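(* Let $\mathfrak g$ be a contragredient Lie algebra of finite growth with symmetrizable Cartan matrix, and $\mathcal A$ a $\mathfrak g$-admissible algebra such that the automorphisms $T_i$ of $U(\mathfrak g)$ admit extensions to automorphisms $T_i:\mathcal A\to\mathcal A$ satisfying the braid group relations of $\mathfrak g$. Let $\check q_i=q_{\alpha_i,\mathfrak n}\circ T_i:\mathcal A'/\mathcal A'\mathfrak n\to\mathcal A'/\mathcal A'\mathfrak n$ for $\alpha_i\in\Pi$. Then: (i) The restriction of $\check q_i$ to $Z^{\mathfrak n}(\mathcal A)$ defines an automorphism of the algebra $Z^{\mathfrak n}(\mathcal A)$, satisfying $\check q_i([h,x])=[s_{\alpha_i}(h),\check q_i(x)]$ for $h\in\mathfrak h$, $\check q_i(xd)=\check q_i(x)\cdot(s_{\alpha_i}\circ d)$ for $d\in D$, and $\check q_i(xy)=\check q_i(x)\check q_i(y)$, for all $x,y\in Z^{\mathfrak n}(\mathcal A)$. (ii) For any $x\in Z^{\mathfrak n}(\mathcal A)$ we have $$\check q_i^{\,2}(x)=(h_{\alpha_i}+1)^{-1}\,T_i^2(x)\,(h_{\alpha_i}+1).$$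
   Context: The ground field is $\mathbb C$. $\mathfrak g$ is a contragredient (Kac–Moody) Lie algebra of finite growth with symmetrizable Cartan matrix $(a_{i,j})$, Gauss decomposition $\mathfrak g=\mathfrak n_-+\mathfrak h+\mathfrak n$, simple roots $\Pi=\{\alpha_i\}$, root system $\Delta=\Delta_+\sqcup\Delta_-$, real roots $\Delta^{re}$, Weyl group $W$. Chevalley generators $e_{\pm\alpha_i}$, $h_{\alpha_i}\in\mathfrak h$ satisfy $[e_{\alpha_i},e_{-\alpha_j}]=\delta_{i,j}h_{\alpha_i}$, $[h_{\alpha_i},e_{\pm\alpha_j}]=\pm a_{i,j}e_{\pm\alpha_j}$ and the Serre relations; $d_i\in\mathbb N$ are such that $(\alpha_i,\alpha_j)=d_ia_{i,j}=d_ja_{j,i}$. For a root $\gamma=\sum n_i\alpha_i$ put $t_\gamma=\sum n_id_ih_{\alpha_i}$; $h_\gamma=2t_\gamma/(\gamma,\gamma)$ (the coroot) if $\gamma$ is real, $h_\gamma=t_\gamma$ if $\gamma$ is imaginary. $D$ is the localization of $U(\mathfrak h)$ at the multiplicative set generated by $\{h_\gamma+k:\gamma\in\Delta,k\in\mathbb Z\}$. For an integral weight $\mu$, $\tau_\mu$ is the automorphism of $D$ with $\tau_\mu(h)=h+\langle h,\mu\rangle$, $h\in\mathfrak h$. The shifted action of a simple reflection is the automorphism $d\mapsto s_{\alpha_i}\circ d$ of $D$ with $s_{\alpha_i}\circ h=s_{\alpha_i}(h)-\langle h,\alpha_i\rangle$ for $h\in\mathfrak h$ (induced by $w\circ\mu=w(\mu+\rho)-\rho$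 on $\mathfrak h^*$). An associative algebra $\mathcal A$ containing $U(\mathfrak g)$ as a subalgebra carries the adjoint action of $U(\mathfrak g)$, denoted $\hat g(a)=\mathrm{ad}_g(a)$, with $\hat g(a)=ga-ag$ for $g\in\mathfrak g$. $\mathcal A$ is called $\mathfrak g$-admissible if: (a) there is a subspace $\mathcal V\subset\mathcal A$, invariant under the adjoint action, such that multiplication induces isomorphisms of vector spaces $U(\mathfrak g)\otimes\mathcal V\to\mathcal A$ and $\mathcal V\otimes U(\mathfrak g)\to\mathcal A$; (b) the adjoint action on $\mathcal V$ of every real root vector is locally nilpotent, and the adjoint action of $\mathfrak h$ on $\mathcal V$ is semisimple. Put $\mathcal A'=D\otimes_{U(\mathfrak h)}\mathcal A$ (the localized algebra); $\mathcal A'\mathfrak n$ is the left ideal generated by $\mathfrak n$. $Z^{\mathfrak n}(\mathcal A)=\mathrm{Nr}(\mathcal A'\mathfrak n)/\mathcal A'\mathfrak n\subset\mathcal A'/\mathcal A'\mathfrak n$ with $\mathrm{Nr}(\mathcal A'\mathfrak n)=\{x\in\mathcal A':\mathfrak nx\subset\mathcal A'\mathfrak n\}$; it is an algebra containing $D$. $T_i$ ($\alpha_i\in\Pi$) are automorphisms of $U(\mathfrak g)$ lifting the simple reflections $s_{\alpha_i}:\mathfrak h\to\mathfrak h$ and satisfying the braid relations $\underbrace{T_iT_jT_i\cdots}_{m_{i,j}}=\underbrace{T_jT_iT_j\cdots}_{m_{i,j}}$ (e.g. those of Lusztig), where $m_{i,j}=2,3,4,6$ if $a_{i,j}a_{j,i}=0,1,2,3$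 respectively and $m_{i,j}=\infty$ (no relation) if $a_{i,j}a_{j,i}>3$. The assumed extensions to $\mathcal A$ satisfy the same relations and are extended canonically to $\mathcal A'$. Put $\mathfrak n^{s_{\alpha_i}}=T_i(\mathfrak n)$, so $T_i$ induces a map $\mathcal A'/\mathcal A'\mathfrak n\to\mathcal A'/\mathcal A'\mathfrak n^{s_{\alpha_i}}$; $T_i^2$ preserves $\mathcal A'\mathfrak n$ and acts on $Z^{\mathfrak n}(\mathcal A)$. For $\alpha=\alpha_i$, the map $q_{\alpha,\mathfrak n}:\mathcal A'\to\mathcal A'/\mathcal A'\mathfrak n$ is $$q_{\alpha,\mathfrak n}(x)=\sum_{n\ge0}\frac{(-1)^n}{n!}\,\hat e_\alpha^{\,n}(x)\,e_{-\alpha}^n\,\big(h_\alpha(h_\alpha-1)\cdots(h_\alpha-n+1)\big)^{-1}\mod\mathcal A'\mathfrak n,\qquad x\in\mathcal A,$$ extended to $\mathcal A'$ by $q_{\alpha,\mathfrak n}(xd)=q_{\alpha,\mathfrak n}(x)\tau_\alpha(d)$, $d\in D$. It vanishes on $\mathcal A'\mathfrak n^{s_\alpha}$ and so induces $q_{\alpha,\mathfrak n}:\mathcal A'/\mathcal A'\mathfrak n^{s_\alpha}\to\mathcal A'/\mathcal A'\mathfrak n$. *)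

(* Defs.v *)
From HB Require Import structures.
From mathcomp Require Import all_boot all_order all_algebra.
From mathcomp Require Import boolp reals complex.

Set Implicit Arguments.
Unset Strict Implicit.
Unset Printing Implicit Defensive.

Import Order.TTheory GRing.Theory Num.Theory.
Local Open Scope ring_scope.
Local Open Scope quotient_scope.

(* ---- Linear algebra in spaces of arbitrary dimension ---- *)

Section Span.
Variables (K : fieldType) (V : lmodType K).

Definition span_of (P : V -> Prop) (x : V) : Prop :=
  exists m (c : 'I_m -> K) (v : 'I_m -> V),
    (forall k, P (v k)) /\ x = \sum_(k < m) c k *: v k.

Definition lin_indep m (v : 'I_m -> V) : Prop :=
  forall c : 'I_m -> K, \sum_(k < m) c k *: v k = 0 -> forall k, c k = 0.

End Span.

(* [is_tensor ract lact b]: the pairing b : X * Y -> Z identifies Z with the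
   tensor product of the right S-module X and the left S-module Y over S. *)
Section Tensor.
Variables (S : Type) (X Y : zmodType).
Variables (ract : X -> S -> X) (lact : S -> Y -> Y).

Definition balanced (M : zmodType) (f : X -> Y -> M) : Prop :=
  [/\ forall x y y', f x (y + y') = f x y + f x y',
      forall x x' y, f (x + x') y = f x y + f x' y
    & forall x s y, f (ract x s) y = f x (lact s y)].

Definition is_tensor (Z : zmodType) (b : X -> Y -> Z) : Prop :=
  balanced b /\
  forall (M : zmodType) (f : X -> Y -> M), balanced f ->
    exists g : {additive Z -> M}, (forall x y, g (b x y) = f x y) /\
      forall g' : {additive Z -> M},
        (forall x y, g' (b x y) = f x y) -> g' =1 g.

End Tensor.

(* ---- Lie algebras and enveloping algebras ---- *)

Record lieAlgebra (K : fieldType) := LieAlgebra {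
  lie_sort :> lmodType K;
  lie_bracket : lie_sort -> lie_sort -> lie_sort;
  lie_linearl : forall c x y z,
    lie_bracket (c *: x + y) z = c *: lie_bracket x z + lie_bracket y z;
  lie_linearr : forall c x y z,
    lie_bracket x (c *: y + z) = c *: lie_bracket x y + lie_bracket x z;
  lie_alt : forall x, lie_bracket x x = 0;
  lie_jacobi : forall x y z,
    lie_bracket x (lie_bracket y z) + lie_bracket y (lie_bracket z x)
      + lie_bracket z (lie_bracket x y) = 0
}.

Notation "[ 'lie' x , y ]" := (lie_bracket x y)
  (at level 0, format "[ 'lie'  x ,  y ]").

Section AbelianLie.
Variables (K : fieldType) (V : lmodType K).

Let br (x y : V) : V := 0.

Fact abelian_linearl c x y z : br (c *: x + y) z = c *: br x z + br y z.
Proof. by rewrite /br scaler0 addr0. Qed.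
Fact abelian_linearr c x y z : br x (c *: y + z) = c *: br x y + br x z.
Proof. by rewrite /br scaler0 addr0. Qed.
Fact abelian_alt x : br x x = 0. Proof. by []. Qed.
Fact abelian_jacobi x y z :
  br x (br y z) + br y (br z x) + br z (br x y) = 0.
Proof. by rewrite /br !addr0. Qed.

Definition abelian_lie : lieAlgebra K :=
  LieAlgebra abelian_linearl abelian_linearr abelian_alt abelian_jacobi.

End AbelianLie.

Section LieTheory.
Variables (K : fieldType) (g : lieAlgebra K).

Definition is_subspace (J : g -> Prop) : Prop :=
  J 0 /\ forall c x y, J x -> J y -> J (c *: x + y).

Definition is_lie_subalgebra (J : g -> Prop) : Prop :=
  is_subspace J /\ forall x y, J x -> J y -> J [lie x, y].

Definition is_lie_ideal (J : g -> Prop) : Prop :=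
  is_subspace J /\ forall x y, J y -> J [lie x, y].

Definition lie_generated (P : g -> Prop) (x : g) : Prop :=
  forall J, is_lie_subalgebra J -> (forall y, P y -> J y) -> J x.

Definition is_lie_morphism (B : algType K) (f : {linear g -> B}) : Prop :=
  forall x y, f [lie x, y] = f x * f y - f y * f x.

Record envelopingAlgebra := EnvelopingAlgebra {
  env_alg :> algType K;
  env_in : {linear g -> env_alg};
  env_in_lie : is_lie_morphism env_in;
  env_universal : forall (B : algType K) (f : {linear g -> B}),
    is_lie_morphism f ->
    exists phi : {lrmorphism env_alg -> B}, (forall x, phi (env_in x) = f x) /\
      forall psi : {lrmorphism env_alg -> B},
        (forall x, psi (env_in x) = f x) -> psi =1 phi
}.

End LieTheory.

(* ---- Contragredient Lie algebras ---- *)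

(* The contragredient Lie algebra of a symmetrizable generalized Cartan matrix
   in the sense of Kac: h is a realization of minimal dimension, and no nonzero
   ideal of g meets h trivially. *)
Record contragredientLie (K : fieldType) := ContragredientLie {
  km_lie :> lieAlgebra K;
  km_rank : nat;
  cartan : 'M[int]_km_rank;
  symm : 'I_km_rank -> nat;                       (* the integers d_i *)
  cartan_diag : forall i, cartan i i = 2;
  cartan_offdiag : forall i j, i != j -> cartan i j <= 0;
  cartan_zero : forall i j, cartan i j = 0 -> cartan j i = 0;
  symm_gt0 : forall i, (0 < symm i)%N;
  cartan_symm : forall i j,
    (symm i)%:Z * cartan i j = (symm j)%:Z * cartan j i;
  km_h : vectType K;
  h_in : {linear km_h -> km_lie};
  coroot : 'I_km_rank -> km_h;
  sroot : 'I_km_rank -> 'Hom(km_h, K^o);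
  e_pos : 'I_km_rank -> km_lie;
  e_neg : 'I_km_rank -> km_lie;
  h_in_inj : injective h_in;
  sroot_free : free [seq sroot i | i <- enum 'I_km_rank];
  coroot_free : free [seq coroot i | i <- enum 'I_km_rank];
  sroot_coroot : forall i j, sroot j (coroot i) = (cartan i j)%:~R;
  dim_h : (\dim (fullv : {vspace km_h})
           + \rank (map_mx intr cartan : 'M[K]_km_rank) = km_rank.*2)%N;
  h_abelian : forall x y, [lie h_in x, h_in y] = 0;
  h_e_pos : forall x i, [lie h_in x, e_pos i] = (sroot i x : K) *: e_pos i;
  h_e_neg : forall x i, [lie h_in x, e_neg i] = - (sroot i x : K) *: e_neg i;
  e_pos_neg : forall i j,
    [lie e_pos i, e_neg j] = if i == j then h_in (coroot i) else 0;
  serre_pos : forall i j, i != j ->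
    iter `|1 - cartan i j|%N (lie_bracket (e_pos i)) (e_pos j) = 0;
  serre_neg : forall i j, i != j ->
    iter `|1 - cartan i j|%N (lie_bracket (e_neg i)) (e_neg j) = 0;
  km_generated : forall x, lie_generated
    (fun y => [\/ exists z, y = h_in z, exists i, y = e_pos i
                | exists i, y = e_neg i]) x;
  km_no_ideal : forall J : km_lie -> Prop, is_lie_ideal J ->
    (forall z, J (h_in z) -> z = 0) -> forall x, J x -> x = 0
}.

Section Roots.
Variables (K : fieldType) (G : contragredientLie K).
Local Notation n := (km_rank G).

(* The row vector gam stands for the element \sum_i gam_i alpha_i of the root
   lattice. *)
Definition lattice_eval (gam : 'rV[int]_n) (x : km_h G) : K :=
  \sum_(i < n) (gam 0 i)%:~R * (sroot i x : K).

Definition root_space (gam : 'rV[int]_n) (x : G) : Prop :=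
  forall z : km_h G, [lie h_in G z, x] = lattice_eval gam z *: x.

Definition is_root (gam : 'rV[int]_n) : Prop :=
  gam <> 0 /\ exists2 x, x <> 0 & root_space gam x.

Definition lattice_reflection (i : 'I_n) (gam : 'rV[int]_n) : 'rV[int]_n :=
  gam - (\sum_(j < n) gam 0 j * cartan G i j) *: delta_mx 0 i.

Inductive real_root : 'rV[int]_n -> Prop :=
| real_simple i : real_root (delta_mx 0 i)
| real_reflect i gam : real_root gam -> real_root (lattice_reflection i gam).

Definition lattice_form (gam eta : 'rV[int]_n) : int :=
  \sum_(i < n) \sum_(j < n) gam 0 i * eta 0 j * ((symm i)%:Z * cartan G i j).

Definition t_root (gam : 'rV[int]_n) : km_h G :=
  \sum_(i < n) ((gam 0 i)%:~R * (symm i)%:R) *: coroot i.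

Definition h_root (gam : 'rV[int]_n) : km_h G :=
  if `[< real_root gam >]
  then (2%:R / (lattice_form gam gam)%:~R) *: t_root gam
  else t_root gam.

Definition simple_reflection (i : 'I_n) (x : km_h G) : km_h G :=
  x - (sroot i x : K) *: coroot i.

Definition nil_pos (x : G) : Prop :=
  lie_generated (fun y => exists i, y = e_pos (c := G) i) x.

(* Polynomial growth of the principal gradation, whose component of degree j
   is the sum of the root spaces of height j. *)
Definition height (gam : 'rV[int]_n) : int := \sum_(i < n) gam 0 i.

Definition height_space (j : int) : G -> Prop :=
  span_of (fun x => exists2 gam, height gam = j & root_space gam x).

Definition finite_growth : Prop :=
  exists c r : nat, forall (j : int) (m : nat) (v : 'I_m -> G),
    (forall k, height_space j (v k)) -> lin_indep v ->
    (m <= c * (`|j|%N).+1 ^ r)%N.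

(* The order m_{ij}; None stands for infinity. *)
Definition braid_order (i j : 'I_n) : option nat :=
  match absz (cartan G i j * cartan G j i) with
  | 0%N => Some 2%N | 1%N => Some 3%N | 2%N => Some 4%N | 3%N => Some 6%N | _ => None
  end.

End Roots.

(* [alternate m f g] is f \o g \o f \o ... with m factors. *)
Fixpoint alternate (X : Type) (m : nat) (f g : X -> X) (x : X) : X :=
  if m is m'.+1 then f (alternate m' g f x) else x.

Definition braid_relations (K : fieldType) (G : contragredientLie K)
    (X : Type) (T : 'I_(km_rank G) -> X -> X) : Prop :=
  forall i j m, i != j -> braid_order i j = Some m ->
    alternate m (T i) (T j) =1 alternate m (T j) (T i).

(* ---- Admissible algebras ---- *)

Definition ad (B : nzRingType) (a x : B) : B := a * x - x * a.

Section Admissible.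
Variables (K : fieldType) (G : contragredientLie K).
Variables (U : envelopingAlgebra G) (A : algType K).
Variable (iA : {lrmorphism U -> A}).

Definition g_in (x : G) : A := iA (env_in U x).

Definition admissible : Prop :=
  exists (V : lmodType K) (v : {linear V -> A}),
    [/\ injective v,
        forall (x : G) (w : V), exists w', ad (g_in x) (v w) = v w',
        is_tensor (fun (u : U) (c : K) => c *: u) (fun c (w : V) => c *: w)
          (fun u w => iA u * v w)
      & is_tensor (fun (w : V) (c : K) => c *: w) (fun c (u : U) => c *: u)
          (fun w u => v w * iA u)]
    /\
    (forall gam (x : G), real_root gam -> root_space gam x ->
       forall w, exists N, iter N (ad (g_in x)) (v w) = 0)
    /\
    (forall w : V, exists m (y : 'I_m -> V) (mu : 'I_m -> km_h G -> K),
       w = \sum_(k < m) y k /\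
       forall k z, ad (g_in (h_in G z)) (v (y k)) = mu k z *: v (y k)).

(* Automorphisms T_i of U(g) induced by automorphisms of g that lift the
   simple reflections. *)
Definition lifts_reflections (T : 'I_(km_rank G) -> {lrmorphism U -> U}) :=
  forall i,
    [/\ bijective (T i),
        forall x, exists y, T i (env_in U x) = env_in U y
      & forall z, T i (env_in U (h_in G z)) =
                  env_in U (h_in G (simple_reflection i z))].

Definition extends (T : 'I_(km_rank G) -> {lrmorphism U -> U})
    (TA : 'I_(km_rank G) -> {lrmorphism A -> A}) :=
  forall i, bijective (TA i) /\ forall u, TA i (iA u) = iA (T i u).

End Admissible.

(* ---- Localization ---- *)

Definition is_localization (B : nzRingType) (S : B -> Prop)
    (D : comUnitRingType) (l : B -> D) : Prop :=
  [/\ forall s, S s -> l s \is a GRing.unit,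
      forall d, exists u s, S s /\ d = l u / l s
    & forall u, l u = 0 -> exists2 s, S s & s * u = 0].

Section Localized.
Variables (K : fieldType) (G : contragredientLie K).
Variables (U : envelopingAlgebra G) (A : algType K).
Variable (iA : {lrmorphism U -> A}).

Inductive mul_generated (B : nzRingType) (P : B -> Prop) : B -> Prop :=
| mul_gen1 : mul_generated P 1
| mul_genM x y : P x -> mul_generated P y -> mul_generated P (x * y).

Definition denominators (Uh : envelopingAlgebra (abelian_lie (km_h G))) :
    Uh -> Prop :=
  mul_generated (fun s => exists gam (k : int), is_root gam /\
    s = env_in Uh (h_root gam : abelian_lie (km_h G)) + k%:~R).

(* U(h) with its map to U(g), the ring D, and the algebra A' whose underlying
   space is the tensor product of D and A over U(h). *)
Record localizedAlgebra := LocalizedAlgebra {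
  loc_Uh : envelopingAlgebra (abelian_lie (km_h G));
  Uh_in : {lrmorphism loc_Uh -> U};
  Uh_inE : forall z : km_h G,
    Uh_in (env_in loc_Uh (z : abelian_lie (km_h G))) = env_in U (h_in G z);
  loc_D : comUnitAlgType K;
  to_D : {lrmorphism loc_Uh -> loc_D};
  to_D_localization : is_localization (@denominators loc_Uh) to_D;
  loc_A : algType K;
  D_in : {lrmorphism loc_D -> loc_A};
  A_in : {lrmorphism A -> loc_A};
  D_A_compat : forall u, D_in (to_D u) = A_in (iA (Uh_in u));
  loc_tensor : is_tensor (fun (d : loc_D) (u : loc_Uh) => d * to_D u)
    (fun (u : loc_Uh) (a : A) => iA (Uh_in u) * a)
    (fun d a => D_in d * A_in a)
}.

End Localized.

(* ---- Quotients by left ideals and their normalizers ---- *)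

Section LeftIdealQuotient.
Variables (B : nzRingType) (N : B -> Prop).

(* The left ideal B N. *)
Definition left_ideal (x : B) : Prop :=
  exists m (a y : 'I_m -> B),
    (forall k, N (y k)) /\ x = \sum_(k < m) a k * y k.

Definition left_idealb : {pred B} := fun x => `[< left_ideal x >].

Fact left_ideal_zmod_closed : zmod_closed left_idealb.
Proof.
split.
  apply/asboolP; exists 0%N, (fun=> 0), (fun=> 0).
  by split; [case | rewrite big_ord0].
move=> _ _ /asboolP [m [a [y [yN ->]]]] /asboolP [p [b [z [zN ->]]]].
apply/asboolP; exists (m + p)%N.
exists (fun k => match split k with inl i => a i | inr i => - b i end).
exists (fun k => match split k with inl i => y i | inr i => z i end).
split=> [k|]; first by case: (split k).
rewrite big_split_ord /= -sumrN; congr (_ + _); apply: eq_bigr => k _.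
  by case: (split_ordP (lshift p k)) => i /eqP;
    rewrite ?eq_lshift ?eq_lrshift // => /eqP ->.
by case: (split_ordP (rshift m k)) => i /eqP;
  rewrite ?eq_rlshift ?eq_rshift // => /eqP ->; rewrite mulNr.
Qed.

HB.instance Definition _ :=
  GRing.isZmodClosed.Build B left_idealb left_ideal_zmod_closed.

Definition left_quot := {ideal_quot left_idealb}.
HB.instance Definition _ := GRing.Zmodule.on left_quot.

Definition cls (x : B) : left_quot := \pi_({ideal_quot left_idealb}) x.
Definition rep (u : left_quot) : B := repr u.

Definition normalizer (x : B) : Prop := forall y, N y -> left_ideal (y * x).

Definition step_algebra (u : left_quot) : Prop :=
  exists2 x, normalizer x & u = cls x.

(* The product is computed on representatives; it is independent of their
   choice as soon as v lies in step_algebra. *)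
Definition qmul (u v : left_quot) : left_quot := cls (rep u * rep v).

End LeftIdealQuotient.

Definition qscale (K : fieldType) (B : algType K) (N : B -> Prop)
    (c : K) (u : left_quot N) : left_quot N := cls N (c *: rep u).

(* ---- Zhelobenko operators ---- *)

Section Zhelobenko.
Variables (K : fieldType) (G : contragredientLie K).
Variables (U : envelopingAlgebra G) (A : algType K).
Variables (iA : {lrmorphism U -> A}) (L : localizedAlgebra iA).
Local Notation A' := (loc_A L).
Local Notation D := (loc_D L).

Definition h_D (z : km_h G) : D :=
  to_D L (env_in (loc_Uh L) (z : abelian_lie (km_h G))).

Definition g_A' (x : G) : A' := A_in L (g_in iA x).

(* The subspace n of A'. *)
Definition n_A' (a : A') : Prop := exists2 x, nil_pos x & a = g_A' x.

Section SimpleRoot.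
Variable (i : 'I_(km_rank G)).

Definition is_shift (tau : {lrmorphism D -> D}) : Prop :=
  forall z, tau (h_D z) = h_D z + (sroot i z : K)%:A.

Definition is_shifted_reflection (s : {lrmorphism D -> D}) : Prop :=
  forall z, s (h_D z) = h_D (simple_reflection i z) - (sroot i z : K)%:A.

Definition q_term (m : nat) (x : A) : A' :=
  ((-1) ^+ m / m`!%:R) *:
    (A_in L (iter m (ad (g_in iA (e_pos i))) x) * g_A' (e_neg i) ^+ m
     * D_in L (\prod_(l < m) (h_D (coroot i) - l%:R))^-1).

(* As A' is spanned by the products of A and D, at most one q satisfies is_q.
   The series is cut at any N such that ad(e_i)^N x = 0; for an admissible
   algebra such an N exists for every x. *)
Definition is_q (tau : D -> D) (q : A' -> left_quot n_A') : Prop :=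
  [/\ forall a b, q (a + b) = q a + q b,
      forall (x : A) (N : nat), iter N (ad (g_in iA (e_pos i))) x = 0 ->
        q (A_in L x) = cls n_A' (\sum_(m < N) q_term m x)
    & forall (a : A') (d : D),
        q (a * D_in L d) = qmul (q a) (cls n_A' (D_in L (tau d)))].

(* T stands for the extension of T_i to A'. *)
Variables (T : A' -> A') (q : A' -> left_quot n_A').

Definition ns_A' (a : A') : Prop := exists2 b, n_A' b & a = T b.

Definition T_induced (u : left_quot n_A') : left_quot ns_A' :=
  cls ns_A' (T (rep u)).

Definition q_induced (u : left_quot ns_A') : left_quot n_A' := q (rep u).

Definition q_check (u : left_quot n_A') : left_quot n_A' :=
  q_induced (T_induced u).

Definition T_square (u : left_quot n_A') : left_quot n_A' :=
  cls n_A' (T (T (rep u))).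

End SimpleRoot.

(* D as a subalgebra of A' / A' n. *)
Definition D_Z (d : D) : left_quot n_A' := cls n_A' (D_in L d).

Definition Z_alg : left_quot n_A' -> Prop := step_algebra (N := n_A').

Definition is_Z_automorphism (f : left_quot n_A' -> left_quot n_A') : Prop :=
  [/\ forall u, Z_alg u -> Z_alg (f u),
      forall u v, Z_alg u -> Z_alg v -> f u = f v -> u = v
    & forall v, Z_alg v -> exists2 u, Z_alg u & f u = v] /\
  [/\ forall (c : K) u v, Z_alg u -> Z_alg v ->
        f (qscale c u + v) = qscale c (f u) + f v,
      f (D_Z 1) = D_Z 1
    & forall u v, Z_alg u -> Z_alg v -> f (qmul u v) = qmul (f u) (f v)].

Definition qcomm (u v : left_quot n_A') : left_quot n_A' :=
  qmul u v - qmul v u.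

End Zhelobenko.

Arguments n_A' {K G U A iA} L a.
Arguments h_D {K G U A iA} L z.
Arguments D_Z {K G U A iA} L d.

(* Main.v *)
(* Write e, f, h for the sl2-triple of a simple root and let m be the nilradical of
   the corresponding minimal parabolic subalgebra, so that n = Ce + m and
   T_i(n) = Cf + m.  If v is the class of 1 in A'/A'T_i(n), then e^(-1) v generates
   a copy of A'/A'n in the quotient of the localization of A'/A'T_i(n) at e by
   A'/A'T_i(n): it is killed by n, and f^k e^(-1) v is e^(-k-1) v up to an invertible
   factor of D.  Under this identification the Zhelobenko map is y v |-> e^(-1) y v,
   whence it vanishes on A'T_i(n), is killed on the left by e, and is
   multiplicative on the elements normalizing A'T_i(n), because right
   multiplication by such an element is an endomorphism of A'/A'T_i(n).

   For (ii), let y = T_i^2(x) normalize A'n.  Solving e y = b e modulo A'm gives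
   y = q(b) modulo A'n.  Expanding the commutators of e y and of b e with log f
   gives (h - 1) T_i(q(T_i(x))) = b (h - 1) modulo e A' and A'T_i(n), both of which
   are killed by q, and applying q yields (h + 1) q(T_i(q(T_i(x)))) = y (h + 1).
   The bijectivity of the operator follows from this formula.

   Passing between A and A' requires A to be spanned by vectors whose weights are
   integral on the coroots; this holds because e_i and f_i act locally
   nilpotently on the admissible algebra. *)
Require Import Defs.
From HB Require Import structures.
From mathcomp Require Import all_boot all_order all_algebra.
From mathcomp Require Import boolp reals complex ring.

Set Implicit Arguments.
Unset Strict Implicit.
Unset Printing Implicit Defensive.

Import Order.TTheory GRing.Theory Num.Theory.
Local Open Scope ring_scope.

(** * The exponential series of an inner derivation *)

(** The localization at e is never built. A polynomial variable t replaces it, through the Laplace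
    formula k! e^(-k-1) = int t^k exp(-t e) dt: since exp(-t e) y = (exp(-t ad e) y) exp(-t e),
    sending t^k to [lower_pow k] turns the polynomial exp(-t ad e) y into e^(-1) y v, and products
    of elements become products of polynomials. The obstacle is that this series is a polynomial
    only where ad e is nilpotent, which holds on A but fails for inverses of denominators. Elements
    of A' are therefore multiplied on the right by a denominator that brings them into the image of
    A; right multiplication by d becomes right multiplication by tau(d), so the denominator can be
    cancelled afterwards. The factor h + 1 in (ii) comes from [f, log e] = - (h + 1) e^(-1), used
    for the opposite triple (f, e, -h) and carried back by the rule Q(h y) = (h + 2) Q(y). *)

Section AdTheory.
Variables (K : fieldType) (A : algType K).
Implicit Types (a x y : A) (c : K).

Lemma adD a x y : ad a (x + y) = ad a x + ad a y.
Proof. by rewrite /ad mulrDr mulrDl opprD addrACA. Qed.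

Lemma ad0 a : ad a 0 = 0. Proof. by rewrite /ad mulr0 mul0r subrr. Qed.

Lemma adN a x : ad a (- x) = - ad a x.
Proof. by rewrite /ad mulrN mulNr opprB opprK addrC. Qed.

Lemma adB a x y : ad a (x - y) = ad a x - ad a y.
Proof. by rewrite adD adN. Qed.

Lemma adZ a c x : ad a (c *: x) = c *: ad a x.
Proof. by rewrite /ad -scalerAr -scalerAl scalerBr. Qed.

Lemma adZl a c x : ad (c *: a) x = c *: ad a x.
Proof. by rewrite /ad -scalerAr -scalerAl scalerBr. Qed.

Lemma adMr a x y : ad a (x * y) = ad a x * y + x * ad a y.
Proof. by rewrite /ad mulrBl mulrBr !mulrA addrA addrNK. Qed.

Lemma ad_sum a I (r : seq I) P (F : I -> A) :
  ad a (\sum_(i <- r | P i) F i) = \sum_(i <- r | P i) ad a (F i).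
Proof. by apply: big_morph; [exact: adD | exact: ad0]. Qed.

Lemma mul_ad a x : a * x = x * a + ad a x.
Proof. by rewrite /ad addrC addrNK. Qed.

Lemma iter_adD a n x y : iter n (ad a) (x + y) = iter n (ad a) x + iter n (ad a) y.
Proof. by elim: n x y => // n IHn x y; rewrite !iterSr adD IHn. Qed.

Lemma iter_ad0 a n : iter n (ad a) 0 = 0.
Proof. by elim: n => // n IHn; rewrite iterSr ad0. Qed.

Lemma iter_adZ a n c x : iter n (ad a) (c *: x) = c *: iter n (ad a) x.
Proof. by elim: n x => // n IHn x; rewrite !iterSr adZ IHn. Qed.

Lemma ad_linear a : linear (@ad A a).
Proof. by move=> c x y; rewrite adD adZ. Qed.
HB.instance Definition _ a := GRing.isLinear.Build K A A *:%R (@ad A a)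
  (ad_linear a).

End AdTheory.

Lemma rmorph_ad (K : fieldType) (A B : algType K) (phi : {lrmorphism A -> B}) a x :
  phi (ad a x) = ad (phi a) (phi x).
Proof. by rewrite /ad rmorphB !rmorphM. Qed.

Lemma rmorph_iter_ad (K : fieldType) (A B : algType K) (phi : {lrmorphism A -> B})
    a x n :
  phi (iter n (ad a) x) = iter n (ad (phi a)) (phi x).
Proof. by elim: n => //= n <-; rewrite rmorph_ad. Qed.

(* [adexp_coef e n x] is the coefficient of t^n in exp(- t ad e) x. *)
Section Series.
Variables (K : numFieldType) (A : algType K) (e : A).

Definition adexp_coef n (x : A) : A :=
  ((-1) ^+ n / n`!%:R) *: iter n (ad e) x.

Lemma adexp_coef0 x : adexp_coef 0 x = x.
Proof. by rewrite /adexp_coef /= fact0 divr1 scale1r. Qed.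

Lemma ad_adexp_coef n x : ad e (adexp_coef n x) = - (adexp_coef n.+1 x *+ n.+1).
Proof.
rewrite /adexp_coef adZ /= -scaler_nat scalerA -scaleNr; congr (_ *: _).
rewrite factS natrM exprS; set u := (-1) ^+ n.
have n0 : n.+1%:R != 0 :> K by rewrite pnatr_eq0.
have f0 : n`!%:R != 0 :> K by rewrite pnatr_eq0 -lt0n fact_gt0.
by move: n.+1%:R n`!%:R n0 f0 => a b a0 b0; field; rewrite a0 b0.
Qed.

Lemma adexp_coef1 x : adexp_coef 1 x = - ad e x.
Proof. by rewrite -[x in RHS]adexp_coef0 ad_adexp_coef opprK. Qed.

Lemma mulrn_inj n (x y : A) : x *+ n.+1 = y *+ n.+1 -> x = y.
Proof.
rewrite -2!scaler_nat => /(congr1 (fun u => n.+1%:R^-1 *: u)).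
by rewrite !scalerA mulVf ?pnatr_eq0 // !scale1r.
Qed.

Lemma adexp_coef2 x : adexp_coef 2 x *+ 2 = ad e (ad e x).
Proof.
by have := ad_adexp_coef 1 x; rewrite adexp_coef1 adN => /oppr_inj ->.
Qed.

(** exp(- t ad e) is multiplicative because ad e is a derivation; the degrees are compared through
    (n + 1) c_(n+1) = - ad e c_n, and n + 1 is cancelled in characteristic zero. *)
Lemma adexp_coefM n x y :
  adexp_coef n (x * y) = \sum_(i < n.+1) adexp_coef i x * adexp_coef (n - i) y.
Proof.
elim: n => [|n IHn]; first by rewrite big_ord1 !adexp_coef0.
apply: (@mulrn_inj n); rewrite -[LHS]opprK -ad_adexp_coef IHn ad_sum -sumrN.
rewrite -sumrMnl.
transitivity (\sum_(i < n.+2) adexp_coef i x *+ i * adexp_coef (n.+1 - i) y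
  + \sum_(i < n.+2) adexp_coef i x * (adexp_coef (n.+1 - i) y *+ (n.+1 - i))).
  rewrite [X in _ = X + _]big_ord_recl [X in _ = _ + X]big_ord_recr /=.
  rewrite subnn !mulr0n mul0r mulr0 add0r addr0 -big_split; apply: eq_bigr => i _ /=.
  rewrite adMr !ad_adexp_coef opprD mulNr mulrN !opprK /bump /= add1n subSS.
  by rewrite (subSn (leq_ord i)).
rewrite -big_split; apply: eq_bigr => i _ /=.
by rewrite mulrnAl mulrnAr -mulrnDr subnKC // -ltnS.
Qed.

(** A relation rather than a function: a polynomial p exists only when ad e is nilpotent on x, and
    its coefficients then determine it. *)
Definition adexp (p : {poly A}) (x : A) : Prop := forall n, p`_n = adexp_coef n x.

Lemma adexp_exists N x : iter N (ad e) x = 0 -> exists p, adexp p x.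
Proof.
move=> xN; exists (\poly_(n < N) adexp_coef n x) => n; rewrite coef_poly.
case: ltnP => // leNn; rewrite /adexp_coef -(subnK leNn) iterD xN iter_ad0.
by rewrite scaler0.
Qed.

Lemma adexpM p r x y : adexp p x -> adexp r y -> adexp (p * r) (x * y).
Proof.
move=> px ry n; rewrite coefM adexp_coefM; apply: eq_bigr => i _.
by rewrite px ry.
Qed.

Lemma adexpD p r x y : adexp p x -> adexp r y -> adexp (p + r) (x + y).
Proof. by move=> px ry n; rewrite coefD px ry /adexp_coef iter_adD scalerDr. Qed.

Lemma adexpB p r x y : adexp p x -> adexp r y -> adexp (p - r) (x - y).
Proof.
move=> px ry n; rewrite coefB px ry /adexp_coef iter_adD -[in LHS]scalerBr.
by rewrite -[- y]scaleN1r iter_adZ scaleN1r.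
Qed.

End Series.

(** * Formal negative powers of e for an sl2-triple *)

Section SL2.
Variables (K : numFieldType) (A : algType K) (e f h : A) (g : nat -> A).
Hypothesis ef : e * f = f * e + h.
Hypothesis hf : h * f = f * (h - 2%:R).
Hypothesis g0 : g 0 = 1.
Hypothesis gS : forall k, (h - k%:R) * g k.+1 = g k.
Hypothesis hg : forall k, h * g k = g k * h.

Implicit Types (p r : {poly A}) (j k : nat).

(** [g k] plays the inverse of h (h - 1) ... (h - k + 1). Keeping it abstract lets the same
    computations serve the triple (e, f, h) and the opposite triple (f, e, -h). *)
Definition lower_pow k : A := f ^+ k * g k.


Lemma hfB c : (h - c%:R) * f = f * (h - c.+2%:R).
Proof.
rewrite mulrBl hf !mulrBr mulr_natl mulr_natr -addrA -opprD; congr (_ - _).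
by rewrite mulr_natr -mulrnDr.
Qed.

(** The classical sl2 commutation formula; its factor h - k is the one that [gS] absorbs into
    [g k.+1]. *)
Lemma ef_pow k : e * f ^+ k.+1 = f ^+ k.+1 * e + f ^+ k * (h - k%:R) *+ k.+1.
Proof.
elim: k => [|k IHk]; first by rewrite expr0 mul1r subr0 mulr1n expr1.
rewrite exprSr mulrA IHk mulrDl -!mulrA ef mulrDr mulrA -exprSr -!addrA.
congr (_ + _); rewrite mulrnAl -mulrA hfB mulrA -exprSr -mulrnAr -mulrDr.
rewrite -[RHS]mulrnAr; congr (_ * _).
rewrite !mulrnBl addrA -mulrS; congr (_ - _).
by rewrite -!mulrnA mulnC.
Qed.

Lemma hfX c k : (h - c%:R) * f ^+ k = f ^+ k * (h - (c + k.*2)%:R).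
Proof.
elim: k c => [|k IHk] c; first by rewrite expr0 mulr1 mul1r addn0.
by rewrite exprS mulrA hfB -mulrA IHk mulrA doubleS !addnS !addSn.
Qed.

Lemma hgB c k : (h - c%:R) * g k = g k * (h - c%:R).
Proof. by rewrite mulrBl mulrBr hg mulr_natl mulr_natr. Qed.

Lemma h_vpow k : h * lower_pow k = lower_pow k * (h - k.*2%:R).
Proof.
have := hfX 0 k; rewrite subr0 add0n /lower_pow => hk.
by rewrite mulrA hk -!mulrA hgB.
Qed.

Lemma f_vpow k : f * lower_pow k = lower_pow k.+1 * (h - k%:R).
Proof. by rewrite /lower_pow -mulrA -hgB gS mulrA -exprS. Qed.

Lemma e_vpow k : e * lower_pow k = lower_pow k.-1 *+ k + f ^+ k * (e * g k).
Proof.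
case: k => [|k]; first by rewrite /lower_pow expr0 !mul1r mulr0n add0r.
rewrite /lower_pow mulrA ef_pow mulrDl -mulrA addrC mulrnAl; congr (_ *+ _ + _).
by rewrite -mulrA gS.
Qed.

(* Modulo the left ideal of e one has e [lower_pow k] = k [lower_pow k.-1], so that
   [lower_pow k] behaves as k! e^(-k-1) v for a formal vector v; in this sense
   [lower_ser k p], for p the series of y, is k! e^(-k-1) y v. *)
Definition lower_ser k (p : {poly A}) : A :=
  \sum_(j < size p) p`_j * lower_pow (j + k).

Lemma vserE N k p : (size p <= N)%N ->
  lower_ser k p = \sum_(j < N) p`_j * lower_pow (j + k).
Proof.
move=> pN; rewrite /lower_ser.
rewrite (big_ord_widen N (fun j => p`_j * lower_pow (j + k))) //.
rewrite big_mkcond; apply: eq_bigr => j _; case: ltnP => // pj.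
by rewrite nth_default // mul0r.
Qed.

Lemma vserD k p r : lower_ser k (p + r) = lower_ser k p + lower_ser k r.
Proof.
pose N := maxn (size p) (size r).
rewrite !(@vserE N) ?leq_maxl ?leq_maxr ?(leq_trans (size_polyD _ _)) //.
by rewrite -big_split; apply: eq_bigr => j _; rewrite coefD mulrDl.
Qed.

Lemma vserN k p : lower_ser k (- p) = - lower_ser k p.
Proof.
rewrite /lower_ser size_polyN -sumrN; apply: eq_bigr => j _.
by rewrite coefN mulNr.
Qed.

Lemma vserB k p r : lower_ser k (p - r) = lower_ser k p - lower_ser k r.
Proof. by rewrite vserD vserN. Qed.

Lemma vser0 k : lower_ser k 0 = 0.
Proof. by rewrite /lower_ser size_poly0 big_ord0. Qed.

Lemma vserCM k c p : lower_ser k (c%:P * p) = c * lower_ser k p.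
Proof.
rewrite (@vserE (size p)) ?mulr_sumr.
  by apply: eq_bigr => j _; rewrite coefCM mulrA.
by rewrite (leq_trans (size_polyMleq _ _)) // size_polyC; case: (c != 0);
  rewrite ?add1n // add0n leq_pred.
Qed.

Lemma vserC k c : lower_ser k c%:P = c * lower_pow k.
Proof.
rewrite (@vserE 1) ?size_polyC ?leq_b1 // big_ord1 coefC eqxx add0n //.
Qed.

Lemma vserXM k p : lower_ser k ('X * p) = lower_ser k.+1 p.
Proof.
rewrite (@vserE (size p).+1).
  rewrite big_ord_recl coefXM mul0r add0r; apply: eq_bigr => j _.
  by rewrite coefXM /= /bump /= add1n addSnnS.
by rewrite (leq_trans (size_polyMleq _ _)) // size_polyX.
Qed.

Lemma vserMX k p : lower_ser k (p * 'X) = lower_ser k.+1 p.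
Proof. by rewrite commr_polyX vserXM. Qed.

Lemma vserXnM k n p : lower_ser k ('X^n * p) = lower_ser (n + k) p.
Proof.
elim: n k => [|n IHn] k; first by rewrite expr0 mul1r.
by rewrite exprS -mulrA vserXM IHn addnS.
Qed.

Lemma vserM k p r :
  lower_ser k (p * r) = \sum_(i < size p) p`_i * lower_ser (i + k) r.
Proof.
rewrite -[p in LHS]coefK poly_def mulr_suml (big_morph _ (vserD k) (vser0 k)).
by apply: eq_bigr => i _; rewrite -mul_polyC -mulrA vserCM vserXnM.
Qed.

End SL2.

Lemma sum_ord_support (M : zmodType) (F : nat -> M) n N :
  (n <= N)%N -> (forall i, (n <= i)%N -> F i = 0) ->
  \sum_(i < n) F i = \sum_(i < N) F i.
Proof.
move=> nN F0; rewrite (big_ord_widen N F) // big_mkcond.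
by apply: eq_bigr => i _; case: ltnP => // /F0.
Qed.

(** * Calculus in the quotient by a left ideal containing e *)

Section SL2Module.
Variables (K : numFieldType) (A : algType K) (e f h : A) (g : nat -> A).
Hypothesis ef : e * f = f * e + h.
Hypothesis hf : h * f = f * (h - 2%:R).
Hypothesis he : h * e = e * (h + 2%:R).
Hypothesis g0 : g 0 = 1.
Hypothesis gS : forall k, (h - k%:R) * g k.+1 = g k.
Hypothesis hg : forall k, h * g k = g k * h.
Variables (M : zmodType) (pi : {additive A -> M}).
Hypothesis piM : forall a x, pi x = 0 -> pi (a * x) = 0.
Hypothesis pieg : forall k, pi (e * g k) = 0.
Implicit Types (p r : {poly A}) (j k : nat).
Local Notation vpow := (lower_pow f g).
Local Notation vser := (lower_ser f g).

Lemma pi_congrM a x y : pi x = pi y -> pi (a * x) = pi (a * y).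
Proof.
move=> xy; apply/eqP; rewrite -subr_eq0 -raddfB -mulrBr piM //.
by rewrite raddfB xy subrr.
Qed.

Lemma pi_e_vpow a k : pi (a * (e * vpow k)) = pi (a * vpow k.-1) *+ k.
Proof.
rewrite (e_vpow ef hf gS) mulrDr raddfD /= [X in _ + X]piM; last exact/piM/pieg.
by rewrite addr0 mulrnAr raddfMn.
Qed.

(** Formally e k! e^(-k-1) = k (k - 1)! e^(-k). Moving e past a coefficient produces the next
    coefficient times its degree, and the shifted sums cancel up to the factor k. For k = 0 the
    truncated index is harmless, its multiplicity being 0. *)
Lemma pi_e_vser k r y : adexp e r y -> pi (e * vser k r) = pi (vser k.-1 r) *+ k.
Proof.
move=> ry; rewrite /vser mulr_sumr -(raddfMn pi) -sumrMnl /= !raddf_sum /=.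
pose G j := pi (r`_j * vpow (j + k).-1).
transitivity (\sum_(j < size r) (- (G j.+1 *+ j.+1) + G j *+ (j + k))).
  apply: eq_bigr => j _; rewrite mulrA [e * _]mul_ad mulrDl addrC raddfD /=.
  congr (_ + _); last by rewrite -mulrA pi_e_vpow.
  by rewrite ry ad_adexp_coef mulNr raddfN mulrnAl raddfMn /G ry addSn.
have Gr : G (size r) = 0 by rewrite /G nth_default // mul0r raddf0.
rewrite big_split /= sumrN.
have -> : \sum_(j < size r) G j.+1 *+ j.+1 = \sum_(j < size r) G j *+ j.
  transitivity (\sum_(j < (size r).+1) G j *+ j).
    by rewrite big_ord_recl mulr0n add0r.
  by rewrite big_ord_recr /= Gr mul0rn addr0.
rewrite addrC -sumrB; apply: eq_bigr => j _; rewrite mulrnDr addrAC subrr add0r.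
by rewrite raddfMn /G; case: (k) => [|k']; rewrite ?mulr0n // addnS.
Qed.

Lemma adexp_cartan z c :
  e * z = z * e - c *: e -> adexp e (z%:P + (c *: e)%:P * 'X) z.
Proof.
move=> ez; have ead : ad e z = - (c *: e) by rewrite /ad ez addrAC subrr add0r.
move=> n; rewrite coefD coefC coefMX coefC.
case: n => [|[|n]] /=; rewrite ?addr0 ?add0r ?adexp_coef0 //.
  by rewrite adexp_coef1 ead opprK.
rewrite /adexp_coef 2!iterSr ead adN adZ /ad subrr scaler0 oppr0 iter_ad0.
by rewrite scaler0.
Qed.


Lemma z_vpow z c k : z * f = f * (z - c%:A) -> (forall j, z * g j = g j * z) ->
  z * vpow k = vpow k * (z - c%:A *+ k).
Proof.
move=> zf zg; have cg x j : c%:A * x = x * c%:A :> A.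
  by rewrite -scalerAl mul1r -scalerAr mulr1.
rewrite /lower_pow mulrA; have -> : z * f ^+ k = f ^+ k * (z - c%:A *+ k).
  elim: k => [|k IHk]; first by rewrite expr0 mulr1 mul1r subr0.
  rewrite exprSr mulrA IHk -!mulrA; congr (_ * _).
  rewrite mulrBl zf !mulrBr mulrnAl cg // -mulrnAr -addrA; congr (_ + _).
  by rewrite -opprD -mulrDr -mulrS.
rewrite -!mulrA; congr (_ * _).
by rewrite mulrBl mulrBr zg mulrnAl mulrnAr cg.
Qed.

Lemma pi_vserM k p (s : {poly A}) d :
    (forall j a, pi (a * vser j s) = pi (a * (vpow j * d))) ->
  pi (vser k (p * s)) = pi (vser k p * d).
Proof.
move=> sd; rewrite vserM /lower_ser mulr_suml !raddf_sum; apply: eq_bigr => i _.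
by rewrite sd mulrA.
Qed.


(** The origin of tau: when z + c e t is the series of z, right multiplication by z before e^(-1) is
    applied amounts to right multiplication by z + c after it. *)
Lemma pi_vser_cartan z c k p : z * f = f * (z - c%:A) ->
    (forall j, z * g j = g j * z) ->
  pi (vser k (p * (z%:P + (c *: e)%:P * 'X))) = pi (vser k p * (z + c%:A)).
Proof.
move=> zf zg; apply: pi_vserM => {}k a.
rewrite vserD vserMX !vserC (z_vpow _ zf zg) mulrDr raddfD /=.
rewrite -scalerAl -scalerAr scalerAl pi_e_vpow -(raddfMn pi).
rewrite -raddfD /=; congr (pi _).
rewrite -scalerAl scalerAr -mulrnAr -mulrDr; congr (_ * _).
rewrite -[c *: lower_pow _ _ _]mulr1 -scalerAl scalerAr -mulrnAr -mulrDr.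
by rewrite mulrSr addrA addrNK.
Qed.

(** Here z stays on the left instead: commuting it through e^(-k-1) shifts it by k + 1 times its
    weight. *)
Lemma pi_cartan_vser z c k r y : adexp e r y ->
  pi (vser k ((z%:P + (c *: e)%:P * 'X) * r)) =
  pi ((z + (c *+ k.+1)%:A) * vser k r).
Proof.
move=> ry; rewrite mulrDl vserD vserCM -mulrA vserCM vserXM mulrDl !raddfD /=.
congr (_ + _).
have -> x : (c *: e) * x = c%:A * (e * x) by rewrite -!scalerAl mul1r.
rewrite (@pi_congrM _ _ (vser k r *+ k.+1)).
  by rewrite mulrnAr -mulrnAl scalerMnl.
by rewrite (raddfMn pi) (pi_e_vser _ ry).
Qed.

Lemma adexp_f : adexp e (f%:P - h%:P * 'X - e%:P * 'X^2) f.
Proof.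
have ad1 : ad e f = h by rewrite /ad ef addrAC subrr add0r.
have ad2 : ad e h = - e *+ 2.
  by rewrite /ad he mulrDr mulr_natr opprD addrA subrr add0r mulNrn.
move=> n; rewrite !coefB coefC coefMX coefCM coefXn coefC.
case: n => [|[|[|n]]] /=; rewrite ?subr0 ?sub0r ?mulr0 ?mulr1 ?subr0 ?oppr0.
- by rewrite adexp_coef0.
- by rewrite adexp_coef1 ad1.
- apply: (@mulrn_inj _ _ 1); rewrite adexp_coef2 ad1 ad2 //.
- rewrite /adexp_coef 3!iterSr ad1 ad2 -scaler_nat adZ adN /ad subrr oppr0.
  by rewrite !scaler0 iter_ad0 scaler0.
Qed.

(** Reflects f v = 0: the three terms are [lower_pow k.+1] times h - k, - (h - 2 (k + 1)) and - (k +
    2), whose sum is zero. *)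
Lemma pi_vser_f k p : pi (vser k (p * (f%:P - h%:P * 'X - e%:P * 'X^2))) = 0.
Proof.
rewrite (@pi_vserM _ _ _ 0) ?mulr0 ?raddf0 // => {}k a.
rewrite !vserB expr2 mulrA !vserMX !vserC (f_vpow _ gS hg) (h_vpow hf hg).
have k2 : k.+1.*2%:R - k%:R = k.+2%:R :> A.
  by rewrite -addnn addSnnS natrD addrAC subrr add0r.
rewrite -mulrBr opprB [h - _ + _]addrC addrA addrNK k2 !mulr0 raddf0 mulrBr.
rewrite raddfB /= pi_e_vpow; apply/eqP; rewrite subr_eq0 -(raddfMn pi) -mulrnAr.
by rewrite mulr_natr.
Qed.

(** Pulls f to the left out of e^(-k-1) f y v; the constant k + 2 is the multiplicity with which e
    lowers the vector of index k + 2. *)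
Lemma pi_f_vser k r y : adexp e r y ->
  pi (vser k ((f%:P - h%:P * 'X - e%:P * 'X^2) * r)) =
  pi (f * vser k r - (h + k.+2%:R) * vser k.+1 r).
Proof.
move=> ry; rewrite !mulrBl !vserB -[_ * 'X^2 * r]mulrA -[_ * 'X * r]mulrA !vserCM.
rewrite vserXnM vserXM add2n.
rewrite -addrA -opprD mulrDl !raddfB /= !raddfD /= (pi_e_vser _ ry) /=.
by rewrite [_%:R * _]mulr_natl (raddfMn pi).
Qed.

Lemma adexp_e : adexp e e%:P e.
Proof.
move=> [|n]; rewrite coefC ?adexp_coef0 //.
by rewrite /adexp_coef iterSr /ad subrr iter_ad0 scaler0.
Qed.

Lemma poly_split_coef0 p : exists p', p = (p`_0)%:P + p' * 'X.
Proof.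
exists (\poly_(j < size p) p`_j.+1); apply/polyP => -[|j].
  by rewrite coefD coefC coefMX addr0.
rewrite coefD coefC coefMX add0r coef_poly; case: ltnP => // pj.
by rewrite nth_default // (leq_trans pj).
Qed.

(* For p the series of y, the sum of the p_(j+1) [vpow j] is formally the
   commutator of y and log e applied to v; the proof evaluates these sums for
   f y and b f, which differ by an element of no effect. *)
Lemma sl2_exchange r s y b : adexp e r y -> adexp e s b ->
    (forall n k, pi (adexp_coef e n (f * y - b * f) * vpow k) = 0) ->
  exists V, pi ((h + 1) * vser 0 r - b * (h + 1)) = pi (f * V).
Proof.
move=> ry sb; set pf := f%:P - h%:P * 'X - e%:P * 'X^2 => yb0.
have [r' Er] := poly_split_coef0 r; have [s' Es] := poly_split_coef0 s.
(* Removing the constant term of a series and shifting it gives the commutator with log e: r' stands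
   for [y, log e], s' for [b, log e], - w for [f, log e], and u for [f y - b f, log e] by the
   Leibniz rule. *)
exists (vser 0 r'); pose w := h%:P + e%:P * 'X : {poly A}.
pose u := (f%:P * r' - w * r) - (s' * f%:P - s * w).
have Epf : pf = f%:P - w * 'X by rewrite /pf mulrDl opprD addrA expr2 mulrA.
have Eu : pf * r - s * pf = (f * r`_0 - s`_0 * f)%:P + u * 'X.
  have FR : f%:P * r = (f * r`_0)%:P + f%:P * r' * 'X.
    by rewrite {1}Er mulrDr polyCM mulrA.
  have FS : s * f%:P = (s`_0 * f)%:P + s' * f%:P * 'X.
    by rewrite {1}Es mulrDl polyCM -!mulrA commr_polyX.
  rewrite Epf mulrBl mulrBr FR FS -[w * 'X * r]mulrA -commr_polyX !mulrA.
  rewrite /u !mulrBl polyCB -[_ + _ - w * r * 'X]addrA -[X in _ - X]addrA opprD.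
  by rewrite addrACA.
have pu k : pi (vser k u) = 0.
  rewrite /lower_ser raddf_sum big1 // => n _.
  have <- : (pf * r - s * pf)`_n.+1 = u`_n.
    by rewrite Eu coefD coefC coefMX add0r.
  have -> : (pf * r - s * pf)`_n.+1 = adexp_coef e n.+1 (f * y - b * f).
    exact: (adexpB (adexpM adexp_f ry) (adexpM sb adexp_f)).
  exact: yb0.
have ps : pi (vser 0 (s' * f%:P - s * w)) = - pi (b * (h + 1)).
  have s0 : s`_0 = b by rewrite sb adexp_coef0.
  pose G n := pi (s`_n * (vpow n * (h + 1 - n%:R))).
  have s'E n : s'`_n = s`_n.+1 by rewrite Es coefD coefC coefMX add0r.
  have Gs n : (size s <= n)%N -> G n = 0.
    by move=> sn; rewrite /G nth_default // mul0r raddf0.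
  have Gs' n : (size s' <= n)%N -> G n.+1 = 0.
    by move=> sn; rewrite /G -s'E nth_default // mul0r raddf0.
  pose N := maxn (size s) (size s').
  (* Both parts are sums of the same G, one of them shifted by one, so only - G 0 = - pi (b (h + 1))
     survives. *)
  have -> : pi (vser 0 (s' * f%:P - s * w)) =
            \sum_(n < N) G n.+1 - \sum_(n < N.+1) G n.
    rewrite vserB !vserM raddfB; congr (_ - _); rewrite raddf_sum /=.
      rewrite -(sum_ord_support _ Gs') ?leq_maxr //; apply: eq_bigr => n _.
      rewrite addn0 vserC (f_vpow _ gS hg) s'E /G; congr (pi (_ * (_ * _))).
      by rewrite mulrS opprD addrA addrK.
    rewrite -(sum_ord_support _ Gs) ?leqW ?leq_maxl //; apply: eq_bigr => n _.
    rewrite addn0 /w vserD vserMX !vserC (h_vpow hf hg) mulrDr raddfD /=.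
    rewrite pi_e_vpow -(raddfMn pi) -raddfD /= -mulrnAr -mulrDr /G.
    rewrite -[X in _ + X]mulr_natr -mulrDr -addnn natrD mulrSr.
    by rewrite opprD !addrA addrNK addrAC.
  rewrite big_ord_recl opprD addrCA subrr addr0 /G s0 /lower_pow expr0 g0.
  by rewrite mulr1 mul1r subr0.
(* The summand e t of w meets a vector of index one, on which e has multiplicity 1: this turns h
   into h + 1. *)
move: (pu 0); rewrite /u vserB raddfB /= ps opprK vserB vserCM mulrDl.
rewrite vserD vserCM -[_ * 'X * r]mulrA vserCM vserXM !raddfB !raddfD /=.
rewrite (pi_e_vser _ ry) mulr1n mulrDl mul1r raddfD /= => /eqP.
by rewrite -opprD addrAC subr_eq0 => /eqP <-; rewrite addrK.
Qed.

End SL2Module.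

(** * The Zhelobenko map of an sl2-triple *)

Inductive addspan (V : zmodType) (P : V -> Prop) : V -> Prop :=
| addspan0 : addspan P 0
| addspan_cons x y : P x -> addspan P y -> addspan P (x + y).

Section AddSpan.
Variables (V : zmodType) (P : V -> Prop).

Lemma addspan_gen x : P x -> addspan P x.
Proof. by move=> Px; rewrite -[x]addr0; do 2?constructor. Qed.

Lemma addspanD x y : addspan P x -> addspan P y -> addspan P (x + y).
Proof.
by elim=> [|u v Pu _ IH] Py; rewrite ?add0r // -addrA; constructor; auto.
Qed.

Lemma addspan_sum n (F : 'I_n -> V) :
  (forall i, addspan P (F i)) -> addspan P (\sum_(i < n) F i).
Proof.
by move=> PF; apply: big_ind => //; [exact: addspan0 | exact: addspanD].
Qed.

Lemma addspan_ind_additive (Q : V -> Prop) : Q 0 ->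
    (forall x y, Q x -> Q y -> Q (x + y)) -> (forall x, P x -> Q x) ->
  forall x, addspan P x -> Q x.
Proof. by move=> Q0 QD PQ x; elim=> // u v /PQ Qu _ Qv; exact: QD. Qed.

End AddSpan.

(* The rank one situation: [e], [f] and [iD H] form an sl2-triple, [B] is a
   subalgebra with A = B D, and [mm] spans the nilradical of the minimal
   parabolic subalgebra.  [pi] and [pis] are the quotients by the left ideals
   of the two Borel subalgebras contained in it.  [US] and [S] are the images in
   D of U(h) and of the set of denominators. *)
Section RankOne.
Variables (K : numFieldType) (A : algType K) (D : comUnitAlgType K).
Variables (iD : {lrmorphism D -> A}) (tau : {lrmorphism D -> D}).
Variables (e f : A) (H : D) (B mm : A -> Prop) (US S : D -> Prop).
Variables (M Ms : zmodType) (pi : {additive A -> M}) (pis : {additive A -> Ms}).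

Definition nil_ideal := addspan (fun x => exists a z, mm z /\ x = a * z).
Local Notation h := (iD H).

Hypothesis ef : e * f = f * e + h.
Hypothesis fd : forall d, f * iD d = iD (tau d) * f.
Hypothesis de : forall d, iD d * e = e * iD (tau d).
Hypothesis tauH : tau H = H + 2%:R.
Hypothesis tau_surj : forall d, exists d', tau d' = d.
Hypothesis unitH : forall k : int, H + k%:~R \is a GRing.unit.

Definition sl2_inv k : A := iD (\prod_(l < k) (H - l%:R))^-1.
Definition sl2_inv' k : A := iD (\prod_(l < k) (- H - l%:R))^-1.
Local Notation vser := (lower_ser f sl2_inv).
Local Notation vser' := (lower_ser e sl2_inv').

(** Only U(h), and not all of D, has polynomial series under ad e; fractions are reached later
    through [D_frac]. *)
Hypothesis US_adexp : forall u, US u -> exists2 pu, adexp e pu (iD u) &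
  forall k p, pi (vser k (p * pu)) = pi (vser k p * iD (tau u)).
Hypothesis US1 : US 1.
Hypothesis USM : forall u v, US u -> US v -> US (u * v).
Hypothesis UStau : forall u, US u -> US (tau u).
Hypothesis S_US : forall s, S s -> US s.
Hypothesis S_unit : forall s, S s -> s \is a GRing.unit.
Hypothesis SM : forall s t, S s -> S t -> S (s * t).
Hypothesis D_frac : forall d, exists u s, [/\ US u, S s & d * s = u].

Hypothesis B_US : forall u, US u -> B (iD u).
Hypothesis B_M : forall x y, B x -> B y -> B (x * y).
Hypothesis B_adexp : forall x, B x -> exists p, adexp e p x.
Hypothesis B_adexp' : forall x, B x -> exists p, adexp f p x.
Hypothesis B_frac : forall a, exists2 s, S s & B (a * iD s).

Hypothesis mm_B : forall z, mm z -> B z.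
Hypothesis mm_e : forall z, mm z -> mm (ad e z).
Hypothesis mm_f : forall z, mm z -> mm (ad f z).
Hypothesis mm_D : forall z d, mm z -> nil_ideal (z * iD d).
Hypothesis D_mm : forall d z, mm z ->
  addspan (fun x => exists z' d', mm z' /\ x = z' * iD d') (iD d * z).

Hypothesis pi_ker : forall x, pi x = 0 <-> exists a, nil_ideal (x - a * e).
Hypothesis pis_ker : forall x, pis x = 0 <-> exists a, nil_ideal (x - a * f).

Lemma nil_idealM a x : nil_ideal x -> nil_ideal (a * x).
Proof.
elim/addspan_ind_additive => [|u v|_ [b [z [mz ->]]]].
- by rewrite mulr0; constructor.
- by rewrite mulrDr; exact: addspanD.
- by rewrite mulrA; apply: addspan_gen; exists (a * b), z.
Qed.

Lemma nil_idealN x : nil_ideal x -> nil_ideal (- x).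
Proof. by rewrite -mulN1r; exact: nil_idealM. Qed.

Lemma nil_idealZ c x : nil_ideal x -> nil_ideal (c *: x).
Proof. by rewrite -mulr_algl; exact: nil_idealM. Qed.

Lemma mm_nil_ideal z : mm z -> nil_ideal z.
Proof. by move=> mz; apply: addspan_gen; exists 1, z; rewrite mul1r. Qed.

Lemma nil_idealMr x y : (forall z, mm z -> nil_ideal (z * y)) ->
  nil_ideal x -> nil_ideal (x * y).
Proof.
move=> my; elim/addspan_ind_additive => [|u v|_ [b [z [mz ->]]]].
- by rewrite mul0r; constructor.
- by rewrite mulrDl; exact: addspanD.
- by rewrite -mulrA; apply/nil_idealM/my.
Qed.

Lemma nil_ideal_e x : nil_ideal x -> nil_ideal (x * e).
Proof.
apply: nil_idealMr => z mz; rewrite -[z * e](subKr (e * z)).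
by apply: addspanD; [exact/nil_idealM/mm_nil_ideal |
  exact/nil_idealN/mm_nil_ideal/mm_e].
Qed.

Lemma nil_ideal_f x : nil_ideal x -> nil_ideal (x * f).
Proof.
apply: nil_idealMr => z mz; rewrite -[z * f](subKr (f * z)).
by apply: addspanD; [exact/nil_idealM/mm_nil_ideal |
  exact/nil_idealN/mm_nil_ideal/mm_f].
Qed.

Lemma nil_ideal_D x d : nil_ideal x -> nil_ideal (x * iD d).
Proof. by apply: nil_idealMr => z; exact: mm_D. Qed.

Lemma nil_ideal_vpow x k : nil_ideal x -> nil_ideal (x * lower_pow f sl2_inv k).
Proof.
rewrite /lower_pow mulrA => mx; apply: nil_ideal_D; elim: k => [|k IHk].
  by rewrite mulr1.
by rewrite exprSr mulrA; exact: nil_ideal_f.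
Qed.

Lemma nil_ideal_vpow' x k : nil_ideal x -> nil_ideal (x * lower_pow e sl2_inv' k).
Proof.
rewrite /lower_pow mulrA => mx; apply: nil_ideal_D; elim: k => [|k IHk].
  by rewrite mulr1.
by rewrite exprSr mulrA; exact: nil_ideal_e.
Qed.

Lemma nil_ideal_adexp x n : nil_ideal x -> nil_ideal (adexp_coef e n x).
Proof.
move=> mx; apply: nil_idealZ; elim: n => //= n IHn; rewrite /ad.
by apply: addspanD; [exact: nil_idealM | exact/nil_idealN/nil_ideal_e].
Qed.

Lemma nil_ideal_adexp' x n : nil_ideal x -> nil_ideal (adexp_coef f n x).
Proof.
move=> mx; apply: nil_idealZ; elim: n => //= n IHn; rewrite /ad.
by apply: addspanD; [exact: nil_idealM | exact/nil_idealN/nil_ideal_f].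
Qed.

Lemma pi_nil x : nil_ideal x -> pi x = 0.
Proof. by move=> mx; apply/pi_ker; exists 0; rewrite mul0r subr0. Qed.

Lemma pis_nil x : nil_ideal x -> pis x = 0.
Proof. by move=> mx; apply/pis_ker; exists 0; rewrite mul0r subr0. Qed.

Lemma piM a x : pi x = 0 -> pi (a * x) = 0.
Proof.
case/pi_ker=> b mb; apply/pi_ker; exists (a * b).
by rewrite -mulrA -mulrBr; exact: nil_idealM.
Qed.

Lemma pisM a x : pis x = 0 -> pis (a * x) = 0.
Proof.
case/pis_ker=> b mb; apply/pis_ker; exists (a * b).
by rewrite -mulrA -mulrBr; exact: nil_idealM.
Qed.

Lemma pi_e a : pi (a * e) = 0.
Proof. by apply/pi_ker; exists a; rewrite subrr; constructor. Qed.

Lemma pis_f a : pis (a * f) = 0.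
Proof. by apply/pis_ker; exists a; rewrite subrr; constructor. Qed.

(** Since tau is onto, any d can be moved to the left of e, while the nilradical part is stable by
    [mm_D]. *)
Lemma piD0 x d : pi x = 0 -> pi (x * iD d) = 0.
Proof.
case/pi_ker=> b mb; have [d' <-] := tau_surj d.
apply/pi_ker; exists (b * iD d'); rewrite -mulrA de mulrA -mulrBl.
exact: nil_ideal_D.
Qed.

Lemma pi_eqP x y : pi x = pi y <-> pi (x - y) = 0.
Proof.
by rewrite raddfB; split => [->|/eqP]; rewrite ?subrr // subr_eq0 => /eqP.
Qed.

Lemma piMl a x y : pi x = pi y -> pi (a * x) = pi (a * y).
Proof. by move=> /pi_eqP xy; apply/pi_eqP; rewrite -mulrBr; exact: piM. Qed.

Lemma piD x y d : pi x = pi y -> pi (x * iD d) = pi (y * iD d).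
Proof. by move=> /pi_eqP xy; apply/pi_eqP; rewrite -mulrBl; exact: piD0. Qed.

Lemma pi_cancelr u x y : u \is a GRing.unit ->
  pi (x * iD u) = pi (y * iD u) -> pi x = pi y.
Proof.
by move=> Uu /(piD u^-1); rewrite -!mulrA -!rmorphM divrr // rmorph1 !mulr1.
Qed.

Lemma pi_cancell u x y : u \is a GRing.unit ->
  pi (iD u * x) = pi (iD u * y) -> pi x = pi y.
Proof.
by move=> Uu /(piMl (iD u^-1)); rewrite !mulrA -!rmorphM mulVr // rmorph1 !mul1r.
Qed.

Lemma unitHn k : H - k%:R \is a GRing.unit.
Proof. by have := unitH (- k%:Z); rewrite rmorphN /= -pmulrn. Qed.

Lemma hf_comm : h * f = f * (h - 2%:R).
Proof.
have -> : 2%:R = iD 2%:R by rewrite rmorph_nat.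
by rewrite -rmorphB fd rmorphB /= tauH rmorph_nat addrK.
Qed.

Lemma he_comm : h * e = e * (h + 2%:R).
Proof. by rewrite de tauH rmorphD rmorph_nat. Qed.

Lemma sl2_inv0 : sl2_inv 0 = 1.
Proof. by rewrite /sl2_inv big_ord0 invr1 rmorph1. Qed.

Lemma sl2_invS k : (h - k%:R) * sl2_inv k.+1 = sl2_inv k.
Proof.
rewrite -[k%:R](rmorph_nat iD) -rmorphB -rmorphM big_ord_recr /=.
rewrite invrM ?unitHn //; last by apply: rpred_prod => i _; exact: unitHn.
by rewrite mulrA divrr ?unitHn // mul1r.
Qed.

Lemma sl2_invC k : h * sl2_inv k = sl2_inv k * h.
Proof. by rewrite -!rmorphM mulrC. Qed.

Lemma sl2_inv'0 : sl2_inv' 0 = 1.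
Proof. by rewrite /sl2_inv' big_ord0 invr1 rmorph1. Qed.

Lemma unitHn' k : - H - k%:R \is a GRing.unit.
Proof. by rewrite -opprD unitrN; have := unitH k; rewrite -pmulrn. Qed.

Lemma sl2_inv'S k : (- h - k%:R) * sl2_inv' k.+1 = sl2_inv' k.
Proof.
rewrite -[k%:R](rmorph_nat iD) -rmorphN -rmorphB -rmorphM big_ord_recr /=.
rewrite invrM ?unitHn' //; last by apply: rpred_prod => i _; exact: unitHn'.
by rewrite mulrA divrr ?unitHn' // mul1r.
Qed.

Lemma sl2_inv'C k : - h * sl2_inv' k = sl2_inv' k * - h.
Proof. by rewrite mulNr mulrN -!rmorphM mulrC. Qed.

Lemma fe_comm : f * e = e * f + - h.
Proof. by rewrite ef addrK. Qed.

Lemma hf_comm' : - h * e = e * (- h - 2%:R).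
Proof. by rewrite mulNr he_comm -mulrN opprD. Qed.

Lemma he_comm' : - h * f = f * (- h + 2%:R).
Proof. by rewrite mulNr hf_comm -mulrN opprB addrC. Qed.

Lemma pieg k : pi (e * sl2_inv k) = 0.
Proof. by apply: piD0; rewrite -[e]mul1r pi_e. Qed.

Lemma pisfg k : pis (f * sl2_inv' k) = 0.
Proof. by rewrite /sl2_inv' fd pis_f. Qed.

Let vserM_e := pi_e_vser ef hf_comm sl2_invS piM pieg.

Lemma adexp_uniq x p r : adexp e p x -> adexp e r x -> p = r.
Proof. by move=> px rx; apply/polyP => n; rewrite px rx. Qed.

Lemma B_frac_adexp y : exists s p,
  [/\ S s, B (y * iD s) & adexp e p (y * iD s)].
Proof.
have [s Ss Bs] := B_frac y; have [p px] := B_adexp Bs.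
by exists s, p; split.
Qed.

Lemma B_MUS b u : B b -> US u -> B (b * iD u).
Proof. by move=> Bb Uu; apply: B_M => //; exact: B_US. Qed.

(** Extends [lower_ser] from B to the whole algebra by clearing denominators on the right. Two
    choices agree because p * r0 and p0 * r are both the series of y s s0. *)
Lemma qser_exists y k : exists c, forall s p, US s -> adexp e p (y * iD s) ->
  pi (c * iD (tau s)) = pi (vser k p).
Proof.
have [s0 [p0 [Ss0 _ p0y]]] := B_frac_adexp y.
have Us0 := S_unit Ss0; have [r0 r0s r0V] := US_adexp (S_US Ss0).
exists (vser k p0 * iD (tau s0)^-1) => s p Us py.
have [r rs rV] := US_adexp Us.
have Epp : p * r0 = p0 * r.
  apply: (@adexp_uniq (y * iD s * iD s0)); first exact: adexpM.
  have -> : y * iD s * iD s0 = y * iD s0 * iD s.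
    by rewrite -!mulrA -!rmorphM mulrC.
  exact: adexpM.
apply: (@pi_cancelr (tau s0)); first by rewrite rmorph_unit.
rewrite -r0V Epp rV -!mulrA -!(rmorphM iD) [tau s * _]mulrC mulKr //.
by rewrite rmorph_unit.
Qed.

(** Formally k! e^(-k-1) y v for an arbitrary y; only its class under [pi] is meaningful. *)
Definition qser k y := projT1 (cid (qser_exists y k)).

Lemma qserP k y s p : US s -> adexp e p (y * iD s) ->
  pi (qser k y * iD (tau s)) = pi (vser k p).
Proof. exact: projT2 (cid (qser_exists y k)) s p. Qed.

Lemma qserE k b p : adexp e p b -> pi (qser k b) = pi (vser k p).
Proof.
move=> pb; rewrite -(@qserP k b 1 p) ?rmorph1 ?mulr1 //.
Qed.

Lemma qser_D k y d : pi (qser k (y * iD d)) = pi (qser k y * iD (tau d)).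
Proof.
have [u [s2 [Uu Ss2 E]]] := D_frac d; have [s1 [p [Ss1 _ py]]] := B_frac_adexp y.
have Us : US (s1 * s2) by apply: USM; exact: S_US.
have Us12 : tau (s1 * s2) \is a GRing.unit.
  by rewrite rmorph_unit // unitrM !S_unit.
have [r ru rV] := US_adexp Uu.
have Ed : y * iD d * iD (s1 * s2) = y * iD s1 * iD u.
  by rewrite -!mulrA -!rmorphM -E mulrCA.
apply: (pi_cancelr Us12); rewrite (@qserP _ _ _ (p * r)) //; last first.
  by rewrite Ed; exact: adexpM.
rewrite rV -(piD _ (qserP k (S_US Ss1) py)) -!mulrA -!rmorphM -E.
by rewrite mulrCA.
Qed.

Lemma B_frac2 x y : exists s, [/\ S s, B (x * iD s) & B (y * iD s)].
Proof.
have [s Ss Bx] := B_frac x; have [t St By] := B_frac y.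
exists (s * t); split; first exact: SM.
  by rewrite rmorphM mulrA; exact/B_MUS/S_US.
by rewrite mulrC rmorphM mulrA; exact/B_MUS/S_US.
Qed.

Lemma qserDr k x y : pi (qser k (x + y)) = pi (qser k x) + pi (qser k y).
Proof.
have [s [Ss Bx By]] := B_frac2 x y.
have [p px] := B_adexp Bx; have [r ry] := B_adexp By.
rewrite -raddfD; apply: (@pi_cancelr (tau s)); first by rewrite rmorph_unit ?S_unit.
rewrite (@qserP _ _ _ (p + r) (S_US Ss)); last by rewrite mulrDl; exact: adexpD.
rewrite vserD mulrDl !raddfD /=.
by rewrite (qserP k (S_US Ss) px) (qserP k (S_US Ss) ry).
Qed.

Lemma qser_e k y : pi (e * qser k y) = pi (qser k.-1 y) *+ k.
Proof.
have [s [p [Ss _ py]]] := B_frac_adexp y.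
rewrite -(raddfMn pi); apply: (@pi_cancelr (tau s)).
  by rewrite rmorph_unit ?S_unit.
rewrite -mulrA (piMl _ (qserP k (S_US Ss) py)) mulrnAl raddfMn.
by rewrite (qserP k.-1 (S_US Ss) py) (vserM_e _ py).
Qed.

(** Moving e^(-k-1) past x leaves vectors of y of higher index, with the coefficients of exp(- t ad
    e) x. *)
Lemma qserM k x y p : adexp e p x ->
  pi (qser k (x * y)) = \sum_(i < size p) pi (p`_i * qser (i + k) y).
Proof.
move=> px; have [s [r [Ss _ ry]]] := B_frac_adexp y.
rewrite -raddf_sum; apply: (@pi_cancelr (tau s)).
  by rewrite rmorph_unit ?S_unit.
rewrite (@qserP _ _ _ (p * r) (S_US Ss)); last by rewrite -mulrA; exact: adexpM.
rewrite vserM mulr_suml !raddf_sum; apply: eq_bigr => i _ /=.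
by rewrite -mulrA; apply: piMl; rewrite (qserP _ (S_US Ss) ry).
Qed.

Lemma qser_f k a : pi (qser k (a * f)) = 0.
Proof.
have [s Ss Bs] := B_frac a; have [p pa] := B_adexp Bs.
have [d Ed] := tau_surj s^-1.
have -> : a * f = a * iD s * f * iD d.
  rewrite -[_ * f * _]mulrA fd Ed -!mulrA; congr (_ * _).
  by rewrite mulrA -rmorphM divrr ?S_unit // rmorph1 mul1r.
rewrite qser_D; apply: piD0; rewrite (qserE k (adexpM pa (adexp_f ef he_comm))).
exact: (pi_vser_f ef hf_comm sl2_invS sl2_invC piM pieg).
Qed.

(** The denominator hidden in a left factor is carried past the nilradical to the far right, so that
    the remaining left factor lies in B and has a series. *)
Lemma nil_ideal_mm_ind (P : A -> Prop) : P 0 ->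
    (forall x y, P x -> P y -> P (x + y)) ->
    (forall b z d, B b -> mm z -> P (b * z * iD d)) ->
  forall x, nil_ideal x -> P x.
Proof.
move=> P0 PD Pb; apply: addspan_ind_additive => // _ [a [z [mz ->]]].
have [s Ss Bs] := B_frac a.
have -> : a * z = a * iD s * (iD s^-1 * z).
  by rewrite mulrA -[a * _ * _]mulrA -rmorphM divrr ?S_unit // rmorph1 mulr1.
elim/addspan_ind_additive: (D_mm s^-1 mz) => [|x y Px Py|_ [z' [d [mz' ->]]]].
- by rewrite mulr0.
- by rewrite mulrDr; exact: PD.
- by rewrite mulrA; exact: Pb.
Qed.

Lemma mm_iter z n : mm z -> mm (iter n (ad e) z).
Proof. by move=> mz; elim: n => //= n; exact: mm_e. Qed.

Lemma qser_nil k x : nil_ideal x -> pi (qser k x) = 0.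
Proof.
move=> mx; elim/nil_ideal_mm_ind: mx k => [|u v u0 v0|b z d Bb mz] k.
- have p0 : adexp e 0 0.
    by move=> n; rewrite coef0 /adexp_coef iter_ad0 scaler0.
  by rewrite (qserE k p0) vser0 raddf0.
- by rewrite qserDr u0 v0 addr0.
rewrite qser_D; apply: piD0; have [p pb] := B_adexp Bb.
have [r rz] := B_adexp (mm_B mz).
rewrite (qserM _ _ pb) big1 // => i _; apply: piM; rewrite (qserE _ rz).
rewrite raddf_sum big1 // => j _; apply/pi_nil/nil_ideal_vpow; rewrite rz.
exact/nil_idealZ/mm_nil_ideal/mm_iter.
Qed.

Lemma qser_pis k x : pis x = 0 -> pi (qser k x) = 0.
Proof.
case/pis_ker=> a mx; rewrite -[x](addrNK (a * f)) qserDr qser_f addr0.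
exact: qser_nil.
Qed.

Lemma f_qser k y : pis (f * y) = 0 ->
  pi (f * qser k y) = pi ((h + k.+2%:R) * qser k.+1 y).
Proof.
move=> fy; have [s [r [Ss _ ry]]] := B_frac_adexp y.
have Us : tau s \is a GRing.unit by rewrite rmorph_unit ?S_unit.
apply/pi_eqP; rewrite -[RHS](raddf0 pi); apply: (pi_cancelr Us).
rewrite mul0r raddf0.
rewrite mulrBl -!mulrA raddfB (piMl _ (qserP k (S_US Ss) ry)).
rewrite (piMl _ (qserP k.+1 (S_US Ss) ry)) -raddfB.
rewrite -(pi_f_vser ef hf_comm sl2_invS piM pieg k ry).
have fry := adexpM (adexp_f ef he_comm) ry; rewrite mulrA in fry.
by rewrite -(qserP k (S_US Ss) fry); exact/piD0/qser_pis.
Qed.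

(** Induction on the order of nilpotency of ad e on z: in the expansion of e^(-k-1) z y v = 0 the
    leading term is z e^(-k-1) y v, and every other term has ad e applied to z at least once. *)
Lemma mm_qser y : (forall z, mm z -> pis (z * y) = 0) ->
  forall z k, mm z -> pi (z * qser k y) = 0.
Proof.
move=> my z k mz; have [p pz] := B_adexp (mm_B mz).
have: forall n, (size p <= n)%N -> iter n (ad e) z = 0.
  move=> n pn; have /eqP := pz n; rewrite nth_default // eq_sym scaler_eq0.
  by rewrite mulf_eq0 signr_eq0 invr_eq0 pnatr_eq0 gtn_eqF ?fact_gt0 // => /eqP.
move: (size p) => N {p pz}; elim: N z k mz => [|N IHN] z k mz zN.
  by have /= -> := zN 0%N isT; rewrite mul0r raddf0.
have [p pz] := B_adexp (mm_B mz).
have := qserM k y pz; rewrite (qser_pis _ (my z mz)).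
pose F i := pi (p`_i * qser (i + k) y).
rewrite -[RHS]/(\sum_(i < size p) F i) (@sum_ord_support _ F _ (size p).+1) //.
  rewrite big_ord_recl {1}/F pz adexp_coef0 add0n big1 ?addr0 // => i _.
  rewrite /F pz /adexp_coef -scalerAl -mulr_algl; apply: piM.
  apply: IHN => [|n Nn]; first exact: (mm_iter i.+1).
  by rewrite -iterD; apply: zN; rewrite addnS ltnS (leq_trans Nn) ?leq_addr.
by move=> i pi0; rewrite /F nth_default // mul0r raddf0.
Qed.

(* [Q] chooses representatives of the values of the Zhelobenko map. *)
Variable Q : A -> A.
Hypothesis QDr : forall x y, pi (Q (x + y)) = pi (Q x) + pi (Q y).
Hypothesis QB : forall b p, B b -> adexp e p b -> pi (Q b) = pi (vser 0 p).
Hypothesis Q_D : forall a d, pi (Q (a * iD d)) = pi (Q a * iD (tau d)).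

Lemma qser0E y : pi (qser 0 y) = pi (Q y).
Proof.
have [s [p [Ss Bs py]]] := B_frac_adexp y.
apply: (@pi_cancelr (tau s)); first by rewrite rmorph_unit ?S_unit.
by rewrite (qserP 0 (S_US Ss) py) -(QB Bs py) Q_D.
Qed.

Lemma e_Q y : pi (e * Q y) = 0.
Proof. by rewrite -(piMl e (qser0E y)) qser_e mulr0n. Qed.

Lemma Q_pis x : pis x = 0 -> pi (Q x) = 0.
Proof. by move=> x0; rewrite -qser0E qser_pis. Qed.

(** Tested on the generators f and m: right multiplication by y descends to an endomorphism of the
    quotient [pis]. *)
Definition normalizing y := pis (f * y) = 0 /\ forall z, mm z -> pis (z * y) = 0.

Lemma mm_Q y : normalizing y -> forall z, mm z -> pi (z * Q y) = 0.
Proof. by case=> _ my z mz; rewrite -(piMl z (qser0E y)) mm_qser. Qed.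

Lemma nil_ideal_Q y x : normalizing y -> nil_ideal x -> pi (x * Q y) = 0.
Proof.
move=> Ny; elim/addspan_ind_additive => [|u v u0 v0|_ [a [z [mz ->]]]].
- by rewrite mul0r raddf0.
- by rewrite mulrDl raddfD /= u0 v0 addr0.
- by rewrite -mulrA; apply/piM/mm_Q.
Qed.

(** [Q y] normalizes the kernel of [pi] in turn, since e and m kill it on the left by [e_Q] and
    [mm_Q]. *)
Lemma pi_mul_Q y u v : normalizing y -> pi u = pi v -> pi (u * Q y) = pi (v * Q y).
Proof.
move=> Ny /pi_eqP/pi_ker [a muv]; apply/pi_eqP; rewrite -mulrBl.
rewrite -[u - v](addrNK (a * e)) mulrDl raddfD /= nil_ideal_Q // add0r -mulrA.
exact/piM/e_Q.
Qed.

Lemma nil_ideal_pis y x : normalizing y -> nil_ideal x -> pis (x * y) = 0.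
Proof.
move=> [_ my]; elim/addspan_ind_additive => [|u v u0 v0|_ [a [z [mz ->]]]].
- by rewrite mul0r raddf0.
- by rewrite mulrDl raddfD /= u0 v0 addr0.
- by rewrite -mulrA; apply/pisM/my.
Qed.

Lemma normalizing_D d y : normalizing y -> normalizing (iD d * y).
Proof.
move=> Ny; have [fy _] := Ny; split=> [|z mz].
  by rewrite mulrA fd -mulrA; exact: pisM.
by rewrite mulrA; apply: nil_ideal_pis => //; exact: mm_D.
Qed.

(** Both sides satisfy f x_k = (h + k + 2) x_(k+1) with the same x_0, and h + k + 2 is invertible.
    On the right, h - k from [f_vpow] becomes h + k + 2 after the shift by 2 (k + 1) of [h_vpow]. *)
Lemma qser_vpow y k : normalizing y ->
  pi (qser k y) = pi (lower_pow f sl2_inv k * Q y).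
Proof.
move=> [fy _]; elim: k => [|k IHk].
  by rewrite qser0E /lower_pow expr0 sl2_inv0 !mul1r.
have hk : h + k.+2%:R = iD (H + (k.+2)%:Z%:~R).
  by rewrite rmorphD -pmulrn rmorph_nat.
apply: (pi_cancell (unitH k.+2)); rewrite -hk -f_qser // (piMl f IHk).
rewrite [f * _]mulrA [(h + _) * _]mulrA; congr (pi (_ * _)).
rewrite (f_vpow _ sl2_invS sl2_invC) mulrDl (h_vpow hf_comm sl2_invC) mulr_natl.
rewrite -[X in _ = _ + X]mulr_natr -mulrDr -addnn addSnnS natrD.
by congr (_ * _); move: (k.+2%:R : A) => c; rewrite opprD addrA addrNK.
Qed.

(** In the expansion of e^(-1) b y v each vector of y is [lower_pow i] times [Q y], and the
    coefficients in front reassemble into Q b. *)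
Lemma Q_BM b y : B b -> normalizing y -> pi (Q (b * y)) = pi (Q b * Q y).
Proof.
move=> Bb Ny; have [p pb] := B_adexp Bb.
rewrite (pi_mul_Q Ny (QB Bb pb)) -qser0E (qserM _ _ pb) mulr_suml raddf_sum.
by apply: eq_bigr => i _ /=; rewrite -mulrA addn0; exact/piMl/qser_vpow.
Qed.

Lemma Q_cartan d : pi (Q (iD d)) = pi (iD (tau d)).
Proof.
have p1 : adexp e 1 1.
  move=> [|n]; rewrite coefC ?adexp_coef0 //.
  by rewrite /adexp_coef iterSr /ad mulr1 mul1r subrr iter_ad0 scaler0.
have B1 : B 1 by rewrite -(rmorph1 iD); exact: B_US.
rewrite -[iD d]mul1r Q_D (piD (y := 1)) ?mul1r // (QB B1 p1).
by rewrite -[1]/1%:P vserC /lower_pow expr0 sl2_inv0 !mulr1.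
Qed.

Lemma Q_DM d y : normalizing y -> pi (Q (iD d * y)) = pi (iD (tau d) * Q y).
Proof.
move=> Ny; have QU u v : US u -> normalizing v ->
    pi (Q (iD u * v)) = pi (iD (tau u) * Q v).
  move=> Uu Nv; rewrite Q_BM //; last exact: B_US.
  exact/pi_mul_Q/Q_cartan.
have [u [s [Uu Ss E]]] := D_frac d; have Us := S_unit Ss.
have -> : d = s^-1 * u by rewrite -E mulrC mulrK.
apply: (@pi_cancell (tau s)); first by rewrite rmorph_unit.
rewrite -QU; [|exact: S_US|exact: normalizing_D].
rewrite mulrA -(rmorphM iD) mulVKr // QU // mulrA -(rmorphM iD) -(rmorphM tau).
by rewrite mulVKr.
Qed.

(** The denominator of x is handed over to y, which stays normalizing, and taken back by [Q_DM] and
    [Q_D]. *)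
Lemma Q_M x y : normalizing y -> pi (Q (x * y)) = pi (Q x * Q y).
Proof.
move=> Ny; have [s Ss Bs] := B_frac x; have Us := S_unit Ss.
have Ex : x = x * iD s * iD s^-1.
  by rewrite -mulrA -rmorphM divrr // rmorph1 mulr1.
rewrite {1}Ex -mulrA Q_BM //; last exact: normalizing_D.
rewrite (piMl _ (Q_DM s^-1 Ny)) mulrA; apply: pi_mul_Q => //.
by rewrite -Q_D -Ex.
Qed.

(** Formally e^(-1) e y v = y v, which lies in the submodule that is divided out. *)
Lemma Q_e y : pi (Q (e * y)) = 0.
Proof.
rewrite -qser0E; have [s [r [Ss _ ry]]] := B_frac_adexp y.
rewrite -[RHS](raddf0 pi); apply: (@pi_cancelr (tau s)).
  by rewrite rmorph_unit ?S_unit.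
have ery := adexpM (adexp_e e) ry; rewrite mulrA in ery.
by rewrite (qserP 0 (S_US Ss) ery) vserCM (vserM_e _ ry) mulr0n mul0r raddf0.
Qed.

(** From e^(-1) h = (h + 2) e^(-1); no normalizing condition on y is involved, h having an explicit
    series. *)
Lemma Q_hM y : pi (Q (h * y)) = pi ((h + 2%:R) * Q y).
Proof.
rewrite -(piMl _ (qser0E y)) -qser0E; have [s [r [Ss _ ry]]] := B_frac_adexp y.
apply: (@pi_cancelr (tau s)); first by rewrite rmorph_unit ?S_unit.
have eh : e * h = h * e - 2%:R *: e.
  by rewrite he_comm mulrDr mulr_natr scaler_nat addrK.
have hry := adexpM (adexp_cartan eh) ry; rewrite mulrA in hry.
rewrite (qserP 0 (S_US Ss) hry).
rewrite (pi_cartan_vser ef hf_comm sl2_invS piM pieg h 2%:R 0 ry) -mulrA.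
rewrite -(piMl _ (qserP 0 (S_US Ss) ry)); congr (pi ((_ + _) * _)).
by rewrite mulr1n scaler_nat.
Qed.

Lemma Q_N x : pi (Q (- x)) = - pi (Q x).
Proof.
have Q0 : pi (Q 0) = 0.
  by apply/eqP; rewrite -(inj_eq (addrI (pi (Q 0)))) addr0 -QDr addr0.
by apply/eqP; rewrite -addr_eq0 -QDr addNr Q0.
Qed.

(* Solving e y = b e modulo the nilradical inverts [Q] on the vector y. *)
Lemma Q_inv y b : B y -> B b -> nil_ideal (e * y - b * e) -> pi (Q b) = pi y.
Proof.
move=> By Bb yb; have [p pb] := B_adexp Bb; have [r ry] := B_adexp By.
(* The congruence passes to all coefficients, e r_n = p_n e modulo m, while (n + 1) r_(n+1) =
   [r_n, e]. Hence (n + 1) r_(n+1) is (r_n - p_n) e, and e lowers the index with multiplicity n +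
   1. *)
have rS n : pi (r`_n.+1 * lower_pow f sl2_inv n.+1) =
    - pi ((p`_n - r`_n) * lower_pow f sl2_inv n).
  have rn : nil_ideal (e * r`_n - p`_n * e).
    have := nil_ideal_adexp n yb.
    have E := adexpB (adexpM (adexp_e e) ry) (adexpM pb (adexp_e e)).
    by rewrite -E coefB coefCM coefMC.
  have -> : r`_n.+1 = n.+1%:R^-1 *:
      ((r`_n - p`_n) * e - (e * r`_n - p`_n * e)).
    rewrite mulrBl opprB addrA addrNK -[X in _ *: X]opprB -/(ad e r`_n).
    rewrite !ry ad_adexp_coef opprK -scaler_nat scalerA mulVf ?scale1r //.
    by rewrite pnatr_eq0.
  rewrite -scalerAl -mulr_algl mulrBl mulrBr raddfB /=.
  rewrite [X in _ - X]piM ?subr0; last exact/pi_nil/nil_ideal_vpow.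
  rewrite -[_ * e * _]mulrA [_%:A * _]mulrA.
  rewrite (pi_e_vpow ef hf_comm sl2_invS piM pieg) /= -raddfMn -mulrnAl mulr_algl.
  rewrite -scaler_nat scalerA divff ?pnatr_eq0 // scale1r -raddfN -mulNr.
  by rewrite opprB.
rewrite (QB Bb pb) -[pi y]addr0; pose N := maxn (size p) (size r).
have r0 : pi y = pi (r`_0 * lower_pow f sl2_inv 0).
  by rewrite ry adexp_coef0 /lower_pow expr0 sl2_inv0 !mulr1.
(* Summing the recursion puts [vser 0 r] on both sides; it cancels and leaves y equal to
   [vser 0 p]. *)
have : pi (vser 0 r) = pi y - pi (vser 0 p - vser 0 r).
  rewrite -vserB [in LHS](@vserE _ _ _ _ N.+1) ?leqW ?leq_maxr //.
  rewrite big_ord_recl raddfD /= -r0; congr (_ + _).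
  rewrite (@vserE _ _ _ _ N); last by
    rewrite (leq_trans (size_polyD _ _)) // size_polyN.
  rewrite !raddf_sum; apply: eq_bigr => n _.
  by rewrite !addn0 coefB /= rS.
rewrite raddfB opprB addrCA => /eqP; rewrite addr0 -subr_eq0 opprD addrA subrr.
by rewrite add0r oppr_eq0 subr_eq0 => /eqP.
Qed.

(** The element a with e y = a e modulo m need not lie in B and is multiplied by a denominator t; as
    t e = e tau(t), the matching factor for y is d = tau(t). The series [vser'] belongs to the
    opposite triple and is recognised later as T_i of a value of Q. *)
Lemma Q_square y : B y -> pi (e * y) = 0 ->
  exists2 d, US d /\ d \is a GRing.unit &
    forall s, adexp f s (y * iD d) ->
      pi ((h + 1) * Q (vser' 0 s)) = pi (y * iD d * (h + 1)).
Proof.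
move=> By /pi_ker [a ya]; have [t St Bt] := B_frac a.
exists (tau t).
  by rewrite rmorph_unit ?S_unit //; split; first exact/UStau/S_US.
move=> s sy; set y2 := y * iD (tau t); set b := a * iD t.
have By2 : B y2 by apply: B_MUS By _; exact/UStau/S_US.
have yb : nil_ideal (e * y2 - b * e).
  by rewrite /y2 /b -[a * _ * e]mulrA de !mulrA -mulrBl; exact: nil_ideal_D.
rewrite -[iD H + 1]/(h + 1).
have [s' sb] := B_adexp' Bt.
have yb0 n k : pis (adexp_coef f n (e * y2 - b * e) * lower_pow e sl2_inv' k) = 0.
  by apply/pis_nil/nil_ideal_vpow'/nil_ideal_adexp'.
have [V EV] := sl2_exchange fe_comm hf_comm' he_comm' sl2_inv'0 sl2_inv'S
  sl2_inv'C pisM pisfg sy sb yb0.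
set W := lower_ser _ _ _ _ in EV *.
have : pis ((- h + 1) * W - b * (- h + 1) - e * V) = 0.
  by rewrite raddfB EV subrr.
move/Q_pis; rewrite QDr QDr !Q_N Q_e subr0 => /eqP; rewrite subr_eq0.
(* Q turns - h + 1 on the left into - (h + 2) + 1 and on the right into tau(- H + 1) = - (H + 1), so
   both sides acquire the factor - (h + 1). *)
rewrite mulrDl mul1r mulNr QDr Q_N Q_hM.
have -> : - h + 1 = iD (- H + 1) by rewrite rmorphD rmorphN rmorph1.
rewrite Q_D (piD _ (Q_inv By2 Bt yb)) => /eqP E; apply: oppr_inj.
rewrite -!raddfN -[X in _ = pi X]mulrN.
have -> : - (h + 1) = iD (tau (- H + 1)).
  rewrite rmorphD rmorphN rmorph1 /= tauH rmorphD rmorphN rmorphD rmorph1 /=.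
  by rewrite rmorph_nat opprD opprD -addrA mulrS opprD addrNK.
rewrite -E -raddfN -raddfD /= -!mulNr -{3}[Q W]mul1r -mulrDl; congr (pi (_ * _)).
by rewrite mulr2n addrA [in RHS]opprD addrNK.
Qed.

Lemma rank_one_Q :
  [/\ forall x, pis x = 0 -> pi (Q x) = 0,
      forall d, pi (Q (iD d)) = pi (iD (tau d)),
      forall y, pi (e * Q y) = 0,
      forall y z, normalizing y -> mm z -> pi (z * Q y) = 0
    & forall x y, normalizing y -> pi (Q (x * y)) = pi (Q x * Q y)] /\
  forall y, B y -> pi (e * y) = 0 ->
    exists2 d, US d /\ d \is a GRing.unit &
      forall s, adexp f s (y * iD d) ->
        pi ((h + 1) * Q (vser' 0 s)) = pi (y * iD d * (h + 1)).
Proof.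
split; last exact: Q_square.
split; [exact: Q_pis|exact: Q_cartan|exact: e_Q| |exact: Q_M].
by move=> y z Ny; exact: mm_Q.
Qed.

End RankOne.

(** * Induction in enveloping algebras and tensor products *)

Section EnvelopingInduction.
Variables (K : fieldType) (g : lieAlgebra K) (U : envelopingAlgebra g).
Variable P : U -> Prop.
Hypothesis P1 : P 1.
Hypothesis PD : forall c x y, P x -> P y -> P (c *: x + y).
Hypothesis PM : forall x y, P x -> P y -> P (x * y).
Hypothesis Pg : forall x, P (env_in U x).

Let Pb : {pred U} := fun x => `[< P x >].

Let Pb_subalg_closed : subalg_closed Pb.
Proof.
split; first exact/asboolP.
  by move=> c x y /asboolP Px /asboolP Py; apply/asboolP; exact: PD.
by move=> x y /asboolP Px /asboolP Py; apply/asboolP; exact: PM.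
Qed.
#[local] HB.instance Definition _ :=
  GRing.isSubalgClosed.Build K U Pb Pb_subalg_closed.

Let sub := {x : U | Pb x}.
#[local] HB.instance Definition _ := SubType.on sub.
#[local] HB.instance Definition _ := Choice.on sub.
#[local] HB.instance Definition _ := [SubChoice_isSubAlgebra of sub by <:].

Let sub_in (x : g) : sub := exist _ (env_in U x) (asboolT (Pg x)).
Let sub_in_linear : linear sub_in.
Proof. by move=> c x y; apply: val_inj; rewrite /= linearP. Qed.
#[local] HB.instance Definition _ := GRing.isLinear.Build K g sub *:%R sub_in
  sub_in_linear.

Let sub_out (x : sub) : U := val x.
Let sub_out_linear : linear sub_out. Proof. by []. Qed.
#[local] HB.instance Definition _ := GRing.isLinear.Build K sub U *:%R sub_out
  sub_out_linear.
Let sub_out_monoid : monoid_morphism sub_out. Proof. by []. Qed.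
#[local] HB.instance Definition _ := GRing.isMonoidMorphism.Build sub U sub_out
  sub_out_monoid.

(** The elements satisfying P form a subalgebra. The universal property maps U into it, and by
    uniqueness the composite with the inclusion is the identity. *)
Lemma env_ind x : P x.
Proof.
have sub_lie : is_lie_morphism sub_in.
  by move=> y z; apply: val_inj; rewrite /= env_in_lie.
have [phi [phiE _]] := @env_universal K g U _ sub_in sub_lie.
have [id' [_ idU]] := @env_universal K g U U _ (@env_in_lie _ _ U).
have val_phi : (val \o phi : U -> U) =1 idfun.
  move=> y; rewrite [RHS](idU idfun) //.
  by apply: (idU (sub_out \o phi)) => z /=; rewrite phiE.
by rewrite -[x]val_phi /=; exact/asboolP/(valP (phi x)).
Qed.

End EnvelopingInduction.

Section TensorSpan.
Variables (S : Type) (X Y Z : zmodType).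
Variables (ract : X -> S -> X) (lact : S -> Y -> Y) (b : X -> Y -> Z).
Hypothesis tb : is_tensor ract lact b.
Variable P : Z -> Prop.
Hypothesis P0 : P 0.
Hypothesis PB : forall x y, P x -> P y -> P (x - y).
Hypothesis Pgen : forall x y, P (b x y).

Let Pb : {pred Z} := fun x => `[< P x >].
Let Pb_zmod_closed : zmod_closed Pb.
Proof.
split; first exact/asboolP.
by move=> x y /asboolP Px /asboolP Py; apply/asboolP; exact: PB.
Qed.
#[local] HB.instance Definition _ := GRing.isZmodClosed.Build Z Pb Pb_zmod_closed.

Let sub := {x : Z | Pb x}.
#[local] HB.instance Definition _ := SubType.on sub.
#[local] HB.instance Definition _ := Choice.on sub.
#[local] HB.instance Definition _ := [SubChoice_isSubZmodule of sub by <:].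

Lemma tensor_ind z : P z.
Proof.
have [[bDr bDl bS] ub] := tb.
pose b' x y : sub := exist _ (b x y) (asboolT (Pgen x y)).
have bb' : balanced ract lact b'.
  by split=> *; apply: val_inj; rewrite /= (bDr, bDl, bS).
have [phi [phiE _]] := ub sub b' bb'.
have [id' [_ idU]] := ub Z b (And3 bDr bDl bS).
have val_phi : (val \o phi : Z -> Z) =1 idfun.
  move=> y; rewrite [RHS](idU idfun) // -[LHS]/((val \o phi) y).
  by apply: (idU (val \o phi)) => u v /=; rewrite phiE.
by rewrite -[z]val_phi /=; exact/asboolP/(valP (phi z)).
Qed.

End TensorSpan.

(** * Contragredient Lie algebras *)

Definition eigspan (K : fieldType) (W : lmodType K) (phi : W -> W) (L : K -> Prop) :=
  addspan (fun v => exists2 l, L l & phi v = l *: v).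

(** * Separation of eigenvalues *)

Section Eigen.
Variables (K : fieldType) (W : lmodType K) (phi : {linear W -> W}).

Lemma eigspanZ L c x : eigspan phi L x -> eigspan phi L (c *: x).
Proof.
elim/addspan_ind_additive => [|u v Lu Lv|v [l Ll pv]].
- by rewrite scaler0; constructor.
- by rewrite scalerDr; exact: addspanD.
- apply: addspan_gen; exists l => //.
  by rewrite linearZ /= pv !scalerA mulrC.
Qed.

Lemma eigspanS L L' x : (forall l, L l -> L' l) -> eigspan phi L x -> eigspan phi L' x.
Proof.
move=> LL'; elim/addspan_ind_additive => [|u v Lu Lv|v [l Ll pv]].
- exact: addspan0.
- exact: addspanD.
- by apply: addspan_gen; exists l; first exact: LL'.
Qed.

(* A polynomial in [phi] kills the component [a] and fixes [w]. *)
Lemma eigen_separation (P : W -> Prop) mu w a b :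
    (forall c x y, P x -> P y -> P (c *: x + y)) -> (forall x, P x -> P (phi x)) ->
    phi w = mu *: w -> w = a + b -> eigspan phi (fun l => l <> mu) a -> P b -> P w.
Proof.
move=> PD Pphi wmu wab aE Pb.
suff [p [pL p_phi pa pmu pP]] : exists p : W -> W,
    [/\ forall c x y, p (c *: x + y) = c *: p x + p y,
        forall x, p (phi x) = phi (p x), p a = 0,
        forall x, phi x = mu *: x -> p x = x & forall x, P x -> P (p x)].
  by rewrite -(pmu w wmu) wab -[a]scale1r pL pa scaler0 add0r; exact: pP.
rewrite /eigspan in aE; elim: aE {wab} => [|v {}a [l lmu vl] _ [p [pL p_phi pa pmu pP]]].
  by exists id; split.
have lmu0 : mu - l != 0 by rewrite subr_eq0 eq_sym; apply/eqP.
exists (fun x => (mu - l)^-1 *: (phi (p x) - l *: p x)); split.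
- move=> c x y; rewrite pL linearP [l *: _]scalerDr opprD addrACA scalerDr.
  congr (_ + _); rewrite [RHS]scalerA [c * _]mulrC -scalerA; congr (_ *: _).
  by rewrite scalerBr !scalerA mulrC.
- by move=> x; rewrite !p_phi [RHS]linearZ /= [phi (_ - _)]linearB [phi (l *: _)]linearZ.
- have pD x y : p (x + y) = p x + p y by rewrite -[x]scale1r pL !scale1r.
  have pZ c : p (c *: v) = c *: p v.
    have p0 : p 0 = 0 by have := pL (-1) 0 0; rewrite !scaleN1r oppr0 addr0 addNr.
    by rewrite -[c *: v]addr0 pL p0 addr0.
  by rewrite pD pa addr0 -p_phi vl pZ subrr scaler0.
- by move=> x xmu; rewrite pmu // xmu -scalerBl scalerA mulVf // scale1r.
- move=> x Px; rewrite -[_ *: _]addr0.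
  have P0 : P 0 by rewrite -(addNr x) -scaleN1r; exact: PD.
  apply: (PD) => //; rewrite addrC -scaleNr; apply: PD; first exact: pP.
  exact/Pphi/pP.
Qed.

End Eigen.

Section LieBasics.
Variables (K : fieldType) (g : lieAlgebra K).
Implicit Types x y z : g.

Lemma lieDl x y z : [lie x + y, z] = [lie x, z] + [lie y, z].
Proof. by have := lie_linearl 1 x y z; rewrite !scale1r. Qed.

Lemma lieDr x y z : [lie x, y + z] = [lie x, y] + [lie x, z].
Proof. by have := lie_linearr 1 x y z; rewrite !scale1r. Qed.

Lemma lie0r x : [lie x, 0] = 0.
Proof. by apply: (addrI [lie x, 0]); rewrite -lieDr !addr0. Qed.

Lemma lie0l x : [lie 0, x] = 0.
Proof. by apply: (addrI [lie 0, x]); rewrite -lieDl !addr0. Qed.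

Lemma lieZl c x y : [lie c *: x, y] = c *: [lie x, y].
Proof. by have := lie_linearl c x 0 y; rewrite !addr0 lie0l addr0. Qed.

Lemma lieZr c x y : [lie x, c *: y] = c *: [lie x, y].
Proof. by have := lie_linearr c x y 0; rewrite !addr0 lie0r addr0. Qed.

Lemma lieNr x y : [lie x, - y] = - [lie x, y].
Proof. by rewrite -scaleN1r lieZr scaleN1r. Qed.

Lemma lieC x y : [lie x, y] = - [lie y, x].
Proof.
apply/eqP; rewrite -addr_eq0; have /eqP := lie_alt (x + y).
by rewrite lieDl !lieDr !lie_alt add0r addr0.
Qed.

Lemma lieA x y z : [lie x, [lie y, z]] = [lie [lie x, y], z] + [lie y, [lie x, z]].
Proof.
have /eqP := lie_jacobi x y z; rewrite -addrA addr_eq0 => /eqP ->.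
by rewrite opprD addrC [in - [lie z, _]]lieC opprK [[lie z, x]]lieC lieNr opprK.
Qed.

Lemma lie_linear x : linear (lie_bracket x).
Proof. by move=> c y z; rewrite lieDr lieZr. Qed.
HB.instance Definition _ x := GRing.isLinear.Build K g g *:%R (lie_bracket x)
  (lie_linear x).

Lemma subspaceD (J : g -> Prop) x y : is_subspace J -> J x -> J y -> J (x + y).
Proof. by move=> [_ JD] Jx Jy; rewrite -[x]scale1r; exact: JD. Qed.

Lemma subspaceZ (J : g -> Prop) c x : is_subspace J -> J x -> J (c *: x).
Proof. by move=> [J0 JD] Jx; rewrite -[_ *: _]addr0; exact: JD. Qed.

Lemma lie_generated_sub P : is_lie_subalgebra (lie_generated (g := g) P).
Proof.
split; first split.
- by move=> J [[]].
- by move=> c x y Px Py J sJ PJ; apply: sJ.1.2; [exact: Px|exact: Py].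
- by move=> x y Px Py J sJ PJ; apply: sJ.2; [exact: Px|exact: Py].
Qed.

Lemma lie_generated_gen (P : g -> Prop) x : P x -> lie_generated P x.
Proof. by move=> Px J _; exact. Qed.

Lemma lie_generated_mono (P Q : g -> Prop) :
  (forall x, P x -> lie_generated Q x) ->
  forall x, lie_generated P x -> lie_generated Q x.
Proof. by move=> PQ x; apply; [exact: lie_generated_sub | exact: PQ]. Qed.

Lemma lie_generated_ind (P Q : g -> Prop) :
    Q 0 -> (forall c x y, Q x -> Q y -> Q (c *: x + y)) ->
    (forall x y, lie_generated P x -> lie_generated P y -> Q x -> Q y ->
       Q [lie x, y]) ->
    (forall x, P x -> Q x) -> forall x, lie_generated P x -> Q x.
Proof.
move=> Q0 QD QL PQ x Px; have [[sg0 sgD] sgL] := lie_generated_sub P.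
suff: lie_generated P x /\ Q x by case.
apply: (Px (fun y => lie_generated P y /\ Q y)) => [|y Py]; last first.
  by split; [exact: lie_generated_gen | exact: PQ].
split; first split => //.
- by move=> c y z [? ?] [? ?]; split; [exact: sgD|exact: QD].
- by move=> y z [? ?] [? ?]; split; [exact: sgL|exact: QL].
Qed.

Lemma lie_generated_deriv (P : g -> Prop) u :
  (forall y, P y -> lie_generated P [lie u, y]) ->
  forall x, lie_generated P x -> lie_generated P [lie u, x].
Proof.
have sub := lie_generated_sub P; move=> uP.
apply: lie_generated_ind => [|c x y ux uy|x y Px Py ux uy|//].
- by rewrite lie0r; exact: sub.1.1.
- by rewrite lieDr lieZr; exact: sub.1.2.
- by rewrite lieA; apply: (subspaceD sub.1); exact: sub.2.
Qed.

Lemma eigspan_lie z (L1 L2 L : K -> Prop) x y :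
    (forall a b, L1 a -> L2 b -> L (a + b)) ->
    eigspan (lie_bracket z) L1 x -> eigspan (lie_bracket z) L2 y ->
  eigspan (lie_bracket z) L [lie x, y].
Proof.
move=> LD xL; move: y; elim/addspan_ind_additive: x / xL
    => [|u v IHu IHv|u [a La ua]] y yL.
- by rewrite lie0l; constructor.
- by rewrite lieDl; exact: addspanD (IHu _ yL) (IHv _ yL).
elim/addspan_ind_additive: y / yL => [|v w IHv IHw|v [b Lb vb]].
- by rewrite lie0r; constructor.
- by rewrite lieDr; exact: addspanD.
apply: addspan_gen; exists (a + b); first exact: LD.
by rewrite lieA ua vb lieZl lieZr scalerDl.
Qed.

End LieBasics.

(* Both halves of the Chevalley generators: [s] is 1 or -1, and [E], [F] are
   the generators of the roots s alpha_i and - s alpha_i. *)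
Section Half.
Variables (K : numFieldType) (G : contragredientLie K).
Local Notation n := (km_rank G).
Local Notation H := (h_in G).
Variables (s : K) (E F : 'I_n -> G) (c : 'I_n -> km_h G).
Hypothesis HE : forall z i, [lie H z, E i] = (s * (sroot i z : K)) *: E i.
Hypothesis EF : forall i j, [lie F i, E j] = if i == j then H (c i) else 0.

Definition half := lie_generated (fun y => exists i, y = E i).

Lemma half_sub : is_lie_subalgebra half. Proof. exact: lie_generated_sub. Qed.

Lemma half_gen i : half (E i).
Proof. by apply: lie_generated_gen; exists i. Qed.

Lemma half_h z x : half x -> half [lie H z, x].
Proof.
apply: lie_generated_deriv => _ [i ->]; rewrite HE.
by apply: (subspaceZ _ half_sub.1); exact: half_gen.
Qed.

Lemma half_opp k x : half x -> exists b y, half y /\ [lie F k, x] = H b + y.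
Proof.
have sub := half_sub.
elim/lie_generated_ind => [|a x1 x2 [b1 [y1 [hy1 E1]]] [b2 [y2 [hy2 E2]]]
  |x1 x2 hx1 hx2 [b1 [y1 [hy1 E1]]] [b2 [y2 [hy2 E2]]]|_ [i ->]].
- by exists 0, 0; rewrite lie0r linear0 addr0; split; first exact: sub.1.1.
- exists (a *: b1 + b2), (a *: y1 + y2); split; first exact: sub.1.2.
  by rewrite lieDr lieZr E1 E2 linearP scalerDr addrACA.
- exists 0, ([lie H b1, x2] + [lie y1, x2] + (- [lie H b2, x1] + [lie x1, y2])).
  have hN u : half u -> half (- u).
    by rewrite -scaleN1r; exact: (subspaceZ _ sub.1).
  split; last first.
    by rewrite linear0 add0r lieA E1 E2 lieDl lieDr [[lie x1, H b2]]lieC.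
  apply: (subspaceD sub.1); apply: (subspaceD sub.1).
  + exact: half_h hx2.
  + exact: sub.2 hy1 hx2.
  + by apply: hN; exact: half_h hx1.
  + exact: sub.2 hx1 hy2.
- exists (if k == i then c k else 0), 0; split; first exact: sub.1.1.
  by rewrite EF addr0; case: eqP => // _; rewrite linear0.
Qed.

(* Only the root s alpha_i itself has eigenvalue s under z. *)
Lemma half_grading i z x : (forall j, sroot j z = (j != i).+1%:R :> K) -> half x ->
  exists a r, x = a *: E i + r /\
    eigspan (lie_bracket (H z)) (fun l => exists m, l = s * m.+2%:R) r.
Proof.
move=> az; have eE j (P : K -> Prop) : P (s * (j != i).+1%:R) ->
    eigspan (lie_bracket (H z)) P (E j).
  by move=> Pj; apply: addspan_gen; exists (s * (j != i).+1%:R); rewrite ?HE ?az.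
have lieE a y : eigspan (lie_bracket (H z)) (fun l => exists m, l = s * m.+2%:R) y ->
    eigspan (lie_bracket (H z)) (fun l => exists m, l = s * m.+2%:R) [lie a *: E i, y].
  rewrite lieZl => yL; apply: eigspanZ.
  apply: (eigspan_lie (L1 := fun l => l = s)) yL; last first.
    by apply: eE; rewrite eqxx mulr1.
  by move=> _ _ -> [m ->]; exists m.+1; rewrite -{1}[s]mulr1 -mulrDr nat1r.
elim/lie_generated_ind => [|a x1 x2 [a1 [r1 [-> r1L]]] [a2 [r2 [-> r2L]]]
  |x1 x2 hx1 hx2 [a1 [r1 [-> r1L]]] [a2 [r2 [-> r2L]]]|_ [j ->]].
- by exists 0, 0; rewrite scale0r addr0; split => //; exact: addspan0.
- exists (a * a1 + a2), (a *: r1 + r2); split; last first.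
    by apply: addspanD => //; exact: eigspanZ.
  by rewrite scalerDr scalerA addrACA scalerDl.
- exists 0, ([lie a1 *: E i, r2] - [lie a2 *: E i, r1] + [lie r1, r2]); split.
    rewrite scale0r add0r lieDl !lieDr [[lie a1 *: E i, a2 *: _]]lieZr lieZl.
    by rewrite lie_alt !scaler0 add0r -lieC addrA.
  apply: addspanD; first apply: addspanD.
  + exact: lieE.
  + by rewrite -scaleN1r; apply/eigspanZ/lieE.
  + apply: eigspan_lie r1L r2L => _ _ [m ->] [m' ->]; exists (m + m').+2.
    by rewrite -mulrDr -natrD !addSn !addnS.
- case: (altP (j =P i)) => [->|ji].
    by exists 1, 0; rewrite scale1r addr0; split => //; exact: addspan0.
  exists 0, (E j); rewrite scale0r add0r; split => //; apply: eE.
  by rewrite ji; exists 0%N.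
Qed.

Lemma half_cone z x : (forall j, exists m : nat, sroot j z = m%:R :> K) -> half x ->
  eigspan (lie_bracket (H z)) (fun l => exists m : nat, l = s * m%:R) x.
Proof.
move=> az; elim/lie_generated_ind => [|a x1 x2 x1L x2L|x1 x2 hx1 hx2 x1L x2L|_ [j ->]].
- exact: addspan0.
- by apply: addspanD => //; exact: eigspanZ.
- apply: eigspan_lie x1L x2L => _ _ [m ->] [m' ->]; exists (m + m')%N.
  by rewrite natrD mulrDr.
- by have [m azj] := az j; apply: addspan_gen; exists (s * m%:R); rewrite ?HE ?azj;
    last by []; exists m.
Qed.

End Half.

(** * Triangular decomposition *)

Section KacMoody.
Variables (K : numFieldType) (G : contragredientLie K).
Local Notation n := (km_rank G).
Local Notation H := (h_in G).

Definition nil_neg (x : G) : Prop := half (@e_neg K G) x.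

Lemma HE_pos z i : [lie H z, e_pos i] = (1 * (sroot i z : K)) *: e_pos (c := G) i.
Proof. by rewrite h_e_pos mul1r. Qed.

Lemma HE_neg z i : [lie H z, e_neg i] = (-1 * (sroot i z : K)) *: e_neg (c := G) i.
Proof. by rewrite h_e_neg mulN1r. Qed.

Lemma EF_neg i j : [lie e_pos (c := G) i, e_neg j] = if i == j then H (coroot i) else 0.
Proof. exact: e_pos_neg. Qed.

Lemma EF_pos i j : [lie e_neg (c := G) i, e_pos j] = if i == j then H (- coroot i) else 0.
Proof.
rewrite lieC e_pos_neg eq_sym; case: eqP => [->|_]; last by rewrite oppr0.
by rewrite linearN.
Qed.

(** The sum n_- + h + n contains the generators and is stable under bracket with each of them, hence
    with every element. *)
Lemma triangular (x : G) : exists a b c, [/\ nil_neg a, nil_pos c & x = a + H b + c].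
Proof.
pose tri x := exists a b c, [/\ nil_neg a, nil_pos c & x = a + H b + c].
have subp := half_sub (@e_pos K G); have subn := half_sub (@e_neg K G).
have triL k y z : tri y -> tri z -> tri (k *: y + z).
  move=> [a [b [c [na nc ->]]]] [a' [b' [c' [na' nc' ->]]]].
  exists (k *: a + a'), (k *: b + b'), (k *: c + c'); split.
  - exact: subn.1.2.
  - exact: subp.1.2.
  - by rewrite linearP !scalerDr addrACA; congr (_ + _); rewrite addrACA.
have trip y : nil_pos y -> tri y.
  by exists 0, 0, y; rewrite linear0 !add0r; split; first exact: subn.1.1.
have trin y : nil_neg y -> tri y.
  by exists y, 0, 0; rewrite linear0 !addr0; split=> //; exact: subp.1.1.
have trih b : tri (H b).
  by exists 0, b, 0; rewrite add0r addr0; split; [exact: subn.1.1|exact: subp.1.1|].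
have triD y z : tri y -> tri z -> tri (y + z).
  by rewrite -{2}[y]scale1r; exact: triL.
have trih_lie b y : tri y -> tri [lie H b, y].
  move=> [a [b' [c [na nc ->]]]]; rewrite !lieDr h_abelian addr0.
  apply: triD; first exact: trin (half_h HE_neg b na).
  exact: trip (half_h HE_pos b nc).
have tri0 : tri 0 by apply: trip; exact: subp.1.1.
have triZ k y : tri y -> tri (k *: y) by move=> ty; rewrite -[_ *: _]addr0; exact: triL.
have stable u : forall y, tri y -> tri [lie u, y].
  have := km_generated u; elim/lie_generated_ind => [|k v w tv tw|v w _ _ tv tw|v gv] y ty.
  - by rewrite lie0l.
  - by rewrite lieDl lieZl; apply: triL; [exact: tv|exact: tw].
  - rewrite -[[lie [lie v, w], y]](addrK [lie w, [lie v, y]]) -lieA -scaleN1r.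
    by apply: triD; [exact/tv/tw|exact/triZ/tw/tv].
  case: gv => [[b ->]|[k ->]|[k ->]]; first exact: trih_lie.
    have [a [b [c [na nc ->]]]] := ty; rewrite !lieDr.
    apply: (triD); [apply: (triD)|].
    + by have [b' [a' [na' ->]]] := half_opp HE_neg EF_neg k na; apply: triD; auto.
    + rewrite lieC h_e_pos -scaleNr; apply: (triZ); apply: (trip).
      exact: (half_gen (E := @e_pos K G) k).
    + apply: (trip); exact: (subp.2 _ _ (@half_gen _ _ _ k) nc).
  have [a [b [c [na nc ->]]]] := ty; rewrite !lieDr.
  apply: (triD); [apply: (triD)|].
  + apply: (trin); exact: (subn.2 _ _ (@half_gen _ _ _ k) na).
  + rewrite lieC h_e_neg -scaleNr; apply: (triZ); apply: (trin).
    exact: (half_gen (E := @e_neg K G) k).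
  + by have [b' [a' [na' ->]]] := half_opp HE_pos EF_pos k nc; apply: triD; auto.
have := km_generated x; elim/lie_generated_ind => [//|k y z|y z _ _ _ tz|y].
- exact: triL.
- exact: stable.
- case=> [[b ->]|[k ->]|[k ->]]; first exact: trih.
    by apply: (trip); exact: (half_gen (E := @e_pos K G) k).
  by apply: (trin); exact: (half_gen (E := @e_neg K G) k).
Qed.

End KacMoody.

(** * Integrality of the elements h_gamma *)

Section Roots.
Variables (K : numFieldType) (G : contragredientLie K).
Local Notation n := (km_rank G).
Local Notation H := (h_in G).

(** The simple roots are free, so their matrix on a basis of h has independent rows and a right
    inverse, which solves the system. *)
Lemma sroot_values (p : 'I_n -> K) : exists z : km_h G, forall j, sroot j z = p j :> K.
Proof.
pose b := vbasis {: km_h G}.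
pose A : 'M[K]_(n, \dim {: km_h G}) := \matrix_(j, k) sroot j b`_k.
have /row_freeP [B AB] : row_free A.
  apply: inj_row_free => v vA.
  have /(@freeP _ _ n (map_tuple (@sroot K G) (ord_tuple n))) fr := sroot_free G.
  apply/rowP => j; rewrite mxE; apply: fr j.
  under eq_bigr => j _ do rewrite -tnth_nth tnth_map tnth_ord_tuple.
  apply/lfunP => x; rewrite [in LHS](coord_vbasis (memvf x)) zero_lfunE linear_sum.
  apply: big1 => k _; rewrite linearZ /= sum_lfunE.
  have /rowP/(_ k) := vA; rewrite !mxE => vk.
  rewrite (_ : \sum_(i < n) _ = 0) ?scaler0 //.
  by rewrite -[RHS]vk; apply: eq_bigr => j _; rewrite mxE scale_lfunE.
exists (\sum_k (\sum_j p j * B k j) *: b`_k) => j.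
rewrite linear_sum /=.
transitivity (\sum_j' p j' * (A *m B) j j').
  under [RHS]eq_bigr => j' _ do rewrite mxE mulr_sumr.
  rewrite exchange_big; apply: eq_bigr => k _ /=.
  rewrite linearZ /= [X in X = _]mulr_suml; apply: eq_bigr => j' _.
  by rewrite mxE mulrAC -mulrA.
rewrite AB (bigD1 j) //= mxE eqxx mulr1 big1 ?addr0 // => j' j'j.
by rewrite mxE eq_sym (negPf j'j) mulr0.
Qed.

Definition int_coroot (z : km_h G) : Prop :=
  exists c : 'I_n -> int, z = \sum_k (c k)%:~R *: coroot k.

Lemma int_corootD z w : int_coroot z -> int_coroot w -> int_coroot (z + w).
Proof.
move=> [c ->] [d ->]; exists (fun k => c k + d k); rewrite -big_split.
by apply: eq_bigr => k _; rewrite intrD scalerDl.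
Qed.

Lemma int_corootZ (a : int) z : int_coroot z -> int_coroot (a%:~R *: z).
Proof.
move=> [c ->]; exists (fun k => a * c k); rewrite scaler_sumr.
by apply: eq_bigr => k _; rewrite intrM scalerA.
Qed.

Lemma int_coroot_coroot k : int_coroot (coroot k).
Proof.
exists (fun j => (j == k)%:Z); rewrite (bigD1 k) //= eqxx scale1r big1 ?addr0 //.
by move=> j /negPf ->; rewrite scale0r.
Qed.

Lemma sroot_int i z : int_coroot z -> exists a : int, sroot i z = a%:~R :> K.
Proof.
move=> [c ->]; exists (\sum_k c k * cartan G k i).
rewrite linear_sum rmorph_sum; apply: eq_bigr => k _ /=.
by rewrite linearZ /= sroot_coroot intrM.
Qed.

Lemma t_root_form gam k : sroot k (t_root gam) =
  (\sum_(j < n) gam 0 j * ((symm j)%:Z * cartan G j k))%:~R :> K.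
Proof.
rewrite linear_sum rmorph_sum; apply: eq_bigr => j _ /=.
by rewrite linearZ /= sroot_coroot !intrM mulrA.
Qed.

Lemma lattice_formE gam eta : (lattice_form (G := G) gam eta)%:~R =
  \sum_j (eta 0 j)%:~R * (sroot j (t_root gam) : K).
Proof.
rewrite /lattice_form exchange_big rmorph_sum; apply: eq_bigr => j _ /=.
rewrite t_root_form -rmorphM mulr_sumr; congr (_%:~R); apply: eq_bigr => i _.
by rewrite -mulrA mulrCA.
Qed.

Lemma t_root_delta i : t_root (delta_mx 0 i) = (symm i)%:R *: coroot (c := G) i.
Proof.
rewrite /t_root (bigD1 i) //= mxE !eqxx mul1r big1 ?addr0 // => j /negPf ji.
by rewrite mxE ji andbF mul0r scale0r.
Qed.

(** d is half of (gam, gam), which reflections preserve, and z is the coroot. A reflection subtracts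
    from z an integer multiple of [coroot i], so z stays integral. *)
Lemma real_root_coroot (gam : 'rV[int]_n) : real_root gam -> exists (d : K) z,
  [/\ d != 0, int_coroot z, t_root gam = d *: z &
      (lattice_form (G := G) gam gam)%:~R = 2%:R * d].
Proof.
elim=> [i|i {}gam _ [d [z [d0 zint tz fd]]]].
  have di : (symm i)%:R != 0 :> K by rewrite pnatr_eq0 -lt0n symm_gt0.
  exists (symm i)%:R, (coroot i); split => //.
  - exact: int_coroot_coroot.
  - exact: t_root_delta.
  rewrite lattice_formE t_root_delta (bigD1 i) //= mxE !eqxx big1 ?addr0.
    by rewrite mul1r linearZ /= sroot_coroot cartan_diag mulrC.
  by move=> j /negPf ji; rewrite mxE ji andbF mul0r.
have [a za] := sroot_int i zint.
pose r := \sum_(j < n) gam 0 j * cartan G i j.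
(* Both sides are (alpha_i, gam), by symmetry of the form. *)
have sr : (symm i)%:R * r%:~R = d * a%:~R :> K.
  have -> : d * a%:~R =
      (\sum_(j < n) gam 0 j * ((symm j)%:Z * cartan G j i))%:~R.
    by have := t_root_form gam i; rewrite tz linearZ /= za.
  rewrite /r -[(symm i)%:R]/((symm i)%:Z%:~R) -intrM mulr_sumr; congr (_%:~R).
  by apply: eq_bigr => j _; rewrite mulrCA cartan_symm.
have tr : t_root (lattice_reflection i gam) = d *: (z - a%:~R *: coroot i).
  rewrite scalerBr scalerA -sr -tz [_ * r%:~R]mulrC -scalerA -t_root_delta.
  rewrite /t_root scaler_sumr -sumrB; apply: eq_bigr => j _.
  rewrite scalerA -scalerBl /lattice_reflection !mxE; congr (_ *: _).
  by rewrite intrB intrM mulrBl mulrA.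
exists d, (z - a%:~R *: coroot i); split => //.
  rewrite -scaleN1r -[-1]/((-1)%:~R); apply: int_corootD => //.
  by do 2!apply: int_corootZ; exact: int_coroot_coroot.
rewrite lattice_formE tr.
rewrite (eq_bigr (fun j => (gam 0 j)%:~R * (d * sroot j z)
    - (d * a%:~R) * (gam 0 j * cartan G i j)%:~R
    - ((j == i)%:R * r)%:~R * (d * (sroot j z - a%:~R * (cartan G i j)%:~R))
    :> K)); last first.
  move=> j _; rewrite linearZ linearB linearZ /= sroot_coroot !mxE eqxx /= -/r.
  rewrite /GRing.scale /= [r * _]mulrC intrB mulrBl; congr (_ - _).
  by rewrite intrM; ring.
rewrite !sumrB [X in _ - X](bigD1 i) //= [X in _ - (_ + X)]big1 ?addr0; last first.
  by move=> j /negPf ->; rewrite mul0r mul0r.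
rewrite -mulr_sumr -rmorph_sum /= -/r eqxx mul1r cartan_diag za.
have -> : \sum_j (gam 0 j)%:~R * (d * (sroot j z : K)) = 2%:R * d.
  rewrite -fd lattice_formE tz; apply: eq_bigr => j _.
  by rewrite [in RHS]linearZ.
by rewrite -[2%:~R]/(2%:R : K); ring.
Qed.

Lemma int_coroot_t_root gam : int_coroot (t_root gam).
Proof.
exists (fun k => gam 0 k * (symm k)%:Z); apply: eq_bigr => k _.
by rewrite intrM.
Qed.

(** Consequently an integral weight shifts h_gamma + k by an integer, and the result is again a
    denominator. *)
Lemma int_coroot_h_root gam : int_coroot (h_root (G := G) gam).
Proof.
rewrite /h_root; case: asboolP => [/real_root_coroot|_]; last first.
  exact: int_coroot_t_root.
move=> [d [z [d0 zint -> ->]]]; rewrite scalerA invfM mulrA divff ?pnatr_eq0 //.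
by rewrite mul1r mulVf // scale1r.
Qed.

End Roots.

(** * The nilradical of a minimal parabolic subalgebra *)

Section Parabolic.
Variables (K : numFieldType) (G : contragredientLie K).
Local Notation n := (km_rank G).
Local Notation H := (h_in G).

Definition int_weight (x : G) : Prop :=
  (forall z, exists c : K, [lie H z, x] = c *: x) /\
  forall k, exists c : int, [lie H (coroot k), x] = c%:~R *: x.

Lemma int_weight_pos k : int_weight (e_pos k).
Proof.
split=> [z|j]; first by exists (sroot k z : K); exact: h_e_pos.
by exists (cartan G j k); rewrite h_e_pos sroot_coroot.
Qed.

Lemma int_weight_neg k : int_weight (e_neg k).
Proof.
split=> [z|j]; first by exists (- (sroot k z : K)); exact: h_e_neg.
by exists (- cartan G j k); rewrite h_e_neg sroot_coroot intrN.
Qed.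

Lemma int_weight_h z : int_weight (H z).
Proof.
split=> [w|j]; first by exists 0; rewrite h_abelian scale0r.
by exists 0; rewrite h_abelian scale0r.
Qed.

Lemma int_weight_lie x y : int_weight x -> int_weight y -> int_weight [lie x, y].
Proof.
move=> [xh xk] [yh yk]; split=> [z|k].
  have [c Ec] := xh z; have [d Ed] := yh z; exists (c + d).
  by rewrite lieA Ec Ed lieZl lieZr scalerDl.
have [c Ec] := xk k; have [d Ed] := yk k; exists (c + d).
by rewrite lieA Ec Ed lieZl lieZr intrD scalerDl.
Qed.

Lemma int_weightZ a x : int_weight x -> int_weight (a *: x).
Proof.
move=> [xh xk]; split=> [z|k].
  by have [c Ec] := xh z; exists c; rewrite lieZr Ec !scalerA mulrC.
by have [c Ec] := xk k; exists c; rewrite lieZr Ec !scalerA mulrC.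
Qed.

Lemma lie_generated_weight (P : G -> Prop) x : (forall y, P y -> int_weight y) ->
  lie_generated P x -> addspan (fun y => lie_generated P y /\ int_weight y) x.
Proof.
have sub := lie_generated_sub P; move=> Pw.
have genZ a y : addspan (fun y => lie_generated P y /\ int_weight y) y ->
    addspan (fun y => lie_generated P y /\ int_weight y) (a *: y).
  elim/addspan_ind_additive => [|u v|u [Pu wu]].
  - by rewrite scaler0; constructor.
  - by rewrite scalerDr; exact: addspanD.
  - apply: addspan_gen; split; last exact: int_weightZ.
    exact: (subspaceZ _ sub.1).
elim/lie_generated_ind => [|a u v Hu Hv|u v _ _ Hu|u Pu].
- exact: addspan0.
- by apply: addspanD => //; exact: genZ.
- elim/addspan_ind_additive: u / Hu => [|u u' IH IH'|u [Pu wu]].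
  + by rewrite lie0l; constructor.
  + by move=> Hv; rewrite lieDl; apply: addspanD; [exact: IH | exact: IH'].
  elim/addspan_ind_additive => [|w w' IH IH'|w [Pw' ww]].
  + by rewrite lie0r; constructor.
  + by rewrite lieDr; exact: addspanD.
  by apply: addspan_gen; split; [exact: sub.2 | exact: int_weight_lie].
- by apply: addspan_gen; split; [exact: lie_generated_gen | exact: Pw].
Qed.

Lemma int_weight_span x : addspan int_weight x.
Proof.
have := km_generated x; move/lie_generated_weight => E.
have : addspan (fun y => lie_generated (fun y => [\/ exists z, y = H z,
  exists i, y = e_pos i | exists i, y = e_neg (c := G) i]) y /\ int_weight y) x.
  apply: E => y [[z ->]|[k ->]|[k ->]].
  - exact: int_weight_h.
  - exact: int_weight_pos.
  - exact: int_weight_neg.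
elim/addspan_ind_additive => [|u v|u [_ wu]]; first exact: addspan0.
  exact: addspanD.
exact: addspan_gen.
Qed.

Variable i : 'I_n.

(** Generating m by whole strings of ad e_i through the other simple root vectors makes its
    stability under e_i immediate. *)
Definition par_gen (y : G) : Prop :=
  exists j k, j != i /\ y = iter k (lie_bracket (e_pos i)) (e_pos j).
Definition par_nil := lie_generated par_gen.

Lemma par_nil_sub : is_lie_subalgebra par_nil. Proof. exact: lie_generated_sub. Qed.

Lemma par_nil_gen j k : j != i -> par_nil (iter k (lie_bracket (e_pos i)) (e_pos j)).
Proof. by move=> ji; apply: lie_generated_gen; exists j, k. Qed.

Lemma int_weight_par_gen y : par_gen y -> int_weight y.
Proof.
move=> [j [k [_ ->]]]; elim: k => [|k IHk] /=; first exact: int_weight_pos.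
by apply: int_weight_lie => //; exact: int_weight_pos.
Qed.

Lemma par_nil_weight x : par_nil x -> addspan (fun y => par_nil y /\ int_weight y) x.
Proof. exact/lie_generated_weight/int_weight_par_gen. Qed.

Lemma par_nil_e x : par_nil x -> par_nil [lie e_pos i, x].
Proof.
apply: lie_generated_deriv => _ [j [k [ji ->]]]; exact: (par_nil_gen k.+1).
Qed.

Lemma par_nil_h z x : par_nil x -> par_nil [lie H z, x].
Proof.
apply: lie_generated_deriv => y gy; have [yh _] := int_weight_par_gen gy.
have [c ->] := yh z; apply: (subspaceZ _ par_nil_sub.1).
exact: lie_generated_gen.
Qed.

(** f_i commutes with e_j for j <> i, and along a string [f, [e, x]] = [[f, e], x] + [e, [f, x]]
    stays in m. *)
Lemma par_nil_f x : par_nil x -> par_nil [lie e_neg i, x].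
Proof.
apply: lie_generated_deriv => _ [j [k [ji ->]]].
have ifj : [lie e_neg i, e_pos j] = 0 :> G.
  by rewrite EF_pos eq_sym (negPf ji).
elim: k => [|k IHk] /=; first by rewrite ifj; exact: par_nil_sub.1.1.
rewrite lieA EF_pos eqxx; apply: (subspaceD par_nil_sub.1).
  by apply: par_nil_h; exact: (par_nil_gen k ji).
exact: par_nil_e.
Qed.

Lemma par_nil_pos x : par_nil x -> nil_pos x.
Proof.
apply: lie_generated_mono => _ [j [k [_ ->]]]; elim: k => [|k IHk] /=.
  exact: half_gen.
by apply: (half_sub (@e_pos K G)).2 => //; exact: half_gen.
Qed.

Lemma nil_pos_par x : nil_pos x -> exists a y, par_nil y /\ x = a *: e_pos i + y.
Proof.
have sub := par_nil_sub.
elim/lie_generated_ind => [|c u v [a [y [py ->]]] [b [w [pw ->]]]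
  |u v _ _ [a [y [py ->]]] [b [w [pw ->]]]|_ [j ->]].
- by exists 0, 0; rewrite scale0r addr0; split => //; exact: sub.1.1.
- exists (c * a + b), (c *: y + w); split; first exact: sub.1.2.
  by rewrite scalerDr scalerA addrACA scalerDl.
- exists 0, (a *: [lie e_pos i, w] - b *: [lie e_pos i, y] + [lie y, w]); split.
    apply: (subspaceD sub.1); last exact: sub.2.
    rewrite -scaleN1r scalerA; apply: (subspaceD sub.1).
      by apply: (subspaceZ _ sub.1); exact: par_nil_e.
    by apply: (subspaceZ _ sub.1); exact: par_nil_e.
  rewrite scale0r add0r lieDl !lieDr !lieZl !lieZr lie_alt !scaler0 add0r.
  by rewrite [[lie y, e_pos i]]lieC scalerN addrA.
- case: (altP (j =P i)) => [->|ji].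
    by exists 1, 0; rewrite scale1r addr0; split => //; exact: sub.1.1.
  exists 0, (e_pos j); rewrite scale0r add0r; split => //.
  exact: (par_nil_gen 0).
Qed.

Lemma eigspan_h z b (L : K -> Prop) : L 0 -> eigspan (lie_bracket (H z)) L (H b).
Proof.
by move=> L0; apply: addspan_gen; exists 0; rewrite ?h_abelian ?scale0r.
Qed.

(** z is 1 on alpha_i and 2 on the other simple roots, so that the eigenvalue 1 can come only from
    the line of e_i. *)
Lemma pos_eigen z x : (forall j, sroot j z = (j != i).+1%:R :> K) ->
  exists a r, x = r + a *: e_pos i /\ eigspan (lie_bracket (H z)) (fun l => l <> 1) r.
Proof.
move=> az; have [y [b [w [ny pw ->]]]] := triangular x.
have [a [r [-> rL]]] := half_grading (@HE_pos K G) az pw.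
exists a, (y + H b + r); rewrite -!addrA [r + _]addrC; split => //.
have az' j : exists m : nat, sroot j z = m%:R :> K.
  by exists (j != i).+1; exact: az.
apply: addspanD; last apply: addspanD.
- apply: eigspanS (half_cone (@HE_neg K G) az' ny) => l [m ->] E.
  have : (m%:R + 1 : K) = 0 by apply/eqP; rewrite addrC addr_eq0 -mulN1r E.
  by apply/eqP; rewrite natr1 pnatr_eq0.
- by apply: eigspan_h; apply/eqP; rewrite eq_sym oner_eq0.
- apply: eigspanS rL => l [m ->]; rewrite mul1r => /eqP.
  by rewrite (eqr_nat K m.+2 1).
Qed.

Lemma neg_eigen z x : (forall j, sroot j z = (j != i).+1%:R :> K) ->
  exists a r, x = r + a *: e_neg i /\ eigspan (lie_bracket (H z)) (fun l => l <> -1) r.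
Proof.
move=> az; have [y [b [w [ny pw ->]]]] := triangular x.
have [a [r [-> rL]]] := half_grading (@HE_neg K G) az ny.
exists a, (r + (H b + w)); split; first by rewrite -!addrA addrC -!addrA.
have az' j : exists m : nat, sroot j z = m%:R :> K.
  by exists (j != i).+1; exact: az.
apply: addspanD; last apply: addspanD.
- apply: eigspanS rL => l [m ->]; rewrite mulN1r => /oppr_inj/eqP.
  by rewrite (eqr_nat K m.+2 1).
- by apply: eigspan_h; apply/eqP; rewrite eq_sym oppr_eq0 oner_eq0.
- apply: eigspanS (half_cone (@HE_pos K G) az' pw) => l [m ->]; rewrite mul1r => E.
  have : (m%:R + 1 : K) = 0 by rewrite E addNr.
  by apply/eqP; rewrite natr1 pnatr_eq0.
Qed.

(** As z vanishes on alpha_i, the parts n_-, h and e_i only carry zero or negative eigenvalues, and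
    the eigenvalue 1 is confined to m. *)
Lemma par_eigen z x : (forall j, sroot j z = (j != i)%:R :> K) ->
  exists r y, [/\ x = r + y, par_nil y & eigspan (lie_bracket (H z)) (fun l => l <> 1) r].
Proof.
move=> az; have [w [b [v [nw pv ->]]]] := triangular x.
have [a [y [py ->]]] := nil_pos_par pv.
exists (w + H b + a *: e_pos i), y; split => //; first by rewrite !addrA.
have az' j : exists m : nat, sroot j z = m%:R :> K.
  by exists (j != i); exact: az.
have n01 : 0 <> 1 :> K by apply/eqP; rewrite eq_sym oner_eq0.
apply: addspanD; first apply: addspanD.
- apply: eigspanS (half_cone (@HE_neg K G) az' nw) => l [m ->] E.
  have : (m%:R + 1 : K) = 0 by apply/eqP; rewrite addrC addr_eq0 -mulN1r E.
  by apply/eqP; rewrite natr1 pnatr_eq0.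
- exact: eigspan_h.
- apply: eigspanZ; apply: addspan_gen; exists 0 => //.
  by rewrite -[LHS]/[lie H z, e_pos i] h_e_pos az eqxx.
Qed.

End Parabolic.

(** * Admissible algebras *)

Section LocalNilpotency.
Variables (K : numFieldType) (A : algType K).
Implicit Types (a e f h x y : A).

Definition ad_nilpotent e x := exists N, iter N (ad e) x = 0.

Lemma ad_nilpotentP e x : ad_nilpotent e x <-> exists p, adexp e p x.
Proof.
split=> [[N] | [p px]]; first exact: adexp_exists.
exists (size p); have /eqP := px (size p); rewrite nth_default // eq_sym.
rewrite scaler_eq0 mulf_eq0 signr_eq0 invr_eq0 pnatr_eq0.
by rewrite gtn_eqF ?fact_gt0 // => /eqP.
Qed.

Lemma ad_nilpotentM e x y : ad_nilpotent e x -> ad_nilpotent e y ->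
  ad_nilpotent e (x * y).
Proof.
move=> /ad_nilpotentP [p px] /ad_nilpotentP [r ry]; apply/ad_nilpotentP.
by exists (p * r); exact: adexpM.
Qed.

Lemma ad_nilpotentD e c x y : ad_nilpotent e x -> ad_nilpotent e y ->
  ad_nilpotent e (c *: x + y).
Proof.
move=> [N xN] [N' yN]; exists (N + N')%N.
rewrite iter_adD iter_adZ.
have -> : iter (N + N') (ad e) y = 0 by rewrite iterD yN iter_ad0.
by rewrite addnC iterD xN iter_ad0 scaler0 addr0.
Qed.

Lemma ad_nilpotent1 e : ad_nilpotent e 1.
Proof. by exists 1%N; rewrite /= /ad mulr1 mul1r subrr. Qed.

Lemma ad_ad x y a : ad x (ad y a) = ad (ad x y) a + ad y (ad x a).
Proof.
rewrite [ad y a]/ad adB !adMr [ad x a * y + _]addrC opprD addrACA.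
by rewrite -/(ad _ a) -/(ad y _).
Qed.

Lemma ad_nilpotent_min e x : ad_nilpotent e x -> x != 0 ->
  exists N, iter N.+1 (ad e) x = 0 /\ iter N (ad e) x != 0.
Proof.
move=> [N]; elim: N => [/= ->|N IHN]; first by rewrite eqxx.
move=> xN x0; case: (eqVneq (iter N (ad e) x) 0) => [/IHN/(_ x0)//|xN'].
by exists N.
Qed.

Lemma ad_eigen_shift e h (b c : K) a k : ad h e = b *: e -> ad h a = c *: a ->
  ad h (iter k (ad e) a) = (c + b * k%:R) *: iter k (ad e) a.
Proof.
move=> he hc; elim: k => [|k IHk] /=; first by rewrite mulr0 addr0.
rewrite ad_ad he IHk adZ adZl -scalerDl; congr (_ *: _).
by rewrite -[k.+1%:R]natr1; ring.
Qed.

(* The highest weight argument for finite-dimensional sl2-modules. *)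
Lemma sl2_integral e f h c a :
    ad e f = h -> ad h e = 2%:R *: e -> ad h f = - 2%:R *: f ->
    (forall x, ad_nilpotent e x) -> (forall x, ad_nilpotent f x) ->
    ad h a = c *: a -> a != 0 ->
  exists k : int, c = k%:~R.
Proof.
move=> ef he hf e_nil f_nil hc a0.
have [N [eN eN0]] := ad_nilpotent_min (e_nil a) a0.
set w := iter N (ad e) a in eN0; have ew : ad e w = 0 by [].
pose c' := c + 2%:R * N%:R.
have hw : ad h w = c' *: w by exact: ad_eigen_shift.
have [M [fM fM0]] := ad_nilpotent_min (f_nil w) eN0.
have efk k : ad e (iter k.+1 (ad f) w) =
    (k.+1%:R * (c' - k%:R)) *: iter k (ad f) w.
  elim: k => [|k IHk].
    by rewrite /= ad_ad ef ew ad0 addr0 hw mul1r subr0.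
  rewrite iterS ad_ad ef IHk adZ -[ad f _]/(iter k.+1 (ad f) w).
  rewrite (ad_eigen_shift k.+1 hf hw) -scalerDl; congr (_ *: _).
  by rewrite -[k.+2%:R]natr1 -[k.+1%:R]natr1; ring.
have := efk M; rewrite fM ad0 => /esym/eqP.
rewrite scaler_eq0 (negPf fM0) orbF mulf_eq0 pnatr_eq0 /= subr_eq0 => /eqP cM.
exists (M%:Z - 2 * N%:Z); rewrite intrB intrM -[M%:~R]/(M%:R : K) -cM.
by rewrite /c' -[2%:~R]/(2%:R : K) -[N%:~R]/(N%:R : K) addrK.
Qed.

End LocalNilpotency.

Section WeightSpan.
Variables (K : numFieldType) (G : contragredientLie K) (A : algType K).
Variable hA : km_h G -> A.

Definition alg_int_weight (a : A) : Prop :=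
  (forall z, exists c : K, ad (hA z) a = c *: a) /\
  forall k, exists c : int, ad (hA (coroot k)) a = c%:~R *: a.

Lemma alg_int_weightM a b :
  alg_int_weight a -> alg_int_weight b -> alg_int_weight (a * b).
Proof.
move=> [ah ak] [bh bk]; split=> [z|k].
  have [c Ec] := ah z; have [d Ed] := bh z; exists (c + d).
  by rewrite adMr Ec Ed -scalerAl -scalerAr scalerDl.
have [c Ec] := ak k; have [d Ed] := bk k; exists (c + d).
by rewrite adMr Ec Ed -scalerAl -scalerAr intrD scalerDl.
Qed.

Lemma alg_int_weightZ s a : alg_int_weight a -> alg_int_weight (s *: a).
Proof.
move=> [ah ak]; split=> [z|k].
  by have [c Ec] := ah z; exists c; rewrite adZ Ec !scalerA mulrC.
by have [c Ec] := ak k; exists c; rewrite adZ Ec !scalerA mulrC.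
Qed.

Lemma alg_int_weight1 : alg_int_weight 1.
Proof.
by split=> [z|k]; exists 0; rewrite /ad mulr1 mul1r subrr scale0r.
Qed.

Lemma weight_spanM a b : addspan alg_int_weight a -> addspan alg_int_weight b ->
  addspan alg_int_weight (a * b).
Proof.
elim/addspan_ind_additive => [|u v IHu IHv|u wu].
- by rewrite mul0r; constructor.
- by move=> wb; rewrite mulrDl; apply: addspanD; [exact: IHu | exact: IHv].
elim/addspan_ind_additive => [|v w IHv IHw|v wv].
- by rewrite mulr0; constructor.
- by rewrite mulrDr; exact: addspanD.
- by apply: addspan_gen; exact: alg_int_weightM.
Qed.

Lemma weight_spanD s a b : addspan alg_int_weight a -> addspan alg_int_weight b ->
  addspan alg_int_weight (s *: a + b).
Proof.
move=> wa wb; apply: addspanD => //; elim/addspan_ind_additive: wa => [|u v|u wu].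
- by rewrite scaler0; constructor.
- by rewrite scalerDr; exact: addspanD.
- by apply: addspan_gen; exact: alg_int_weightZ.
Qed.

End WeightSpan.

Section AdmissibleAlgebra.
Variables (K : numFieldType) (G : contragredientLie K).
Variables (U : envelopingAlgebra G) (A : algType K) (iA : {lrmorphism U -> A}).
Local Notation n := (km_rank G).
Local Notation H := (h_in G).
Local Notation gA := (g_in iA).

Lemma g_in_lie x y : gA [lie x, y] = ad (gA x) (gA y).
Proof. by rewrite /g_in env_in_lie rmorphB !rmorphM. Qed.

Lemma g_inP c x y : gA (c *: x + y) = c *: gA x + gA y.
Proof. by rewrite /g_in linearP linearP. Qed.

Lemma g_in0 : gA 0 = 0. Proof. by rewrite /g_in !linear0. Qed.

Lemma g_inZ c x : gA (c *: x) = c *: gA x.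
Proof. by rewrite -[_ *: x]addr0 g_inP g_in0 addr0. Qed.

Lemma g_inD x y : gA (x + y) = gA x + gA y.
Proof. by rewrite -[x]scale1r g_inP !scale1r. Qed.

Lemma g_in_iter u k x : gA (iter k (lie_bracket u) x) = iter k (ad (gA u)) (gA x).
Proof. by elim: k => //= k <-; rewrite g_in_lie. Qed.

Hypothesis admA : admissible iA.

Lemma real_root_pos i : real_root (G := G) (delta_mx 0 i).
Proof. exact: real_simple. Qed.

Lemma real_root_neg i : real_root (G := G) (- delta_mx 0 i).
Proof.
have -> : - delta_mx 0 i = lattice_reflection (G := G) i (delta_mx 0 i).
  rewrite /lattice_reflection (bigD1 i) //= mxE !eqxx mul1r cartan_diag big1.
    by rewrite addr0 scaler_nat mulr2n opprD addNKr.
  by move=> j /negPf ji; rewrite mxE ji andbF mul0r.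
by constructor; exact: real_root_pos.
Qed.

Lemma lattice_eval_delta i z : lattice_eval (G := G) (delta_mx 0 i) z = sroot i z.
Proof.
rewrite /lattice_eval (bigD1 i) //= mxE !eqxx mul1r big1 ?addr0 // => j /negPf ji.
by rewrite mxE ji andbF mul0r.
Qed.

Lemma root_space_pos i : root_space (G := G) (delta_mx 0 i) (e_pos i).
Proof. by move=> z; rewrite lattice_eval_delta h_e_pos. Qed.

Lemma root_space_neg i : root_space (G := G) (- delta_mx 0 i) (e_neg i).
Proof.
move=> z; rewrite h_e_neg -lattice_eval_delta /lattice_eval -sumrN.
congr (_ *: _); apply: eq_bigr => j _.
have -> : (- delta_mx 0 i : 'rV[int]_n) 0 j = - (delta_mx 0 i : 'rV[int]_n) 0 j.
  by rewrite mxE.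
by rewrite intrN mulNr.
Qed.

(** Rests on A = U(g) V: [tensor_ind] reduces to products u v, and [env_ind] treats the factor u. *)
Lemma admissible_ind (P : A -> Prop) : P 0 ->
    (forall c x y, P x -> P y -> P (c *: x + y)) ->
    (forall x y, P x -> P y -> P (x * y)) -> P 1 ->
    (forall x, P (gA x)) ->
    (forall (V : lmodType K) (v : {linear V -> A}),
       (forall x w, exists w', ad (gA x) (v w) = v w') ->
       (forall gam (x : G), real_root gam -> root_space gam x ->
          forall w, exists N, iter N (ad (gA x)) (v w) = 0) ->
       (forall w : V, exists m (y : 'I_m -> V) (mu : 'I_m -> km_h G -> K),
          w = \sum_(k < m) y k /\
          forall k z, ad (gA (H z)) (v (y k)) = mu k z *: v (y k)) ->
       forall w, P (v w)) ->
  forall a, P a.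
Proof.
move=> P0 PD PM P1 Pg PV a.
have [V [v [[_ v_st t1 _] [v_nil v_wt]]]] := admA.
apply: (tensor_ind t1) => // [x y Px Py|u w].
  by rewrite addrC -scaleN1r; exact: PD.
apply: (PM); last exact: PV v_st v_nil v_wt w.
apply: (env_ind (P := fun u => P (iA u))) => [|c x y Px Py|x y Px Py|x].
- by rewrite rmorph1.
- by rewrite linearP; exact: PD.
- by rewrite rmorphM; exact: PM.
- exact: Pg.
Qed.

Lemma ad_nilpotent_admissible e : (forall x, ad_nilpotent (gA e) (gA x)) ->
  (exists gam, real_root gam /\ root_space gam e) -> forall a, ad_nilpotent (gA e) a.
Proof.
move=> e_g [gam [re rs]]; apply: admissible_ind => //.
- by exists 0%N.
- by move=> *; exact: ad_nilpotentD.
- by move=> *; exact: ad_nilpotentM.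
- exact: ad_nilpotent1.
- by move=> V v _ v_nil _ w; exact: v_nil re rs w.
Qed.

Lemma ad_nilpotent_lie e : (forall y, [\/ exists z, y = H z, exists i, y = e_pos i
    | exists i, y = e_neg (c := G) i] -> ad_nilpotent (gA e) (gA y)) ->
  forall x, ad_nilpotent (gA e) (gA x).
Proof.
move=> egen x; have := km_generated x.
elim/lie_generated_ind => [|c y z ey ez|y z _ _ ey ez|y]; last exact: egen.
- by rewrite g_in0; exists 0%N.
- by rewrite g_inP; exact: ad_nilpotentD.
- rewrite g_in_lie /ad -[_ - _]addrC -scaleN1r.
  by apply: ad_nilpotentD; exact: ad_nilpotentM.
Qed.

(** On V this is admissibility, alpha_i being real. On g it is checked on the generators, the Serre
    relations bounding the strings through e_j. *)
Lemma ad_nilpotent_pos i a : ad_nilpotent (gA (e_pos i)) a.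
Proof.
apply: ad_nilpotent_admissible; last first.
  by exists (delta_mx 0 i); split; [exact: real_root_pos|exact: root_space_pos].
apply: ad_nilpotent_lie => _ [[z ->]|[j ->]|[j ->]].
- exists 2%N; rewrite -g_in_iter /= [[lie e_pos i, H z]]lieC h_e_pos lieNr lieZr.
  by rewrite lie_alt scaler0 oppr0 g_in0.
- case: (eqVneq i j) => [<-|ij].
    by exists 1%N; rewrite -g_in_iter /= lie_alt g_in0.
  by exists (absz (1 - cartan G i j)); rewrite -g_in_iter (serre_pos ij) g_in0.
- case: (eqVneq i j) => [<-|ij]; last first.
    by exists 1%N; rewrite -g_in_iter /= EF_neg (negPf ij) g_in0.
  exists 3%N; rewrite -g_in_iter /= EF_neg eqxx [[lie e_pos i, H _]]lieC h_e_pos.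
  by rewrite lieNr lieZr lie_alt scaler0 oppr0 g_in0.
Qed.

Lemma ad_nilpotent_neg i a : ad_nilpotent (gA (e_neg i)) a.
Proof.
apply: ad_nilpotent_admissible; last first.
  by exists (- delta_mx 0 i); split; [exact: real_root_neg|exact: root_space_neg].
apply: ad_nilpotent_lie => _ [[z ->]|[j ->]|[j ->]].
- exists 2%N; rewrite -g_in_iter /= [[lie e_neg i, H z]]lieC h_e_neg lieNr lieZr.
  by rewrite lie_alt scaler0 oppr0 g_in0.
- case: (eqVneq i j) => [<-|ij]; last first.
    by exists 1%N; rewrite -g_in_iter /= EF_pos (negPf ij) g_in0.
  exists 3%N; rewrite -g_in_iter /= EF_pos eqxx [[lie e_neg i, H _]]lieC h_e_neg.
  by rewrite lieNr lieZr lie_alt scaler0 oppr0 g_in0.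
- case: (eqVneq i j) => [<-|ij].
    by exists 1%N; rewrite -g_in_iter /= lie_alt g_in0.
  by exists (absz (1 - cartan G i j)); rewrite -g_in_iter (serre_neg ij) g_in0.
Qed.

Lemma coroot_integral k (a : A) c : ad (gA (H (coroot k))) a = c *: a -> a != 0 ->
  exists m : int, c = m%:~R.
Proof.
apply: (@sl2_integral _ _ (gA (e_pos k)) (gA (e_neg k))).
- by rewrite -g_in_lie EF_neg eqxx.
- by rewrite -g_in_lie h_e_pos g_inZ sroot_coroot cartan_diag.
- by rewrite -g_in_lie h_e_neg g_inZ sroot_coroot cartan_diag.
- exact: ad_nilpotent_pos.
- exact: ad_nilpotent_neg.
Qed.

Lemma g_in_int_weight x : int_weight x -> alg_int_weight (gA \o H) (gA x).
Proof.
move=> [xh xk]; split=> [z|k].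
  by have [c Ec] := xh z; exists c; rewrite /= -g_in_lie Ec g_inZ.
by have [c Ec] := xk k; exists c; rewrite /= -g_in_lie Ec g_inZ.
Qed.

(** Admissibility yields weight vectors in V with arbitrary weights; for the nonzero ones sl2-theory
    forces integrality on the coroots, and zero summands are dropped. *)
Lemma admissible_weight_span (a : A) : addspan (alg_int_weight (gA \o H)) a.
Proof.
apply: admissible_ind a => [|c x y wx wy|x y wx wy||x|V v _ _ v_wt w].
- exact: addspan0.
- exact: weight_spanD.
- exact: weight_spanM.
- exact/addspan_gen/alg_int_weight1.
- elim/addspan_ind_additive: (int_weight_span x) => [|y z|y /g_in_int_weight].
  + by rewrite g_in0; exact: addspan0.
  + by rewrite g_inD; exact: addspanD.
  + exact: addspan_gen.
have [m [y [mu [-> y_wt]]]] := v_wt w; rewrite linear_sum /=.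
apply: addspan_sum => k; have [->|vk] := eqVneq (v (y k)) 0; first exact: addspan0.
apply: addspan_gen; split=> [z|j]; first by exists (mu k z); exact: y_wt.
have [c Ec] := coroot_integral (y_wt k (coroot j)) vk.
by exists c; rewrite -Ec; exact: y_wt.
Qed.

End AdmissibleAlgebra.

(** * The localized algebra *)

Section LeftQuotient.
Variables (B : nzRingType) (N : B -> Prop).

Lemma cls_zmod_morphism : zmod_morphism (cls N).
Proof. by move=> x y; exact: raddfB. Qed.
HB.instance Definition _ := GRing.isZmodMorphism.Build B (left_quot N) (cls N)
  cls_zmod_morphism.

Lemma cls_rep u : cls N (rep u) = u.
Proof. exact: reprK. Qed.

Lemma cls_eq0 x : cls N x = 0 <-> left_ideal N x.
Proof.
rewrite -(raddf0 (cls N)); split=> [/eqP|Nx].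
  by rewrite -Quotient.idealrBE subr0 => /asboolP.
by apply/eqP; rewrite -Quotient.idealrBE subr0; exact/asboolP.
Qed.

Lemma left_ideal_addspan x :
  left_ideal N x <-> addspan (fun x => exists a y, N y /\ x = a * y) x.
Proof.
split=> [[m [a [y [Ny ->]]]]|].
  by apply: addspan_sum => k; apply: addspan_gen; exists (a k), (y k).
have [N0 ND] := left_ideal_zmod_closed N.
have LN u v : left_ideal N u -> left_ideal N v -> left_ideal N (u + v).
  move=> Nu Nv; rewrite -[v]opprK; have /asboolP // : u - - v \in left_idealb N.
  apply: (ND); first exact/asboolP.
  by rewrite -sub0r; apply: ND => //; exact/asboolP.
elim/addspan_ind_additive => [|//|_ [a [y [Ny ->]]]]; first exact/asboolP.
by exists 1%N, (fun=> a), (fun=> y); rewrite big_ord1.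
Qed.

End LeftQuotient.

(** * Moving D past weight vectors *)

Section Localized.
Variables (K : numFieldType) (G : contragredientLie K).
Variables (U : envelopingAlgebra G) (A : algType K) (iA : {lrmorphism U -> A}).
Variable L : localizedAlgebra iA.
Local Notation n := (km_rank G).
Local Notation H := (h_in G).
Local Notation iD := (D_in L).
Local Notation gL := (g_A' L).

Definition cartan_part (u : loc_D L) : Prop := exists v, u = to_D L v.
Definition denominator (s : loc_D L) : Prop :=
  exists2 v, denominators v & s = to_D L v.

Lemma D_in_h z : iD (h_D L z) = gL (H z).
Proof. by rewrite D_A_compat Uh_inE. Qed.

Lemma gL_lie x y : gL [lie x, y] = ad (gL x) (gL y).
Proof. by rewrite /g_A' g_in_lie rmorph_ad. Qed.

Lemma gLP c x y : gL (c *: x + y) = c *: gL x + gL y.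
Proof. by rewrite /g_A' g_inP linearP. Qed.

Lemma gL0 : gL 0 = 0. Proof. by rewrite /g_A' g_in0 linear0. Qed.

Lemma gLZ c x : gL (c *: x) = c *: gL x.
Proof. by rewrite /g_A' g_inZ linearZ. Qed.

Lemma gLD x y : gL (x + y) = gL x + gL y.
Proof. by rewrite /g_A' g_inD linearD. Qed.

Lemma gLN x : gL (- x) = - gL x.
Proof. by rewrite -scaleN1r gLZ scaleN1r. Qed.

Lemma h_DP c y z : h_D L (c *: y + z) = c *: h_D L y + h_D L z.
Proof. by rewrite /h_D -linearP -linearP. Qed.

Lemma h_DD y z : h_D L (y + z) = h_D L y + h_D L z.
Proof. by rewrite -[y]scale1r h_DP !scale1r. Qed.

Lemma h_D0 : h_D L 0 = 0.
Proof. by apply: (addrI (h_D L 0)); rewrite -h_DD !addr0. Qed.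

Lemma h_DZ c y : h_D L (c *: y) = c *: h_D L y.
Proof. by rewrite -[_ *: y]addr0 h_DP h_D0 addr0. Qed.

Lemma cartan_part_ind (P : loc_D L -> Prop) : P 1 ->
    (forall c x y, P x -> P y -> P (c *: x + y)) ->
    (forall x y, P x -> P y -> P (x * y)) -> (forall z, P (h_D L z)) ->
  forall u, cartan_part u -> P u.
Proof.
move=> P1 PD PM Ph _ [v ->].
apply: (env_ind (P := fun v => P (to_D L v))) => [|c x y|x y|z].
- by rewrite rmorph1.
- by rewrite linearP; exact: PD.
- by rewrite rmorphM; exact: PM.
- exact: Ph.
Qed.

Lemma cartan_part1 : cartan_part 1. Proof. by exists 1; rewrite rmorph1. Qed.

Lemma cartan_partM u v : cartan_part u -> cartan_part v -> cartan_part (u * v).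
Proof. by move=> [x ->] [y ->]; exists (x * y); rewrite rmorphM. Qed.

Lemma cartan_partP c u v : cartan_part u -> cartan_part v -> cartan_part (c *: u + v).
Proof. by move=> [x ->] [y ->]; exists (c *: x + y); rewrite linearP. Qed.

Lemma cartan_part_h z : cartan_part (h_D L z).
Proof. by exists (env_in (loc_Uh L) (z : abelian_lie (km_h G))). Qed.

Lemma denominator_ind (P : loc_D L -> Prop) : P 1 ->
    (forall x y, P x -> P y -> P (x * y)) ->
    (forall gam (k : int), is_root (G := G) gam ->
       P (h_D L (h_root gam) + k%:~R)) ->
  forall s, denominator s -> P s.
Proof.
move=> P1 PM Pg _ [v dv ->]; elim: dv => [|x y [gam [k [rg ->]]] _ Py].
  by rewrite rmorph1.
by rewrite rmorphM; apply: PM => //; rewrite rmorphD rmorph_int; exact: Pg.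
Qed.

Lemma denominator1 : denominator 1.
Proof. by exists 1; rewrite ?rmorph1 //; constructor. Qed.

Lemma denominatorM s t : denominator s -> denominator t -> denominator (s * t).
Proof.
move=> [v dv ->] [w dw ->]; exists (v * w); rewrite ?rmorphM //.
elim: dv => [|x y gx _ IH]; first by rewrite mul1r.
by rewrite -mulrA; constructor.
Qed.

Lemma denominator_root gam (k : int) : is_root (G := G) gam ->
  denominator (h_D L (h_root gam) + k%:~R).
Proof.
move=> rg; exists (env_in (loc_Uh L) (h_root gam : abelian_lie (km_h G)) + k%:~R).
  by rewrite -[_ + _]mulr1; constructor; [exists gam, k | constructor].
by rewrite rmorphD rmorph_int.
Qed.

Lemma denominator_unit s : denominator s -> s \is a GRing.unit.
Proof. by move=> [v dv ->]; have [Su _ _] := to_D_localization L; exact: Su. Qed.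

Lemma denominator_cartan s : denominator s -> cartan_part s.
Proof. by move=> [v _ ->]; exists v. Qed.

Lemma loc_D_frac d : exists u s, [/\ cartan_part u, denominator s & d * s = u].
Proof.
have [Su + _] := to_D_localization L => /(_ d) [u [s [Ss ->]]].
exists (to_D L u), (to_D L s); split; [by exists u|by exists s|].
by rewrite divrK // Su.
Qed.

Lemma loc_D_ext (X : algType K) (phi psi : {lrmorphism loc_D L -> X}) :
  (forall z, phi (h_D L z) = psi (h_D L z)) -> phi =1 psi.
Proof.
move=> eq_h d; have eqU u : cartan_part u -> phi u = psi u.
  elim/cartan_part_ind => [|c x y Ex Ey|x y Ex Ey|//]; first by rewrite !rmorph1.
    by rewrite !linearP /= Ex Ey.
  by rewrite !rmorphM /= Ex Ey.
have [u [s [Uu Ss E]]] := loc_D_frac d.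
have Us := denominator_unit Ss.
have Es : phi s = psi s by apply: eqU; exact: denominator_cartan.
have : phi d * phi s = psi d * phi s.
  by rewrite {2}Es -[LHS]rmorphM -[RHS]rmorphM /= E; exact: eqU.
move/(congr1 (fun x => x * phi s^-1)).
by rewrite -!mulrA -!rmorphM divrr // rmorph1 !mulr1.
Qed.

Section WeightShift.
Variable x : loc_A L.
Hypothesis wx : alg_int_weight (gL \o H) x.

Lemma root_weight gam : exists c : int, ad (gL (H (h_root gam))) x = c%:~R *: x.
Proof.
have [c ->] := int_coroot_h_root (G := G) gam; have [_ wk] := wx.
have [w Ew] := choice
  (P := fun k (m : int) => ad (gL (H (coroot k))) x = m%:~R *: x) wk.
exists (\sum_k c k * w k).
rewrite rmorph_sum scaler_suml /g_A' /g_in linear_sum.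
have -> (F : 'I_n -> G) : A_in L (iA (env_in U (\sum_k F k))) = \sum_k gL (F k).
  by rewrite !linear_sum.
have ad_suml (F : 'I_n -> loc_A L) : ad (\sum_k F k) x = \sum_k ad (F k) x.
  by rewrite /ad mulr_suml mulr_sumr sumrB.
rewrite ad_suml; apply: eq_bigr => k _.
by rewrite linearZ /= gLZ adZl Ew scalerA intrM.
Qed.

Lemma cartan_shift u : cartan_part u ->
  exists2 u', cartan_part u' & iD u * x = x * iD u'.
Proof.
have [wh _] := wx; elim/cartan_part_ind => [|c y z|y z|z].
- by exists 1; rewrite ?rmorph1 ?mulr1 ?mul1r //; exact: cartan_part1.
- move=> [y' Uy Ey] [z' Uz Ez]; exists (c *: y' + z'); first exact: cartan_partP.
  by rewrite !linearP /= mulrDl mulrDr -scalerAl -scalerAr Ey Ez.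
- move=> [y' Uy Ey] [z' Uz Ez]; exists (y' * z'); first exact: cartan_partM.
  by rewrite !rmorphM -mulrA Ez mulrA Ey mulrA.
- have [c Ec] := wh z; exists (c *: 1 + h_D L z).
    by apply: cartan_partP; [exact: cartan_part1 | exact: cartan_part_h].
  rewrite linearP /= rmorph1 !D_in_h mulrDr -scalerAr mulr1 -Ec /= /ad.
  by rewrite addrNK.
Qed.

Lemma cartan_shift' u : cartan_part u ->
  exists2 u', cartan_part u' & x * iD u = iD u' * x.
Proof.
have [wh _] := wx; elim/cartan_part_ind => [|c y z|y z|z].
- by exists 1; rewrite ?rmorph1 ?mulr1 ?mul1r //; exact: cartan_part1.
- move=> [y' Uy Ey] [z' Uz Ez]; exists (c *: y' + z'); first exact: cartan_partP.
  by rewrite !linearP /= mulrDl mulrDr -scalerAl -scalerAr Ey Ez.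
- move=> [y' Uy Ey] [z' Uz Ez]; exists (y' * z'); first exact: cartan_partM.
  by rewrite !rmorphM mulrA Ey -mulrA Ez mulrA.
- have [c Ec] := wh z; exists ((- c) *: 1 + h_D L z).
    by apply: cartan_partP; [exact: cartan_part1 | exact: cartan_part_h].
  rewrite linearP /= rmorph1 !D_in_h mulrDl -scalerAl mul1r scaleNr -Ec /= /ad.
  by rewrite opprB addrNK.
Qed.

Let iD_root gam (k : int) :
  iD (h_D L (h_root gam) + k%:~R) = gL (H (h_root gam)) + k%:~R.
Proof. by rewrite rmorphD rmorph_int /= D_in_h. Qed.

(** A factor h_gamma + k becomes h_gamma + k + c, which is a denominator because [root_weight] makes
    c an integer. *)
Lemma denominator_shift s : denominator s ->
  exists2 s', denominator s' & iD s * x = x * iD s'.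
Proof.
elim/denominator_ind => [|y z|gam k rg].
- by exists 1; rewrite ?rmorph1 ?mulr1 ?mul1r //; exact: denominator1.
- move=> [y' Sy Ey] [z' Sz Ez]; exists (y' * z'); first exact: denominatorM.
  by rewrite !rmorphM -mulrA Ez mulrA Ey mulrA.
- have [c Ec] := root_weight gam; exists (h_D L (h_root gam) + (k + c)%:~R).
    exact: denominator_root.
  rewrite !iD_root mulrDl mulrDr [gL _ * x]mul_ad Ec -addrA; congr (_ + _).
  by rewrite mulrzl mulrzr scaler_int mulrzDr addrC.
Qed.

Lemma denominator_shift' s : denominator s ->
  exists2 s', denominator s' & x * iD s = iD s' * x.
Proof.
elim/denominator_ind => [|y z|gam k rg].
- by exists 1; rewrite ?rmorph1 ?mulr1 ?mul1r //; exact: denominator1.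
- move=> [y' Sy Ey] [z' Sz Ez]; exists (y' * z'); first exact: denominatorM.
  by rewrite !rmorphM mulrA Ey -mulrA Ez mulrA.
- have [c Ec] := root_weight gam; exists (h_D L (h_root gam) + (k - c)%:~R).
    exact: denominator_root.
  rewrite !iD_root mulrDr mulrDl [gL _ * x]mul_ad Ec -addrA; congr (_ + _).
  by rewrite mulrzl mulrzr scaler_int mulrzBr addrC addrNK.
Qed.

Lemma D_shift d : exists d', iD d * x = x * iD d'.
Proof.
have [u [s [Uu Ss E]]] := loc_D_frac d; have Us := denominator_unit Ss.
have [u' _ Eu] := cartan_shift Uu; have [s' Ss' Es] := denominator_shift Ss.
have Us' := denominator_unit Ss'.
have Esi : iD s^-1 * x = x * iD s'^-1.
  rewrite -[LHS]mulr1 -(rmorph1 iD) -(divrr Us') rmorphM mulrA -[_ * x * _]mulrA.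
  by rewrite -Es mulrA -rmorphM mulVr // rmorph1 mul1r.
exists (u' * s'^-1); have -> : d = u * s^-1 by rewrite -E mulrK.
by rewrite !rmorphM -mulrA Esi mulrA Eu mulrA.
Qed.

Lemma D_shift' d : exists d', x * iD d = iD d' * x.
Proof.
have [u [s [Uu Ss E]]] := loc_D_frac d; have Us := denominator_unit Ss.
have [u' _ Eu] := cartan_shift' Uu; have [s' Ss' Es] := denominator_shift' Ss.
have Us' := denominator_unit Ss'.
have Esi : x * iD s^-1 = iD s'^-1 * x.
  rewrite -[LHS]mul1r -(rmorph1 iD) -(mulVr Us') rmorphM -mulrA [iD s' * _]mulrA.
  by rewrite -Es -mulrA -rmorphM divrr // rmorph1 mulr1.
exists (u' * s'^-1); have -> : d = u * s^-1 by rewrite -E mulrK.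
by rewrite !rmorphM mulrA Eu -mulrA Esi mulrA.
Qed.

End WeightShift.

End Localized.

(** * Denominators on the right, and the rank one data inside A' *)

Section LocalizedAdmissible.
Variables (K : numFieldType) (G : contragredientLie K).
Variables (U : envelopingAlgebra G) (A : algType K) (iA : {lrmorphism U -> A}).
Variable L : localizedAlgebra iA.
Local Notation n := (km_rank G).
Local Notation H := (h_in G).
Local Notation iD := (D_in L).
Local Notation gL := (g_A' L).

Definition base_part (b : loc_A L) : Prop := exists a, b = A_in L a.

Lemma base_cartan u : cartan_part u -> base_part (iD u).
Proof. by move=> [v ->]; exists (iA (Uh_in L v)); exact: D_A_compat. Qed.

Lemma base_partM x y : base_part x -> base_part y -> base_part (x * y).
Proof. by move=> [a ->] [b ->]; exists (a * b); rewrite rmorphM. Qed.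

Lemma base_partB x y : base_part x -> base_part y -> base_part (x - y).
Proof. by move=> [a ->] [b ->]; exists (a - b); rewrite rmorphB. Qed.

Lemma base_gL x : base_part (gL x).
Proof. by exists (g_in iA x). Qed.

Hypothesis admA : admissible iA.

Lemma A_in_weight a : alg_int_weight (g_in iA \o H) a ->
  alg_int_weight (gL \o H) (A_in L a).
Proof.
move=> [ah ak]; split=> [z|k].
  have [c Ec] := ah z; exists c; rewrite -linearZ /= -Ec rmorph_ad //.
have [c Ec] := ak k; exists c; rewrite -linearZ /= -Ec rmorph_ad //.
Qed.

Lemma gL_int_weight x : int_weight x -> alg_int_weight (gL \o H) (gL x).
Proof. by move/(@g_in_int_weight _ _ _ _ iA)/A_in_weight. Qed.

(** In a product d a with a a weight vector, the denominator of d can be moved to the right of a;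
    sums are handled by common denominators. *)
Lemma base_frac (a : loc_A L) : exists2 s, denominator s & base_part (a * iD s).
Proof.
have comm_frac x y s t : denominator s -> denominator t ->
    base_part (x * iD s) -> base_part (y * iD t) ->
    base_part (x * iD (s * t)) /\ base_part (y * iD (s * t)).
  move=> Ss St Bx By; split; rewrite ?rmorphM ?mulrA.
    exact/base_partM/base_cartan/denominator_cartan.
  rewrite -mulrA -rmorphM mulrC rmorphM mulrA.
  exact/base_partM/base_cartan/denominator_cartan.
pose P a := exists2 s, denominator s & base_part (a * iD s).
apply: (@tensor_ind _ _ _ _ _ _ _ (loc_tensor L) P) => [|x y [s Ss Bx] [t St By]|d {}a].
- exists 1; first exact: denominator1.
  by rewrite mul0r; exists 0; rewrite rmorph0.
- exists (s * t); first exact: denominatorM.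
  have [Bx' By'] := comm_frac _ _ _ _ Ss St Bx By.
  by rewrite mulrBl; exact: base_partB.
have [u [s0 [Uu Ss0 Ed]]] := loc_D_frac d; have Us0 := denominator_unit Ss0.
elim/addspan_ind_additive: (admissible_weight_span admA a)
    => [|x y [s Ss Bx] [t St By]|{}a /A_in_weight wa].
- exists 1; first exact: denominator1.
  by rewrite rmorph0 mulr0 mul0r; exists 0; rewrite rmorph0.
- exists (s * t); first exact: denominatorM.
  have [Bx' By'] := comm_frac _ _ _ _ Ss St Bx By.
  rewrite rmorphD mulrDr mulrDl -[X in _ + X]opprK; apply: base_partB => //.
  have [b ->] := By'; by exists (- b); rewrite rmorphN.
have [s Ss Es] := denominator_shift wa Ss0; exists s => //.
rewrite -mulrA -Es mulrA -rmorphM Ed; apply: base_partM; first exact: base_cartan.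
by exists a.
Qed.

Variable i : 'I_n.
Local Notation e := (gL (e_pos i)).
Local Notation f := (gL (e_neg i)).
Local Notation Hi := (h_D L (coroot i)).
Variable tau : {lrmorphism loc_D L -> loc_D L}.
Hypothesis tau_shift : is_shift i tau.

Lemma e_pos_neq0 : e_pos i <> 0 :> G.
Proof.
move=> e0; have := e_pos_neg (c := G) i i; rewrite eqxx e0 lie0l.
rewrite -[0](linear0 H) => /h_in_inj c0.
have : coroot i != 0 :> km_h G.
  by apply: free_not0 (coroot_free G) _; apply: map_f; rewrite mem_enum.
by rewrite -c0 eqxx.
Qed.

Lemma is_root_simple : is_root (G := G) (delta_mx 0 i).
Proof.
split; last by exists (e_pos i); [exact: e_pos_neq0 | exact: root_space_pos].
by move/matrixP/(_ 0 i)/eqP; rewrite !mxE !eqxx.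
Qed.

Lemma h_root_simple : h_root (delta_mx 0 i) = coroot i :> km_h G.
Proof.
rewrite /h_root; case: asboolP => [_|[]]; last exact: real_simple.
have di : (symm i)%:R != 0 :> K by rewrite pnatr_eq0 -lt0n symm_gt0.
rewrite lattice_formE t_root_delta (bigD1 i) //= mxE !eqxx big1 ?addr0; last first.
  by move=> j /negPf ji; rewrite mxE ji andbF mul0r.
rewrite mul1r [sroot i _]linearZ /= sroot_coroot cartan_diag scalerA.
rewrite -[_ *: _%:~R]/((symm i)%:R * 2%:R) invfM mulrCA mulfV ?pnatr_eq0 // mulr1.
by rewrite mulVf // scale1r.
Qed.

Lemma Hi_unit (k : int) : Hi + k%:~R \is a GRing.unit.
Proof.
by rewrite -h_root_simple; apply/denominator_unit/denominator_root/is_root_simple.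
Qed.

Lemma ef_L : e * f = f * e + iD Hi.
Proof. by rewrite D_in_h [e * f]mul_ad -gL_lie EF_neg eqxx. Qed.

Lemma tau_Hi : tau Hi = Hi + 2%:R.
Proof. by rewrite tau_shift sroot_coroot cartan_diag scaler_nat. Qed.

Lemma fd_L d : f * iD d = iD (tau d) * f.
Proof.
have fU u : cartan_part u -> f * iD u = iD (tau u) * f.
  elim/cartan_part_ind => [|c x y Ex Ey|x y Ex Ey|z].
  - by rewrite !rmorph1 mulr1 mul1r.
  - by rewrite !linearP /= mulrDr mulrDl -scalerAl -scalerAr Ex Ey.
  - by rewrite !rmorphM mulrA Ex -mulrA Ey mulrA.
  - rewrite tau_shift rmorphD /= D_in_h mulrDl [gL (H z) * f]mul_ad -gL_lie h_e_neg.
    by rewrite gLZ rmorph_alg mulr_algl scaleNr addrNK.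
have [u [s [Uu Ss E]]] := loc_D_frac d; have Us := denominator_unit Ss.
have Us' : iD s * iD s^-1 = 1 by rewrite -rmorphM divrr // rmorph1.
rewrite -[LHS]mulr1 -[RHS]mulr1 -Us' !mulrA; congr (_ * _).
rewrite -!mulrA -rmorphM E (fU u Uu) -E rmorphM rmorphM -mulrA.
by rewrite (fU s (denominator_cartan Ss)).
Qed.

Lemma de_L d : iD d * e = e * iD (tau d).
Proof.
have eU u : cartan_part u -> iD u * e = e * iD (tau u).
  elim/cartan_part_ind => [|c x y Ex Ey|x y Ex Ey|z].
  - by rewrite !rmorph1 mulr1 mul1r.
  - by rewrite !linearP /= mulrDr mulrDl -scalerAl -scalerAr Ex Ey.
  - by rewrite !rmorphM -mulrA Ey mulrA Ex mulrA.
  - rewrite tau_shift rmorphD /= D_in_h mulrDr [gL (H z) * e]mul_ad -gL_lie h_e_pos.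
    by rewrite gLZ rmorph_alg mulr_algr.
have [u [s [Uu Ss E]]] := loc_D_frac d; have Us := denominator_unit Ss.
have Us' : iD s^-1 * iD s = 1 by rewrite -rmorphM mulVr // rmorph1.
rewrite -[LHS]mul1r -[RHS]mul1r -Us' -!mulrA; congr (_ * _).
rewrite mulrA -rmorphM [s * d]mulrC E (eU u Uu) -E [d * s]mulrC rmorphM rmorphM.
by rewrite !mulrA (eU s (denominator_cartan Ss)).
Qed.

Definition par_L (z : loc_A L) : Prop := exists2 x, par_nil i x & z = gL x.

Lemma par_L_base z : par_L z -> base_part z.
Proof. by move=> [x _ ->]; exact: base_gL. Qed.

Lemma par_L_e z : par_L z -> par_L (ad e z).
Proof.
by move=> [x px ->]; exists [lie e_pos i, x]; rewrite ?gL_lie //; exact: par_nil_e.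
Qed.

Lemma par_L_f z : par_L z -> par_L (ad f z).
Proof.
by move=> [x px ->]; exists [lie e_neg i, x]; rewrite ?gL_lie //; exact: par_nil_f.
Qed.

Lemma par_L_D z d : par_L z -> nil_ideal par_L (z * iD d).
Proof.
move=> [x px ->]; elim/addspan_ind_additive: (par_nil_weight px)
    => [|y w IHy IHw|y [py /gL_int_weight wy]].
- by rewrite gL0 mul0r; constructor.
- by rewrite gLD mulrDl; exact: addspanD.
- have [d' ->] := D_shift' wy d; apply: addspan_gen.
  by exists (iD d'), (gL y); split => //; exists y.
Qed.

Lemma D_par_L d z : par_L z ->
  addspan (fun x => exists z' d', par_L z' /\ x = z' * iD d') (iD d * z).
Proof.
move=> [x px ->]; elim/addspan_ind_additive: (par_nil_weight px)
    => [|y w IHy IHw|y [py /gL_int_weight wy]].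
- by rewrite gL0 mulr0; constructor.
- by rewrite gLD mulrDr; exact: addspanD.
- have [d' ->] := D_shift wy d; apply: addspan_gen.
  by exists (gL y), d'; split => //; exists y.
Qed.

Lemma base_adexp_e x : base_part x -> exists p, adexp e p x.
Proof.
move=> [a ->]; have [N aN] := ad_nilpotent_pos admA i a.
apply: (@adexp_exists _ _ _ N).
by rewrite -(rmorph_iter_ad (A_in L)) aN rmorph0.
Qed.

Lemma base_adexp_f x : base_part x -> exists p, adexp f p x.
Proof.
move=> [a ->]; have [N aN] := ad_nilpotent_neg admA i a.
apply: (@adexp_exists _ _ _ N).
by rewrite -(rmorph_iter_ad (A_in L)) aN rmorph0.
Qed.

Local Notation pi := (cls (n_A' L)).

Lemma n_A'_ker x : pi x = 0 <-> exists a, nil_ideal par_L (x - a * e).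
Proof.
rewrite cls_eq0 left_ideal_addspan; split.
  elim/addspan_ind_additive => [|u v [a ua] [b vb]|_ [b [_ [[y ny ->] ->]]]].
  - by exists 0; rewrite mul0r subrr; constructor.
  - by exists (a + b); rewrite mulrDl opprD addrACA; exact: addspanD.
  have [a [w [pw ->]]] := nil_pos_par i ny; exists (b * a%:A).
  rewrite gLP mulrDr -mulrA mulr_algl addrAC subrr add0r.
  by apply: addspan_gen; exists b, (gL w); split => //; exists w.
move=> [a xa]; rewrite -[x](addrNK (a * e)); apply: addspanD; last first.
  by apply: addspan_gen; exists a, e; split=> //; exists (e_pos i) => //; exact: half_gen.
elim/addspan_ind_additive: xa => [|u v|_ [b [z [[y py ->] ->]]]].
- exact: addspan0.
- exact: addspanD.
- apply: addspan_gen; exists b, (gL y); split => //; exists y => //.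
  exact: par_nil_pos py.
Qed.

Hypothesis tau_surj : forall d, exists d', tau d' = d.

(** Both properties are linear and multiplicative in u, which reduces to u in h, where the series is
    z + alpha_i(z) e t. *)
Lemma cartan_adexp u : cartan_part u -> exists2 pu, adexp e pu (iD u) &
  forall k p, pi (lower_ser f (sl2_inv iD Hi) k (p * pu)) =
              pi (lower_ser f (sl2_inv iD Hi) k p * iD (tau u)).
Proof.
have piM' := piM n_A'_ker.
have pieg' := pieg Hi de_L tau_surj par_L_D n_A'_ker.
have piD' := piD de_L tau_surj par_L_D n_A'_ker.
elim/cartan_part_ind => [|c x y [px ex Ex] [py ey Ey]|x y [px ex Ex] [py ey Ey]|z].
- exists 1 => [|k p]; last by rewrite !rmorph1 !mulr1.
  rewrite rmorph1 => -[|m]; rewrite coefC ?adexp_coef0 //.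
  by rewrite /adexp_coef iterSr /ad mulr1 mul1r subrr iter_ad0 scaler0.
- exists ((c%:A)%:P * px + py) => [|k p].
    rewrite linearP; apply: adexpD ey => m.
    by rewrite coefCM mulr_algl ex /adexp_coef iter_adZ !scalerA mulrC.
  have -> : p * ((c%:A)%:P * px + py) = (c%:A)%:P * (p * px) + p * py.
    rewrite mulrDr; congr (_ + _); rewrite !mulrA; congr (_ * _).
    by apply/polyP => m; rewrite coefMC coefCM mulr_algl mulr_algr.
  rewrite vserD vserCM !linearP /= mulrDr !raddfD /= Ey; congr (_ + _).
  by rewrite -scalerAr -[c *: (_ * _)]mulr_algl; exact: (piMl n_A'_ker _ (Ex k p)).
- exists (px * py) => [|k p]; first by rewrite rmorphM; exact: adexpM.
  by rewrite mulrA Ey !rmorphM mulrA; exact: (piD' _ _ _ (Ex k p)).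
- exists ((gL (H z))%:P + ((sroot i z : K) *: e)%:P * 'X) => [|k p].
    rewrite D_in_h; apply: adexp_cartan.
    rewrite [gL _ * e]mul_ad -gL_lie h_e_pos gLZ addrK //.
  rewrite tau_shift rmorphD /= D_in_h rmorph_alg.
  apply: (pi_vser_cartan ef_L (hf_comm fd_L tau_Hi) (sl2_invS iD Hi_unit) piM' pieg').
    by rewrite [gL _ * f]mul_ad -gL_lie h_e_neg gLZ mulrBr mulr_algr scaleNr.
  by move=> j; rewrite -D_in_h -!rmorphM mulrC.
Qed.

End LocalizedAdmissible.

(** * Lifts of simple reflections *)

Section ReflectionLift.
Variables (K : numFieldType) (G : contragredientLie K).
Variables (U : envelopingAlgebra G) (A : algType K) (iA : {lrmorphism U -> A}).
Variable L : localizedAlgebra iA.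
Local Notation n := (km_rank G).
Local Notation H := (h_in G).
Local Notation iD := (D_in L).
Local Notation gL := (g_A' L).
Local Notation env := (env_in U).
Variable i : 'I_n.
Variables (T : {lrmorphism U -> U}) (TA : {lrmorphism A -> A}).
Variables (T' : {lrmorphism loc_A L -> loc_A L}).
Variables (tau sdot : {lrmorphism loc_D L -> loc_D L}).
Hypothesis T_lie : forall x, exists y, T (env x) = env y.
Hypothesis T_h : forall z, T (env (H z)) = env (H (simple_reflection i z)).
Hypothesis TA_bij : bijective TA.
Hypothesis TA_T : forall u, TA (iA u) = iA (T u).
Hypothesis T'_TA : forall a, T' (A_in L a) = A_in L (TA a).
Hypothesis tau_shift : is_shift i tau.
Hypothesis sdot_refl : is_shifted_reflection i sdot.

Local Notation s := (simple_reflection i).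

Lemma sroot_reflection z : sroot i (s z) = - sroot i z :> K.
Proof.
rewrite /simple_reflection linearB linearZ /= sroot_coroot cartan_diag.
by rewrite /GRing.scale /= -[2%:~R]/(1 + 1 : K) mulrDr mulr1 opprD addrA subrr add0r.
Qed.

Lemma reflectionK z : s (s z) = z.
Proof.
by rewrite {1}/simple_reflection sroot_reflection scaleNr opprK /simple_reflection addrNK.
Qed.

Lemma reflection_coroot : s (coroot i) = - coroot i.
Proof.
rewrite /simple_reflection sroot_coroot cartan_diag -[2%:~R]/(2%:R : K).
by rewrite scaler_nat mulr2n opprD addNKr.
Qed.

Lemma env_lie x y : env [lie x, y] = ad (env x) (env y).
Proof. exact: env_in_lie. Qed.

Lemma T_ad_h z u : ad (env (H z)) (T u) = T (ad (env (H (s z))) u).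
Proof. by rewrite rmorph_ad T_h reflectionK. Qed.

Lemma eigspan_env z (P : K -> Prop) x : eigspan (lie_bracket (H z)) P x ->
  eigspan (ad (env (H z))) P (env x).
Proof.
elim/addspan_ind_additive => [|u v|v [l Pl vl]].
- by rewrite linear0; constructor.
- by rewrite linearD; exact: addspanD.
- by apply: addspan_gen; exists l; rewrite // -env_lie vl linearZ.
Qed.

(** The eigenvalue equation for w lives in U, so the components r and y are separated there, inside
    the image of P. *)
Lemma T_component z mu (P : G -> Prop) w r y :
    is_subspace P -> (forall x, P x -> P [lie H z, x]) ->
    ad (env (H z)) w = mu *: w -> w = env (r + y) ->
    eigspan (lie_bracket (H z)) (fun l => l <> mu) r -> P y ->
  exists2 x, P x & w = env x.
Proof.
move=> [P0 PD] Ph wmu wE rE Py.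
pose Pe u := exists2 x, P x & u = env x.
have := @eigen_separation K U (ad (env (H z))) Pe mu w (env r) (env y).
move=> E; apply: E => //.
- move=> c _ _ [x Px ->] [x' Px' ->]; exists (c *: x + x'); first exact: PD.
  by rewrite linearP.
- move=> _ [x Px ->]; exists [lie H z, x]; first exact: Ph.
  by rewrite /= env_lie.
- by rewrite wE linearD.
- exact: eigspan_env.
- by exists y.
Qed.

Lemma line_subspace x : is_subspace (fun y : G => exists a : K, y = a *: x).
Proof.
split; first by exists 0; rewrite scale0r.
by move=> c _ _ [a ->] [b ->]; exists (c * a + b); rewrite scalerDl scalerA.
Qed.

(** T_i(e_i) comes from g and has weight s_i(alpha_i) = - alpha_i; a single z detects this, having
    eigenvalue -1 only on the line of f_i. *)
Lemma T_e : exists c : K, T (env (e_pos i)) = c *: env (e_neg i).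
Proof.
have [z az] := @sroot_values _ G (fun j => (j != i).+1%:R).
have [y Ty] := T_lie (e_pos i); have [a [r [yE rE]]] := neg_eigen y az.
have zi : sroot i z = 1 :> K by rewrite az eqxx.
have [||||_ [c ->] ->] := @T_component z (-1) _ (T (env (e_pos i))) r (a *: e_neg i)
  (line_subspace (e_neg i)) _ _ _ rE.
- move=> _ [b ->]; rewrite lieZr h_e_neg zi; exists (b * -1).
  by rewrite scalerA.
- by rewrite T_ad_h -env_lie h_e_pos sroot_reflection zi !linearZ.
- by rewrite Ty yE.
- by exists a.
- by exists c; rewrite linearZ.
Qed.

Lemma T_f : exists c : K, T (env (e_neg i)) = c *: env (e_pos i).
Proof.
have [z az] := @sroot_values _ G (fun j => (j != i).+1%:R).
have [y Ty] := T_lie (e_neg i); have [a [r [yE rE]]] := pos_eigen y az.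
have zi : sroot i z = 1 :> K by rewrite az eqxx.
have [||||_ [c ->] ->] := @T_component z 1 _ (T (env (e_neg i))) r (a *: e_pos i)
  (line_subspace (e_pos i)) _ _ _ rE.
- move=> _ [b ->]; rewrite lieZr h_e_pos zi; exists (b * 1).
  by rewrite scalerA.
- by rewrite T_ad_h -env_lie h_e_neg sroot_reflection zi opprK !linearZ.
- by rewrite Ty yE.
- by exists a.
- by exists c; rewrite linearZ.
Qed.

(** The chosen z is fixed by s_i, so T_i(e_j) keeps the eigenvalue 1, which only m can carry. *)
Lemma T_e_par j : j != i -> exists2 y, par_nil i y & T (env (e_pos j)) = env y.
Proof.
move=> ji; have [z az] := @sroot_values _ G (fun j => (j != i)%:R).
have [y Ty] := T_lie (e_pos j); have [r [w [yE pw rE]]] := par_eigen y az.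
apply: (@T_component z 1 (par_nil i) _ r w (par_nil_sub i).1 _ _ _ rE pw).
- by move=> x; exact: par_nil_h.
- rewrite T_ad_h -env_lie h_e_pos !linearZ /= /simple_reflection az eqxx scale0r subr0.
  by rewrite az ji.
- by rewrite Ty yE.
Qed.

Lemma TT_e j : exists c : K, T (T (env (e_pos j))) = c *: env (e_pos j).
Proof.
have [z az] := @sroot_values _ G (fun k => (k != j).+1%:R).
have [y Ty] : exists y, T (T (env (e_pos j))) = env y.
  by have [y ->] := T_lie (e_pos j); exact: T_lie.
have [a [r [yE rE]]] := pos_eigen y az.
have zj : sroot j z = 1 :> K by rewrite az eqxx.
have [||||_ [c ->] ->] := @T_component z 1 _ (T (T (env (e_pos j)))) r (a *: e_pos j)
  (line_subspace (e_pos j)) _ _ _ rE.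
- move=> _ [b ->]; rewrite lieZr h_e_pos zj; exists (b * 1).
  by rewrite scalerA.
- by rewrite !T_ad_h reflectionK -env_lie h_e_pos zj !linearZ.
- by rewrite Ty yE.
- by exists a.
- by exists c; rewrite linearZ.
Qed.

Lemma T'_gL x y : T (env x) = env y -> T' (gL x) = gL y.
Proof. by move=> Txy; rewrite /g_A' /g_in T'_TA TA_T Txy. Qed.

Lemma T'_h z : T' (gL (H z)) = gL (H (s z)).
Proof. exact/T'_gL/T_h. Qed.

Local Notation e := (gL (e_pos i)).
Local Notation f := (gL (e_neg i)).
Local Notation Hi := (h_D L (coroot i)).

Lemma T'_scaling x y c : T (env x) = c *: env y -> T' (gL x) = c *: gL y.
Proof. by rewrite -linearZ => /T'_gL ->; rewrite gLZ. Qed.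

Lemma gL_Hi_neq0 : gL (H (coroot i)) != 0.
Proof.
rewrite -D_in_h; apply/eqP => h0; have := Hi_unit L i 0; rewrite addr0 => Hu.
have := congr1 (fun x => x * iD Hi^-1) h0.
by rewrite -rmorphM divrr // rmorph1 mul0r => /eqP; rewrite oner_eq0.
Qed.

(** Applying T_i to [e, f] = h gives c d [f, e] = - h, and h is nonzero because it is invertible in
    A'; hence c d = 1. *)
Lemma T'_ef : exists2 c : K, c != 0 & T' e = c *: f /\ T' f = c^-1 *: e.
Proof.
have [c /T'_scaling Te] := T_e; have [d /T'_scaling Tf] := T_f.
have cd : c * d = 1.
  have hE : ad e f = gL (H (coroot i)) by rewrite -gL_lie EF_neg eqxx.
  have := congr1 T' hE; rewrite rmorph_ad Te Tf T'_h adZ adZl scalerA.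
  rewrite -gL_lie EF_pos eqxx reflection_coroot => /eqP.
  rewrite -[X in _ == X]scale1r -subr_eq0 -scalerBl scaler_eq0.
  rewrite linearN gLN oppr_eq0 (negPf gL_Hi_neq0) orbF subr_eq0 mulrC.
  by move/eqP.
have c0 : c != 0 by apply: contraTneq (oner_neq0 K) => c0; rewrite -cd c0 mul0r eqxx.
exists c => //; split => //; rewrite Tf; congr (_ *: _).
by rewrite -[d]mul1r -(mulVf c0) -mulrA cd mulr1.
Qed.

Lemma T'T'_e : T' (T' e) = e.
Proof.
have [c c0 [Te Tf]] := T'_ef; rewrite Te linearZ /= Tf scalerA mulfV //.
by rewrite scale1r.
Qed.

Lemma T'_par x : par_nil i x -> exists2 y, par_nil i y & T' (gL x) = gL y.
Proof.
have sub := par_nil_sub i; have [c _ [Te _]] := T'_ef.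
elim/lie_generated_ind => [|a u v [u' pu Eu] [v' pv Ev]|u v _ _ [u' pu Eu] [v' pv Ev]
  |_ [j [k [ji ->]]]].
- by exists 0; rewrite ?gL0 ?linear0 //; exact: sub.1.1.
- exists (a *: u' + v'); first exact: sub.1.2.
  by rewrite !gLP linearP /= Eu Ev.
- exists [lie u', v']; first exact: sub.2.
  by rewrite !gL_lie rmorph_ad Eu Ev.
elim: k => [|k [y py Ey]] /=.
  by have [y py Ty] := T_e_par ji; exists y => //; exact: T'_gL.
exists (c *: [lie e_neg i, y]).
  by apply: (subspaceZ _ sub.1); exact: par_nil_f.
by rewrite gL_lie rmorph_ad Te Ey adZl gLZ gL_lie.
Qed.

Lemma sigma_h z : sdot (tau (h_D L z)) = h_D L (s z).
Proof. by rewrite tau_shift rmorphD /= sdot_refl rmorph_alg subrK. Qed.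

Lemma T'_D d : T' (iD d) = iD (sdot (tau d)).
Proof.
apply: (loc_D_ext (phi := T' \o iD) (psi := iD \o (sdot \o tau))) => z /=.
by rewrite sigma_h !D_in_h T'_h.
Qed.

(** Explains the shifted action in (i): T_i acts on D by [sdot \o tau], the linear reflection, and q
    adds one more tau. *)
Lemma tau_sigma d : tau (sdot (tau d)) = sdot d.
Proof.
apply: (loc_D_ext (phi := tau \o (sdot \o tau)) (psi := sdot)) => z /=.
by rewrite sigma_h tau_shift sdot_refl sroot_reflection scaleNr.
Qed.

Lemma sdotK d : sdot (sdot d) = d.
Proof.
apply: (loc_D_ext (phi := sdot \o sdot) (psi := idfun)) => z /=.
rewrite sdot_refl rmorphB /= sdot_refl rmorph_alg sroot_reflection reflectionK.
by rewrite scaleNr opprK addrK.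
Qed.

Lemma sigmaK d : sdot (tau (sdot (tau d))) = d.
Proof. by rewrite tau_sigma sdotK. Qed.

Lemma tau_surjective d : exists d', tau d' = d.
Proof. by exists (sdot (tau (sdot d))); rewrite tau_sigma sdotK. Qed.

Lemma cartan_part_tau u : cartan_part u -> cartan_part (tau u).
Proof.
elim/cartan_part_ind => [|c x y|x y|z].
- by rewrite rmorph1; exact: cartan_part1.
- by rewrite linearP; exact: cartan_partP.
- by rewrite rmorphM; exact: cartan_partM.
rewrite tau_shift addrC; apply: cartan_partP; last exact: cartan_part_h.
exact: cartan_part1.
Qed.

Lemma TATA_cartan u : TA (TA (iA (Uh_in L u))) = iA (Uh_in L u).
Proof.
apply: (env_ind (P := fun u => TA (TA (iA (Uh_in L u))) = iA (Uh_in L u)))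
    => [|c x y Ex Ey|x y Ex Ey|z].
- by rewrite !rmorph1.
- by rewrite !linearP /= Ex Ey.
- by rewrite !rmorphM /= Ex Ey.
- by rewrite Uh_inE !TA_T !T_h reflectionK.
Qed.

(** The inverse is assembled on the tensor product from the reflection on D and the inverse of TA on
    A. It is balanced over U(h) because TA squared fixes the image of U(h). *)
Lemma T'_bijective : exists Ti, cancel T' Ti /\ cancel Ti T'.
Proof.
have [TAi TAK TAiK] := TA_bij.
have TAiD x y : TAi (x + y) = TAi x + TAi y.
  by apply: (can_inj TAK); rewrite rmorphD /= !TAiK.
have TAiM x y : TAi (x * y) = TAi x * TAi y.
  by apply: (can_inj TAK); rewrite rmorphM /= !TAiK.
pose F d a := iD (sdot (tau d)) * A_in L (TAi a).
have [bal univ] := loc_tensor L.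
have F_bal : balanced (fun (d : loc_D L) (u : loc_Uh L) => d * to_D L u)
    (fun (u : loc_Uh L) (a : A) => iA (Uh_in L u) * a) F.
  split=> [d a b|d d' a|d u a]; rewrite /F.
  - by rewrite TAiD rmorphD mulrDr.
  - by rewrite !rmorphD mulrDl.
  rewrite !rmorphM /= TAiM rmorphM mulrA; congr (_ * _ * _).
  rewrite -T'_D D_A_compat T'_TA; congr (A_in L _).
  by apply: (can_inj TAK); rewrite TAiK TATA_cartan.
have [Ti [TiE _]] := univ _ F F_bal; exists Ti; split=> a.
- apply: (@tensor_ind _ _ _ _ _ _ _ (loc_tensor L) (fun a => Ti (T' a) = a))
    => [|x y Ex Ey|d {}a].
  + by rewrite !raddf0.
  + by rewrite !raddfB /= Ex Ey.
  + by rewrite rmorphM /= T'_D T'_TA TiE /F sigmaK TAK.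
- apply: (@tensor_ind _ _ _ _ _ _ _ (loc_tensor L) (fun a => T' (Ti a) = a))
    => [|x y Ex Ey|d {}a].
  + by rewrite !raddf0.
  + by rewrite !raddfB /= Ex Ey.
  + by rewrite TiE /F rmorphM /= T'_D T'_TA sigmaK TAiK.
Qed.

Variable Ti : loc_A L -> loc_A L.
Hypothesis T'K : cancel T' Ti.
Hypothesis TiK : cancel Ti T'.

Lemma T'T'_e_scale j : exists2 c : K, c != 0 & T' (T' (gL (e_pos j))) = c *: gL (e_pos j).
Proof.
have [c Ec] := TT_e j.
have E : T' (T' (gL (e_pos j))) = c *: gL (e_pos j).
  by have [y Ey] := T_lie (e_pos j); rewrite (T'_gL Ey);
    apply: T'_scaling; rewrite -Ey.
have [c0|c0] := eqVneq c 0; last by exists c.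
(* If c = 0, injectivity of T_i makes the image of e_j in A' zero, and any nonzero scalar serves. *)
exists 1; first exact: oner_neq0.
have : T' (T' (gL (e_pos j))) = T' (T' 0) by rewrite E c0 scale0r !rmorph0.
by move/(can_inj T'K)/(can_inj T'K) => ->; rewrite !rmorph0 scaler0.
Qed.

(** T_i^2 fixes e_i and rescales each e_j, hence maps m onto itself; [par_T'] deduces the same for
    T_i. *)
Lemma T'T'_par x : par_nil i x -> exists2 y, par_nil i y & gL x = T' (T' (gL y)).
Proof.
have sub := par_nil_sub i.
elim/lie_generated_ind => [|a u v [u' pu Eu] [v' pv Ev]|u v _ _ [u' pu Eu] [v' pv Ev]
  |_ [j [k [ji ->]]]].
- by exists 0; rewrite ?gL0 ?linear0 //; exact: sub.1.1.
- exists (a *: u' + v'); first exact: sub.1.2.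
  by rewrite !gLP Eu Ev -!linearP.
- exists [lie u', v']; first exact: sub.2.
  by rewrite !gL_lie !rmorph_ad Eu Ev.
elim: k => [|k [y py Ey]] /=.
  have [c c0 E] := T'T'_e_scale j; exists (c^-1 *: e_pos j).
    by apply: (subspaceZ _ sub.1); exact: (par_nil_gen 0).
  by rewrite gLZ !linearZ /= E scalerA mulVf // scale1r.
exists [lie e_pos i, y]; first exact: par_nil_e.
by rewrite !gL_lie Ey !rmorph_ad T'T'_e.
Qed.

Lemma par_T' x : par_nil i x -> exists2 y, par_nil i y & gL x = T' (gL y).
Proof.
move=> /T'T'_par [y /T'_par [z pz Ez] ->].
by exists z => //; rewrite Ez.
Qed.

Local Notation par := (par_L (L := L) i).
Local Notation ns := (ns_A' (L := L) T').

Lemma ns_A'_ker x : cls ns x = 0 <-> exists a, nil_ideal par (x - a * f).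
Proof.
have [c c0 [Te _]] := T'_ef.
rewrite cls_eq0 left_ideal_addspan; split.
  elim/addspan_ind_additive => [|u v [a ua] [b vb]|_ [b [_ [[_ [y ny ->] ->] ->]]]].
  - by exists 0; rewrite mul0r subrr; constructor.
  - by exists (a + b); rewrite mulrDl opprD addrACA; exact: addspanD.
  have [a [w [pw ->]]] := nil_pos_par i ny; have [w' pw' Ew] := T'_par pw.
  exists (b * (a * c)%:A); rewrite gLP linearP /= Te Ew scalerA mulrDr.
  rewrite -mulrA mulr_algl addrAC subrr add0r.
  by apply: addspan_gen; exists b, (gL w'); split => //; exists w'.
move=> [a xa]; rewrite -[x](addrNK (a * f)); apply: addspanD; last first.
  apply: addspan_gen; exists (a * c^-1%:A), (T' e); split.
    by exists e => //; exists (e_pos i) => //; exact: half_gen.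
  by rewrite Te -mulrA mulr_algl scalerA mulVf // scale1r.
elim/addspan_ind_additive: xa => [|u v|_ [b [z [[y py ->] ->]]]].
- exact: addspan0.
- exact: addspanD.
have [w pw ->] := par_T' py; apply: addspan_gen; exists b, (T' (gL w)); split => //.
by exists (gL w) => //; exists w => //; exact: par_nil_pos pw.
Qed.

Lemma n_T'T' y : nil_pos y -> exists2 w, nil_pos w & gL y = T' (T' (gL w)).
Proof.
move=> /(nil_pos_par i) [a [w [pw ->]]]; have [w' pw' Ew] := T'T'_par pw.
exists (a *: e_pos i + w'); last by rewrite !gLP !linearP /= T'T'_e Ew.
apply: (half_sub (@e_pos K G)).1.2; first exact: half_gen.
exact: par_nil_pos pw'.
Qed.

Lemma T'T'_n y : nil_pos y -> exists2 w, nil_pos w & T' (T' (gL y)) = gL w.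
Proof.
move=> /(nil_pos_par i) [a [w [pw ->]]]; have [w' pw' Ew] := T'_par pw.
have [w2 pw2 Ew2] := T'_par pw'.
exists (a *: e_pos i + w2); last by rewrite !gLP !linearP /= T'T'_e Ew Ew2.
apply: (half_sub (@e_pos K G)).1.2; first exact: half_gen.
exact: par_nil_pos pw2.
Qed.

End ReflectionLift.

(** * Zhelobenko operators *)

Section ZhelobenkoOperator.
Variables (K : numFieldType) (G : contragredientLie K).
Variables (U : envelopingAlgebra G) (A : algType K) (iA : {lrmorphism U -> A}).
Variable L : localizedAlgebra iA.
Local Notation n := (km_rank G).
Local Notation H := (h_in G).
Local Notation iD := (D_in L).
Local Notation gL := (g_A' L).
Local Notation env := (env_in U).
Variable i : 'I_n.
Variables (T : {lrmorphism U -> U}) (TA : {lrmorphism A -> A}).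
Variables (T' : {lrmorphism loc_A L -> loc_A L}).
Variables (tau sdot : {lrmorphism loc_D L -> loc_D L}).
Variable q : loc_A L -> left_quot (n_A' L).
Hypothesis admA : admissible iA.
Hypothesis T_lie : forall x, exists y, T (env x) = env y.
Hypothesis T_h : forall z, T (env (H z)) = env (H (simple_reflection i z)).
Hypothesis TA_bij : bijective TA.
Hypothesis TA_T : forall u, TA (iA u) = iA (T u).
Hypothesis T'_TA : forall a, T' (A_in L a) = A_in L (TA a).
Hypothesis tau_shift : is_shift i tau.
Hypothesis sdot_refl : is_shifted_reflection i sdot.
Hypothesis q_q : is_q i tau q.

Local Notation s := (simple_reflection i).
Local Notation e := (gL (e_pos i)).
Local Notation f := (gL (e_neg i)).
Local Notation Hi := (h_D L (coroot i)).
Local Notation pi := (cls (n_A' L)).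
Local Notation pis := (cls (ns_A' (L := L) T')).
Local Notation par := (par_L (L := L) i).
Local Notation vser := (lower_ser f (sl2_inv iD Hi)).
Local Notation vser' := (lower_ser e (sl2_inv' iD Hi)).
Local Notation Nr := (normalizer (n_A' L)).
Local Notation qc := (q_check T' q).

Let tau_sdot := tau_sigma tau_shift sdot_refl.
Let T'D := T'_D T_h TA_T T'_TA tau_shift sdot_refl.
Let sigK := sigmaK tau_shift sdot_refl.
Let sdK := sdotK sdot_refl.
Let tau_surj := tau_surjective tau_shift sdot_refl.
Let n_ker := n_A'_ker (L := L) i.
Let ef := ef_L L i.
Let fd := fd_L tau_shift.
Let de := de_L tau_shift.
Let par_D := @par_L_D _ _ _ _ _ L i.

Definition q_rep a : loc_A L := rep (q a).
Local Notation Q := q_rep.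

Lemma pi_Q a : pi (Q a) = q a. Proof. exact: cls_rep. Qed.

Let pi_M : forall a x, pi x = 0 -> pi (a * x) = 0 := piM n_ker.
Let pi_Ml : forall a x y, pi x = pi y -> pi (a * x) = pi (a * y) := piMl n_ker.
Let pi_D0 : forall x d, pi x = 0 -> pi (x * iD d) = 0 :=
  piD0 de tau_surj par_D n_ker.

Lemma q_rep_base b p : base_part b -> adexp e p b -> pi (Q b) = pi (vser 0 p).
Proof.
move=> [a ->] pa; rewrite pi_Q; have [_ qA _] := q_q.
have [N aN] := ad_nilpotent_pos admA i a.
(* A common cutoff, long enough both for the definition of q and for the polynomial p. *)
rewrite (qA _ (size p + N)%N); last by rewrite iterD aN iter_ad0.
rewrite (@vserE _ _ _ _ (size p + N)) ?leq_addr //; congr (pi _).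
apply: eq_bigr => m _; rewrite pa addn0 /q_term /adexp_coef /lower_pow.
by rewrite -(rmorph_iter_ad (A_in L)) -scalerAl mulrA.
Qed.

Lemma q_rep_D a d : pi (Q (a * iD d)) = pi (Q a * iD (tau d)).
Proof.
have [_ _ qD] := q_q; rewrite pi_Q qD /qmul.
by apply: pi_Ml; exact: cls_rep.
Qed.

Lemma q_repDr a b : pi (Q (a + b)) = pi (Q a) + pi (Q b).
Proof. by have [qDr _ _] := q_q; rewrite !pi_Q. Qed.

Lemma rank_one_q (Ti : loc_A L -> loc_A L) : cancel T' Ti ->
  [/\ forall x, pis x = 0 -> pi (Q x) = 0,
      forall d, pi (Q (iD d)) = pi (iD (tau d)),
      forall y, pi (e * Q y) = 0,
      forall y z, normalizing f par pis y -> par z -> pi (z * Q y) = 0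
    & forall x y, normalizing f par pis y -> pi (Q (x * y)) = pi (Q x * Q y)] /\
  forall y, base_part y -> pi (e * y) = 0 ->
    exists2 d, cartan_part d /\ d \is a GRing.unit &
      forall p, adexp f p (y * iD d) ->
        pi ((iD Hi + 1) * Q (vser' 0 p)) = pi (y * iD d * (iD Hi + 1)).
Proof.
move=> T'K; apply: (rank_one_Q (S := @denominator _ _ _ _ _ L)) => //.
- exact: tau_Hi.
- exact: Hi_unit.
- exact: cartan_adexp.
- exact: cartan_part1.
- exact: cartan_partM.
- exact: cartan_part_tau.
- exact: denominator_cartan.
- exact: denominator_unit.
- exact: denominatorM.
- exact: loc_D_frac.
- exact: base_cartan.
- exact: base_partM.
- exact: base_adexp_e.
- exact: base_adexp_f.
- exact: base_frac.
- exact: par_L_base.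
- exact: par_L_e.
- exact: par_L_f.
- exact: D_par_L.
- exact: (ns_A'_ker T_lie T_h TA_T T'_TA T'K).
- exact: q_repDr.
- exact: q_rep_base.
- exact: q_rep_D.
Qed.

Variable Ti : loc_A L -> loc_A L.
Hypothesis T'K : cancel T' Ti.
Hypothesis TiK : cancel Ti T'.

Let Q_pis : forall x, pis x = 0 -> pi (Q x) = 0.
Proof. by have [[]] := rank_one_q T'K. Qed.
Let Q_cartan : forall d, pi (Q (iD d)) = pi (iD (tau d)).
Proof. by have [[]] := rank_one_q T'K. Qed.
Let e_Q : forall y, pi (e * Q y) = 0.
Proof. by have [[]] := rank_one_q T'K. Qed.
Let par_Q : forall y z, normalizing f par pis y -> par z -> pi (z * Q y) = 0.
Proof. by have [[]] := rank_one_q T'K. Qed.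
Let Q_M : forall x y, normalizing f par pis y -> pi (Q (x * y)) = pi (Q x * Q y).
Proof. by have [[]] := rank_one_q T'K. Qed.

Lemma pi_ind (P : loc_A L -> Prop) : P 0 -> (forall x y, P x -> P y -> P (x + y)) ->
    (forall a w, nil_pos w -> P (a * gL w)) -> forall x, pi x = 0 -> P x.
Proof.
move=> P0 PD Pn x /cls_eq0/left_ideal_addspan.
elim/addspan_ind_additive => // _ [a [_ [[w nw ->] ->]]]; exact: Pn.
Qed.

Lemma pi_n a w : nil_pos w -> pi (a * gL w) = 0.
Proof.
move=> nw; apply/cls_eq0/left_ideal_addspan/addspan_gen.
by exists a, (gL w); split => //; exists w.
Qed.

Lemma pis_T' x : pi x = 0 -> pis (T' x) = 0.
Proof.
elim/pi_ind => [|u v u0 v0|a w nw]; first by rewrite !raddf0.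
  by rewrite !raddfD /= u0 v0 addr0.
apply/cls_eq0/left_ideal_addspan/addspan_gen; exists (T' a), (T' (gL w)).
by rewrite rmorphM; split => //; exists (gL w) => //; exists w.
Qed.

Lemma q_congr a b : pis a = pis b -> q a = q b.
Proof.
move=> /eqP; rewrite -subr_eq0 -raddfB => /eqP ab.
by rewrite -(addrNK b a) -pi_Q q_repDr Q_pis // add0r pi_Q.
Qed.

Lemma q_T'_congr a b : pi a = pi b -> q (T' a) = q (T' b).
Proof.
move=> /eqP; rewrite -subr_eq0 -raddfB => /eqP ab; apply: q_congr.
by apply/eqP; rewrite -subr_eq0 -raddfB -rmorphB; apply/eqP/pis_T'.
Qed.

Lemma q_check_cls x : qc (pi x) = q (T' x).
Proof.
rewrite /q_check /q_induced /T_induced (q_congr (cls_rep _)).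
exact/q_T'_congr/cls_rep.
Qed.

Lemma normalizerP x : Nr x <-> forall w, nil_pos w -> pi (gL w * x) = 0.
Proof.
split=> [Nx w nw|Nx _ [w nw ->]]; apply/cls_eq0; last exact: Nx.
by apply: Nx; exists w.
Qed.

Lemma pi_normalizer x y : Nr y -> pi x = 0 -> pi (x * y) = 0.
Proof.
move=> /normalizerP Ny; elim/pi_ind => [|u v u0 v0|a w nw].
- by rewrite mul0r raddf0.
- by rewrite mulrDl raddfD /= u0 v0 addr0.
- by rewrite -mulrA; apply/pi_M/Ny.
Qed.

Lemma normalizerM x y : Nr x -> Nr y -> Nr (x * y).
Proof.
move=> /normalizerP Nx Ny; apply/normalizerP => w nw; rewrite mulrA.
by apply: pi_normalizer => //; exact: Nx.
Qed.

Lemma normalizer_D d : Nr (iD d).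
Proof.
apply/normalizerP => w nw; apply: pi_D0.
by have := pi_n 1 nw; rewrite mul1r.
Qed.

Lemma Z_alg_cls x : Nr x -> Z_alg (pi x).
Proof. by exists x. Qed.

Lemma qmul_cls x y : Nr y -> qmul (pi x) (pi y) = pi (x * y).
Proof.
move=> Ny; rewrite /qmul (pi_Ml _ (cls_rep (pi y))).
apply/eqP; rewrite -subr_eq0 -raddfB -mulrBl; apply/eqP/pi_normalizer => //.
by rewrite raddfB /= cls_rep subrr.
Qed.

Lemma normalizing_T' x : Nr x -> normalizing f par pis (T' x).
Proof.
move=> /normalizerP Nx; have [c c0 [Te _]] := T'_ef T_lie T_h TA_T T'_TA.
split=> [|_ [z pz ->]].
  have -> : f * T' x = T' (c^-1%:A * (e * x)).
    by rewrite !rmorphM /= rmorph_alg mulr_algl Te scalerAl scalerA mulVf // scale1r.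
  by apply/pis_T'/pi_M/Nx; exact: half_gen.
have [w pw ->] := par_T' T_lie T_h TA_T T'_TA T'K pz.
by rewrite -rmorphM; apply/pis_T'/Nx; exact: par_nil_pos pw.
Qed.

Lemma normalizer_Q x : Nr x -> Nr (Q (T' x)).
Proof.
move=> /normalizing_T' Nx; apply/normalizerP => w /(nil_pos_par i) [a [y [py ->]]].
rewrite gLP mulrDl raddfD /= -scalerAl -mulr_algl.
have -> : pi (a%:A * (e * Q (T' x))) = 0 by exact: pi_M (e_Q _).
by rewrite add0r; apply: par_Q => //; exists y.
Qed.

Lemma q_check_Q x : qc (pi x) = pi (Q (T' x)).
Proof. by rewrite q_check_cls pi_Q. Qed.

Lemma q_check_Z u : Z_alg u -> Z_alg (qc u).
Proof. by move=> [x Nx ->]; rewrite q_check_Q; apply/Z_alg_cls/normalizer_Q. Qed.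

Lemma q_checkD u v : qc (u + v) = qc u + qc v.
Proof.
rewrite -[u]cls_rep -[v]cls_rep -raddfD !q_check_Q rmorphD /=.
exact: q_repDr.
Qed.

Lemma q_checkM u v : Z_alg u -> Z_alg v -> qc (qmul u v) = qmul (qc u) (qc v).
Proof.
move=> [x Nx ->] [y Ny ->]; rewrite qmul_cls // !q_check_Q.
rewrite qmul_cls; last exact: normalizer_Q.
by rewrite rmorphM; apply/Q_M/normalizing_T'.
Qed.

Lemma q_check_D d : qc (D_Z L d) = D_Z L (sdot d).
Proof. by rewrite q_check_Q T'D Q_cartan tau_sdot. Qed.

Lemma Z_alg_D d : Z_alg (D_Z L d).
Proof. exact/Z_alg_cls/normalizer_D. Qed.

Lemma T'T'_pi x : pi x = 0 -> pi (T' (T' x)) = 0.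
Proof.
elim/pi_ind => [|u v u0 v0|a w nw]; first by rewrite !raddf0.
  by rewrite !raddfD /= u0 v0 addr0.
have [w' nw' Ew] := T'T'_n T_lie T_h TA_T T'_TA nw.
by rewrite !rmorphM /= Ew; exact: pi_n.
Qed.

Lemma TiM x y : Ti (x * y) = Ti x * Ti y.
Proof. by apply: (can_inj T'K); rewrite rmorphM /= !TiK. Qed.

Lemma TiD x y : Ti (x + y) = Ti x + Ti y.
Proof. by apply: (can_inj T'K); rewrite rmorphD /= !TiK. Qed.

Lemma TiTi_pi x : pi x = 0 -> pi (Ti (Ti x)) = 0.
Proof.
elim/pi_ind => [|u v u0 v0|a w nw].
- by rewrite -(raddf0 T') T'K -(raddf0 T') T'K raddf0.
- by rewrite !TiD raddfD /= u0 v0 addr0.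
have [w' nw' Ew] := n_T'T' T_lie T_h TA_T T'_TA T'K nw.
by rewrite Ew !TiM !T'K; exact: pi_n.
Qed.

Lemma normalizer_T'T' x : Nr x -> Nr (T' (T' x)).
Proof.
move=> /normalizerP Nx; apply/normalizerP => w nw.
have [w' nw' ->] := n_T'T' T_lie T_h TA_T T'_TA T'K nw.
by rewrite -!rmorphM; apply/T'T'_pi/Nx.
Qed.

Lemma normalizer_TiTi x : Nr x -> Nr (Ti (Ti x)).
Proof.
move=> /normalizerP Nx; apply/normalizerP => w nw.
have [w' nw' Ew] := T'T'_n T_lie T_h TA_T T'_TA nw.
rewrite -[gL w]T'K -[T' (gL w)]T'K Ew -!TiM.
exact/TiTi_pi/Nx.
Qed.

Lemma T_square_cls x : T_square T' (pi x) = pi (T' (T' x)).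
Proof.
apply/eqP; rewrite -subr_eq0 -raddfB -!rmorphB; apply/eqP/T'T'_pi.
by rewrite raddfB /= cls_rep subrr.
Qed.

Lemma T'T'_D y d : T' (T' (y * iD d)) = T' (T' y) * iD d.
Proof. by rewrite !rmorphM /= !T'D sigK. Qed.

(** T_i sends e to c f, f to c^(-1) e and h to - h. The factor c^m from ad(e)^m cancels the c^(-m)
    from f^m, leaving the series of the opposite triple. *)
Lemma T'_vser y p : adexp e p y ->
  exists2 p', adexp f p' (T' y) & T' (vser 0 p) = vser' 0 p'.
Proof.
move=> py; have [c c0 [Te Tf]] := T'_ef T_lie T_h TA_T T'_TA.
have T_iter m : T' (iter m (ad e) y) = c ^+ m *: iter m (ad f) (T' y).
  elim: m => [|m IHm] /=; first by rewrite scale1r.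
  by rewrite rmorph_ad IHm Te adZl adZ scalerA exprS.
have sigma_Hi : sdot (tau Hi) = - Hi.
  rewrite (sigma_h tau_shift sdot_refl) reflection_coroot.
  by rewrite -scaleN1r h_DZ scaleN1r.
have T_inv m : T' (sl2_inv iD Hi m) = sl2_inv' iD Hi m.
  have Pu : \prod_(l < m) (Hi - l%:R) \is a GRing.unit.
    by apply: rpred_prod => l _; exact: unitHn (Hi_unit L i) l.
  rewrite /sl2_inv T'D (rmorphV tau) // (rmorphV sdot) ?rmorph_unit //=.
  rewrite !rmorph_prod /sl2_inv'; congr (iD _^-1); apply: eq_bigr => l _.
  by rewrite !rmorphB /= sigma_Hi !rmorph_nat.
have p'f : adexp f (\poly_(m < size p) ((c^-1) ^+ m *: T' p`_m)) (T' y).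
  move=> m; rewrite coef_poly; case: ltnP => mp.
    rewrite py /adexp_coef linearZ /= T_iter !scalerA; congr (_ *: _).
    by rewrite mulrAC -exprMn mulVf // expr1n mul1r.
  have := congr1 T' (py m); rewrite nth_default // rmorph0 linearZ /= T_iter.
  move/eqP; rewrite eq_sym !scaler_eq0 expf_eq0 (negPf c0) andbF /= => /orP[] /eqP E.
    by rewrite /adexp_coef E scale0r.
  by rewrite /adexp_coef E scaler0.
exists (\poly_(m < size p) ((c^-1) ^+ m *: T' p`_m)) => //.
rewrite [RHS](@vserE _ _ _ _ (size p)) ?size_poly // /lower_ser rmorph_sum.
apply: eq_bigr => m _; rewrite coef_poly ltn_ord !addn0 /lower_pow !rmorphM /= T_inv.
rewrite rmorphXn /= Tf exprZn -scalerAl mulrA -scalerAr -!scalerAl mulrA.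
by [].
Qed.

(** x is replaced by x t, with t in D bringing it within reach of the rank one formula. As [sdot]
    and the reflection are involutions, t comes out unchanged on the right of both sides and
    cancels. *)
Lemma q_check_square x : Nr x ->
  pi ((iD Hi + 1) * Q (T' (Q (T' x)))) = pi (T' (T' x) * (iD Hi + 1)).
Proof.
move=> Nx; have [s0 Ss0 Bx1] := base_frac admA x; set x1 := x * iD s0 in Bx1.
have TB y : base_part y -> base_part (T' y).
  by move=> [a ->]; exists (TA a); exact: T'_TA.
pose y1 := T' (T' x1).
(* e is fixed by T_i^2, so e y1 is the image of e x1 under a map preserving A'n. *)
have ey1 : pi (e * y1) = 0.
  rewrite -(T'T'_e T_lie T_h TA_T T'_TA) -!rmorphM; apply: T'T'_pi.
  rewrite /x1 mulrA; apply: pi_D0; have /normalizerP := Nx; apply.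
  exact: half_gen.
have [_ /(_ y1 (TB _ (TB _ Bx1)) ey1)] := rank_one_q T'K.
move=> [d [Ud d_unit] dE].
pose t := s0 * d; have t_unit : t \is a GRing.unit.
  by rewrite unitrM d_unit andbT; exact: denominator_unit Ss0.
have Ex2 : x1 * iD d = x * iD t by rewrite -mulrA -rmorphM.
clearbody t.
have Ey2 : T' (T' (x1 * iD d)) = y1 * iD d by exact: T'T'_D.
have Bx2 : base_part (x1 * iD d) by apply: base_partM => //; exact: base_cartan.
have [p px2] := base_adexp_e admA i (TB _ Bx2).
have [p' py2 EV] := T'_vser px2.
have := dE p'; rewrite -Ey2 => /(_ py2).
(* [vser' 0 p'] is T_i of a representative of q(T_i(x1 d)), so its value under Q is the square of
   the operator. *)
have -> : pi ((iD Hi + 1) * Q (vser' 0 p')) =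
    pi ((iD Hi + 1) * Q (T' (Q (T' (x1 * iD d))))).
  apply: pi_Ml; rewrite !pi_Q -EV; apply: q_T'_congr; symmetry.
  exact: q_rep_base (TB _ Bx2) px2.
have Eq : pi (Q (T' (Q (T' (x1 * iD d))))) = pi (Q (T' (Q (T' x))) * iD t).
  have E1 : pi (Q (T' (x1 * iD d))) = pi (Q (T' x) * iD (sdot t)).
    by rewrite Ex2 rmorphM /= T'D q_rep_D tau_sdot.
  by rewrite pi_Q (q_T'_congr E1) -pi_Q rmorphM /= T'D q_rep_D tau_sdot sdK.
rewrite (pi_Ml _ Eq) Ex2 T'T'_D.
have hD : iD Hi + 1 = iD (Hi + 1) by rewrite rmorphD rmorph1.
rewrite mulrA hD -[T' (T' x) * _ * _]mulrA -rmorphM [t * _]mulrC rmorphM mulrA.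
exact: (pi_cancelr de tau_surj par_D n_ker t_unit).
Qed.

Local Notation h1 := (Hi + 1).

Lemma h1_unit : h1 \is a GRing.unit.
Proof. exact: Hi_unit L i 1. Qed.

Lemma q_check_qcheck u : Z_alg u ->
  qc (qc u) = qmul (qmul (D_Z L h1^-1) (T_square T' u)) (D_Z L h1).
Proof.
move=> [x Nx ->]; rewrite T_square_cls !q_check_Q -/(Q _).
have NT := normalizer_T'T' Nx.
rewrite (qmul_cls _ NT) (qmul_cls _ (normalizer_D h1)).
rewrite (_ : pi (Q (T' (Q (T' x)))) =
             pi (iD h1^-1 * ((iD Hi + 1) * Q (T' (Q (T' x)))))); last first.
  rewrite mulrA -(rmorph1 iD) -rmorphD -rmorphM mulVr ?h1_unit //.
  by rewrite rmorph1 mul1r.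
by rewrite (pi_Ml _ (q_check_square Nx)) mulrA [iD h1]rmorphD rmorph1.
Qed.

(** By the square formula equal images give equal T_i^2(x) modulo A'n once h + 1 is cancelled, and
    the inverse of T_i^2 preserves A'n. *)
Lemma q_check_inj u v : Z_alg u -> Z_alg v -> qc u = qc v -> u = v.
Proof.
move=> Zu Zv uv.
have [[x Nx Eu] [y Ny Ev]] := (Zu, Zv).
have := q_check_square Nx; have := q_check_square Ny.
have -> : pi ((iD Hi + 1) * Q (T' (Q (T' y)))) = pi ((iD Hi + 1) * Q (T' (Q (T' x)))).
  by apply: pi_Ml; rewrite -!q_check_Q -Ev -Eu uv.
move=> -> /eqP; rewrite -subr_eq0 -raddfB -mulrBl => /eqP xy0.
have hD : iD Hi + 1 = iD h1 by rewrite rmorphD rmorph1.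
have xy1 : pi (T' (T' y) - T' (T' x)) = 0.
  have := pi_D0 h1^-1 xy0; rewrite hD -mulrA -rmorphM divrr ?h1_unit //.
  by rewrite rmorph1 mulr1.
have := TiTi_pi xy1; rewrite -!rmorphB !T'K raddfB => /eqP.
by rewrite subr_eq0 Eu Ev => /eqP.
Qed.

Lemma q_check_surj v : Z_alg v -> exists2 u, Z_alg u & qc u = v.
Proof.
move=> [y Ny ->].
have hD : iD Hi + 1 = iD h1 by rewrite rmorphD rmorph1.
(* Chosen so that the conjugation by h + 1 in the square formula is undone and the square sends x to
   y. *)
pose x := Ti (Ti (iD h1 * y * iD h1^-1)).
have Nx : Nr x.
  apply/normalizer_TiTi/normalizerM; last exact: normalizer_D.
  by apply: normalizerM => //; exact: normalizer_D.
exists (qc (pi x)); first exact/q_check_Z/Z_alg_cls.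
rewrite !q_check_Q; have := q_check_square Nx; rewrite !TiK hD.
rewrite -[_ * iD h1^-1 * _]mulrA -rmorphM mulVr ?h1_unit // rmorph1 mulr1.
exact: (pi_cancell n_ker h1_unit).
Qed.

Lemma qcomm_D_cls d y : Nr y -> qcomm (D_Z L d) (pi y) = pi (iD d * y - y * iD d).
Proof.
move=> Ny; rewrite /qcomm (qmul_cls _ Ny) (qmul_cls _ (normalizer_D d)).
by rewrite raddfB.
Qed.

Lemma q_checkN u : qc (- u) = - qc u.
Proof.
have qc0 : qc 0 = 0 by apply: (addrI (qc 0)); rewrite -q_checkD !addr0.
by apply/eqP; rewrite -addr_eq0 -q_checkD addNr qc0.
Qed.

(** The scalar by which the shifted action differs from the linear reflection drops out of a
    commutator. *)
Lemma q_check_comm z u : Z_alg u ->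
  qc (qcomm (D_Z L (h_D L z)) u) = qcomm (D_Z L (h_D L (s z))) (qc u).
Proof.
move=> Zu; rewrite /qcomm q_checkD q_checkN !q_checkM //; try exact: Z_alg_D.
rewrite -/(qcomm _ _) !q_check_D sdot_refl.
have [y Ny ->] := q_check_Z Zu; rewrite -/(qcomm _ _) !qcomm_D_cls //.
rewrite rmorphB /= rmorph_alg mulrBl mulrBr mulr_algl mulr_algr opprB addrA.
by rewrite subrK.
Qed.

(** Scalars are constants of D, fixed by tau, so homogeneity of q follows from its rule for right
    multiplication by D. *)
Lemma q_check_qscale c u v : Z_alg u -> Z_alg v ->
  qc (qscale c u + v) = qscale c (qc u) + qc v.
Proof.
move=> Zu Zv; rewrite q_checkD /qscale; congr (_ + _).
rewrite -{2}[u]cls_rep !q_check_Q linearZ /= -[c *: T' _]mulr_algr.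
rewrite -(rmorph_alg iD) q_rep_D !rmorph_alg -[c *: _]mulr_algr.
rewrite -(rmorph_alg iD c); apply: (piD de tau_surj par_D n_ker).
by rewrite cls_rep.
Qed.

Lemma q_check_automorphism : is_Z_automorphism qc.
Proof.
split; split.
- exact: q_check_Z.
- exact: q_check_inj.
- exact: q_check_surj.
- exact: q_check_qscale.
- by rewrite q_check_D rmorph1.
- exact: q_checkM.
Qed.

End ZhelobenkoOperator.

Theorem corollary6p3 (R : realType) (G : contragredientLie R[i])
    (U : envelopingAlgebra G) (A : algType R[i]) (iA : {lrmorphism U -> A})
    (T : 'I_(km_rank G) -> {lrmorphism U -> U})
    (TA : 'I_(km_rank G) -> {lrmorphism A -> A})
    (L : localizedAlgebra iA)
    (T' : 'I_(km_rank G) -> {lrmorphism loc_A L -> loc_A L})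
    (tau sdot : 'I_(km_rank G) -> {lrmorphism loc_D L -> loc_D L})
    (q : 'I_(km_rank G) -> loc_A L -> left_quot (n_A' L)) :
  finite_growth G ->
  injective iA ->
  admissible iA ->
  lifts_reflections T ->
  braid_relations T ->
  extends iA T TA ->
  braid_relations TA ->
  (forall i a, T' i (A_in L a) = A_in L (TA i a)) ->
  (forall i, is_shift i (tau i)) ->
  (forall i, is_shifted_reflection i (sdot i)) ->
  (forall i, is_q i (tau i) (q i)) ->
  forall i : 'I_(km_rank G),
    let qc := q_check (T' i) (q i) in
    let hZ z := D_Z L (h_D L z) in
    let h1 := h_D L (coroot i) + 1 in
    (* (i) *)
    (is_Z_automorphism qc /\
     forall x y, Z_alg x -> Z_alg y ->
       [/\ forall z, qc (qcomm (hZ z) x)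
                     = qcomm (hZ (simple_reflection i z)) (qc x),
           forall d, qc (qmul x (D_Z L d)) = qmul (qc x) (D_Z L (sdot i d))
         & qc (qmul x y) = qmul (qc x) (qc y)]) /\
    (* (ii) *)
    forall x, Z_alg x ->
      qc (qc x) = qmul (qmul (D_Z L h1^-1) (T_square (T' i) x)) (D_Z L h1).

Proof.
move=> _ _ admA T_lift _ TA_ext _ T'_TA tau_shift sdot_refl q_q i qc hZ h1.
have [_ T_lie T_h] := T_lift i; have [TA_bij TA_T] := TA_ext i.
have [Ti [T'K TiK]] :=
  T'_bijective T_h TA_bij TA_T (T'_TA i) (tau_shift i) (sdot_refl i).
split; last first.
  exact: (q_check_qcheck admA T_lie T_h TA_T (T'_TA i) (tau_shift i)
    (sdot_refl i) (q_q i) T'K).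
split; first exact: (q_check_automorphism admA T_lie T_h TA_T (T'_TA i)
  (tau_shift i) (sdot_refl i) (q_q i) T'K TiK).
move=> x y Zx Zy.
have qM := q_checkM admA T_lie T_h TA_T (T'_TA i) (tau_shift i)
  (sdot_refl i) (q_q i) T'K.
split=> [z|d|].
- exact: (q_check_comm admA T_lie T_h TA_T (T'_TA i) (tau_shift i)
    (sdot_refl i) (q_q i) T'K).
- have ZD := Z_alg_D (L := L) (tau_shift i) (sdot_refl i) d.
  rewrite /qc qM //; congr (qmul _ _).
  exact: (q_check_D admA T_lie T_h TA_T (T'_TA i) (tau_shift i)
    (sdot_refl i) (q_q i) T'K).
- exact: qM.
Qed.
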